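(* Let $q$ be an even prime power. For each $K$-orbit $o$ of lines of $\mathrm{PG}(5,q)$, the numbers of lines of $o$ contained in a fixed hyperplane belonging to $\mathcal H_1$, $\mathcal H_{2,r}$, $\mathcal H_{2,i}$, $\mathcal H_3$ respectively are: - $o_5$: $\frac12q(q+1)$; $2q^2+q$; $0$; $\frac12q(q+1)$. - $o_6$: $(q+1)^2$; $3q+1$; $q+1$; $q+1$. - $o_{8,1}$: $q^2(q^2-1)$; $(2q+3)(q-1)q^2$; $q^2(q+1)$; $q(q+1)(q^2-1)$. - $o_{8,3}$: $q^2(q+1)$; $2q^2$; $0$; $q(q+1)$. - $o_9$: $q(q^2-1)$; $2q(q^2-1)$; $0$; $q^2(q+1)$. - $o_{10}$: $\frac12q(q-1)$; $q(q-1)$; $q^2$; $\frac12q(q-1)$. - $o_{12,1}$: $q^2+q+1$; $1$; $1$; $1$. - $o_{12,3}$: $(q+1)(q^2-1)$; $(q-1)(2q+1)$; $(q+1)(2q-1)$; $q^2-1$. - $o_{13,1}$: $q^2(q+1)(q^2-1)$; $q^2(q-1)(q+2)$; $q^3(q+1)$; $q(q+1)(q^2-1)$. - $o_{13,3}$: $q^2(q-1)(q^2-1)$; $q^2(q+3)(q-1)^2$; $q^2(q+1)(q^2-1)$; $q(q^2-1)^2$. - $o_{14,1}$: $\frac16q^3(q-1)(q^2-1)$; $\frac16q^3(q-1)^2(q+4)$; $\frac16q^3(q^2-1)(q+2)$; $\frac16q^2(q^2-1)(q^2-2)$. - $o_{15,1}$: $\frac12q^3(q-1)(q^2-1)$;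 $\frac12q^3(q-1)^2(q+2)$; $\frac12q^4(q^2-1)$; $\frac12q^4(q^2-1)$. - $o_{16,1}$: $q(q+1)(q^2-1)$; $q(q^2-1)$; $q(q^2-1)$; $q^2(q+1)$. - $o_{16,3}$: $q(q-1)(q^2-1)$; $q(q-1)^2(q+2)$; $q^2(q^2-1)$; $q^2(q^2-1)$. - $o_{17}$: $\frac13q^3(q-1)(q^2-1)$; $\frac13q^3(q-1)(q^2-1)$; $\frac13q^3(q-1)(q^2-1)$; $\frac13q^2(q^4-1)$.
   Context: A point $(y_0,\dots,y_5)$ of $\mathrm{PG}(5,q)$ is identified with the nonzero symmetric matrix $\begin{bmatrix} y_0&y_1&y_2\\ y_1&y_3&y_4\\ y_2&y_4&y_5\end{bmatrix}$ up to scalar. $K\cong\mathrm{PGL}(3,q)$ acts by $M\mapsto AMA^T$, $A\in\mathrm{GL}(3,q)$. Hyperplanes correspond to conics of $\mathrm{PG}(2,q)$ (nonzero quadratic forms up to scalar): $\sum_{0\le i\le j\le2}a_{ij}X_iX_j$ corresponds to $a_{00}Y_0+a_{01}Y_1+a_{02}Y_2+a_{11}Y_3+a_{12}Y_4+a_{22}Y_5=0$. $\mathcal H_1,\mathcal H_{2,r},\mathcal H_{2,i},\mathcal H_3$ are the $K$-orbits of hyperplanes corresponding respectively to double lines, pairs of distinct real lines (over $\mathbb F_q$), pairs of conjugate imaginary lines (over $\mathbb F_{q^2}$), and non-singular conics (those with $4a_{00}a_{11}a_{22}+a_{01}a_{02}a_{12}-a_{00}a_{12}^2-a_{11}a_{02}^2-a_{22}a_{01}^2\ne0$).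 For $q$ even there are 15 $K$-orbits of lines (a known classification), with representatives as follows, where $(x,y)$ ranges over $\mathrm{PG}(1,q)$ and the symmetric matrix is listed by its rows: $o_5$: $[x,0,0;\,0,y,0;\,0,0,0]$. $o_6$: $[x,y,0;\,y,0,0;\,0,0,0]$. $o_{8,1}$: $[x,0,0;\,0,y,0;\,0,0,-y]$. $o_{8,3}$: $[x,0,0;\,0,0,y;\,0,y,0]$. $o_9$: $[x,0,y;\,0,y,0;\,y,0,0]$. $o_{10}$: $[v_0x,y,0;\,y,x+uy,0;\,0,0,0]$. $o_{12,1}$: $[0,x,0;\,x,0,y;\,0,y,0]$. $o_{12,3}$: $[0,x,0;\,x,x+y,y;\,0,y,0]$. $o_{13,1}$: $[0,x,0;\,x,y,0;\,0,0,-y]$. $o_{13,3}$: $[0,x,0;\,x,x+y,0;\,0,0,y]$. $o_{14,1}$: $[x,0,0;\,0,-(x+y),0;\,0,0,y]$. $o_{15,1}$: $[v_1y,x,0;\,x,ux+y,0;\,0,0,x]$. $o_{16,1}$: $[0,0,x;\,0,x,y;\,x,y,0]$. $o_{16,3}$: $[0,0,x;\,0,x,y;\,x,y,y]$. $o_{17}$: $[\alpha^{-1}x,y,0;\,y,\beta y-\gamma x,x;\,0,x,y]$. Here $u,v_0,v_1,\alpha,\beta,\gamma\in\mathbb F_q$ satisfy: $v_i\lambda^2+uv_i\lambda-1\neq0$ for all $\lambda\in\mathbb F_q$ ($v_i\ne0$, $i=0,1$), and $\lambda^3+\gamma\lambda^2-\beta\lambda+\alpha\ne0$ for all $\lambda\in\mathbb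 F_q$. The orbits do not depend on the choice of these parameters. *)

(* Defs.v *)
From HB Require Import structures.
From mathcomp Require Import all_boot all_order all_fingroup all_algebra all_field.
From mathcomp Require Import mpoly.

Set Implicit Arguments.
Unset Strict Implicit.
Unset Printing Implicit Defensive.

Import GRing.Theory.
Local Open Scope ring_scope.

HB.instance Definition _ (F : finFieldType) (vT : vectType F) :=
  isCountable.Build {vspace vT}
    (pcan_pickleK (can_pcan (@VectorInternalTheory.vs2mxK F vT))).
HB.instance Definition _ (F : finFieldType) (vT : vectType F) :=
  isFinite.Build {vspace vT}
    (pcan_enumP (can_pcan (@VectorInternalTheory.vs2mxK F vT))).

(* PG(5,q) is the projective space of the 6-dimensional space symv F of symmetric
   3 x 3 matrices, the point (y_0, ..., y_5) being the class of the matrix with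
   rows (y_0, y_1, y_2), (y_1, y_3, y_4), (y_2, y_4, y_5).  Projective subspaces
   are vector subspaces of symv F: lines have \dim 2 and hyperplanes \dim 5. *)
Section Defs.

Variable F : finFieldType.

Implicit Types (A M : 'M[F]_3) (f : {mpoly F[3]}) (U H : {vspace 'M[F]_3}).

Definition symv : {vspace 'M[F]_3} := lker (linfun (@trmx F 3 3) - \1%VF).

Lemma memv_sym M : (M \in symv) = (M^T == M).
Proof. by rewrite memv_ker add_lfunE opp_lfunE lfunE id_lfunE subr_eq0. Qed.

Definition congruence A : 'End('M[F]_3) := linfun (mulmxr A^T \o mulmx A).

Lemma congruenceE A M : congruence A M = A *m M *m A^T.
Proof. by rewrite lfunE. Qed.

(* The K-orbit of U: scalar matrices act trivially on subspaces, so that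
   orbits under PGL(3,q) are orbits under GL(3,q). *)
Definition K_orbit U : {set {vspace 'M[F]_3}} :=
  [set (congruence A @: U)%VS | A in unitmx].

(* The line {m x y | (x,y) in PG(1,q)}, for m linear in (x, y). *)
Definition line_of (m : F -> F -> 'M[F]_3) : {vspace 'M[F]_3} :=
  <<[:: m 1%R 0%R; m 0%R 1%R]>>%VS.

(* The coefficient a_ij of X_i X_j. *)
Definition coef2 f (i j : 'I_3) : F := f@_(U_(i) + U_(j))%MM.

(* a_00 Y_0 + a_01 Y_1 + a_02 Y_2 + a_11 Y_3 + a_12 Y_4 + a_22 Y_5, since
   M i j for i <= j lists Y_0, ..., Y_5 in this order. *)
Definition hyperplane_form f M : F^o :=
  \sum_(i < 3) \sum_(j < 3 | (i <= j)%N) coef2 f i j * M i j.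

Lemma hyperplane_form_is_linear f : linear (hyperplane_form f).
Proof.
move=> c M N; rewrite /hyperplane_form scaler_sumr -big_split /=.
apply: eq_bigr => i _; rewrite scaler_sumr -big_split /=.
apply: eq_bigr => j _; rewrite !mxE mulrDr; congr (_ + _).
by rewrite mulrCA.
Qed.

HB.instance Definition _ f :=
  GRing.isLinear.Build F 'M[F]_3 F^o _ (hyperplane_form f)
    (hyperplane_form_is_linear f).

Definition hyperplane f : {vspace 'M[F]_3} :=
  (symv :&: lker (linfun (hyperplane_form f)))%VS.

Lemma mem_hyperplane f M :
  (M \in hyperplane f) = (M^T == M) && (hyperplane_form f M == 0).
Proof. by rewrite memv_cap memv_sym memv_ker lfunE. Qed.

Definition conic f : bool := (f != 0) && (f \is 2.-homog).

(* Nonzero linear forms are proportional exactly when they define the same line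
   of the plane; nonzeroness of l and m below follows from that of the conic. *)
Definition proportional (E : fieldType) (l m : {mpoly E[3]}) : Prop :=
  exists c : E, m = c *: l.

Definition double_line f : Prop :=
  exists (c : F) (l : {mpoly F[3]}), l \is 1.-homog /\ f = c *: l ^+ 2.

Definition real_line_pair f : Prop :=
  exists l m : {mpoly F[3]},
    [/\ l \is 1.-homog, m \is 1.-homog, ~ proportional l m & f = l * m].

(* L is F_(q^2), and conj is x |-> x^q on coefficients. *)
Definition imaginary_line_pair f : Prop :=
  exists (L : finFieldType) (iota : {rmorphism F -> L})
         (c : F) (l : {mpoly L[3]}),
    let conj := map_mpoly (fun x : L => x ^+ #|F|) in
    [/\ #|L| = (#|F| ^ 2)%N, l \is 1.-homog, ~ proportional l (conj l)
      & map_mpoly iota f = iota c *: (l * conj l)].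

Definition nonsingular f : Prop :=
  let a (i j : nat) := coef2 f (inord i) (inord j) in
  4%:R * a 0 0 * a 1 1 * a 2 2 + a 0 1 * a 0 2 * a 1 2
    - a 0 0 * a 1 2 ^+ 2 - a 1 1 * a 0 2 ^+ 2 - a 2 2 * a 0 1 ^+ 2 != 0.

Definition hyperplane_class (P : {mpoly F[3]} -> Prop) H : Prop :=
  exists f, [/\ conic f, P f & H = hyperplane f].

Definition H1 := hyperplane_class double_line.
Definition H2r := hyperplane_class real_line_pair.
Definition H2i := hyperplane_class imaginary_line_pair.
Definition H3 := hyperplane_class nonsingular.

Definition lines_in (o : {set {vspace 'M[F]_3}}) H : rat :=
  #|[set l in o | (l <= H)%VS]|%:R.

Definition hyperplane_numbers (o : {set {vspace 'M[F]_3}})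
    (n1 n2r n2i n3 : rat) : Prop :=
  forall H : {vspace 'M[F]_3},
    [/\ H1 H -> lines_in o H = n1,
        H2r H -> lines_in o H = n2r,
        H2i H -> lines_in o H = n2i
      & H3 H -> lines_in o H = n3].

Definition mx3 (a b c d e f g h k : F) : 'M[F]_3 :=
  \matrix_(i < 3, j < 3)
    nth 0 (nth [::] [:: [:: a; b; c]; [:: d; e; f]; [:: g; h; k]] i) j.

Definition orbit_of (m : F -> F -> 'M[F]_3) := K_orbit (line_of m).

Definition o5 := orbit_of (fun x y => mx3
  x 0 0
  0 y 0
  0 0 0).
Definition o6 := orbit_of (fun x y => mx3
  x y 0
  y 0 0
  0 0 0).
Definition o8_1 := orbit_of (fun x y => mx3
  x 0 0
  0 y 0
  0 0 (- y)).
Definition o8_3 := orbit_of (fun x y => mx3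
  x 0 0
  0 0 y
  0 y 0).
Definition o9 := orbit_of (fun x y => mx3
  x 0 y
  0 y 0
  y 0 0).
Definition o10 (u v0 : F) := orbit_of (fun x y => mx3
  (v0 * x) y           0
  y        (x + u * y) 0
  0        0           0).
Definition o12_1 := orbit_of (fun x y => mx3
  0 x 0
  x 0 y
  0 y 0).
Definition o12_3 := orbit_of (fun x y => mx3
  0 x       0
  x (x + y) y
  0 y       0).
Definition o13_1 := orbit_of (fun x y => mx3
  0 x 0
  x y 0
  0 0 (- y)).
Definition o13_3 := orbit_of (fun x y => mx3
  0 x       0
  x (x + y) 0
  0 0       y).
Definition o14_1 := orbit_of (fun x y => mx3
  x 0           0
  0 (- (x + y)) 0
  0 0           y).
Definition o15_1 (u v1 : F) := orbit_of (fun x y => mx3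
  (v1 * y) x           0
  x        (u * x + y) 0
  0        0           x).
Definition o16_1 := orbit_of (fun x y => mx3
  0 0 x
  0 x y
  x y 0).
Definition o16_3 := orbit_of (fun x y => mx3
  0 0 x
  0 x y
  x y y).
Definition o17 (alpha beta gamma : F) := orbit_of (fun x y => mx3
  (alpha^-1 * x) y                      0
  y              (beta * y - gamma * x) x
  0              x                      y).

End Defs.

(* Main.v *)
From HB Require Import structures.
Require Import Defs.
From mathcomp Require Import all_boot all_order all_fingroup all_algebra all_field.
From mathcomp Require Import all_solvable.
From mathcomp Require Import mpoly.
From mathcomp Require Import ring.
Set Implicit Arguments.
Unset Strict Implicit.
Unset Printing Implicit Defensive.

Import GRing.Theory.
Local Open Scope ring_scope.

(* Count pairs (A, t), A in GL(3,q) and t a conic in a fixed class, with the line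
   A L in the hyperplane of t.  Since K is transitive on each class, the number of
   lines of the orbit of L in such a hyperplane is
     |GL(3,q)| #{t in the class : t contains L} / (|Stab L| |class|).
   In characteristic 2 the polar form of t is alternating; let n be its radical
   vector (the nucleus).  Then t is a double line iff n = 0, and is nonsingular iff
   t(n) <> 0.  Hence the sizes of these two classes, in the space of conics
   containing L, amount to counting zeros of the cubic t(n), which is affine in the
   diagonal coefficients of t.  The two kinds of line pairs are told apart by their
   numbers of zeros, and the total number of zeros of the conics containing L only
   depends on the number of points v with v v^T in L.
   The stabilizers are read off from the equations, except for o17: over an
   algebraic closure its pencil becomes diagonal, as for o14, where the stabilizer
   consists of scaled permutation matrices; those fixed by Frobenius are the ones
   commuting with a 3-cycle. *)

(** * Computing in characteristic 2 *)

(** Each orbit enters only through four numbers: [K] and [T] count the forms t orthogonal to L with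
    n = 0 and with t(n) = 0, [R] counts the vectors v with v v^T in L, and [S] is the order of the
    stabilizer in GL(3,q). Zeros separate the line pairs because a double line and a nonsingular
    conic both have q^2 zero vectors, while a real pair has q(q-1) more and an imaginary pair q(q-1)
    fewer. The excess over q^2 measures the difference of the numbers of pairs of the two kinds;
    t(n) = 0 gives their sum. For [T], one diagonal coefficient of t is left free. Its coefficient
    in t(n) is a combination of squares of the coordinates of n, hence the square of a linear form,
    as every element of F is a square. Off the kernel of that linear form the equation t(n) = 0 has
    exactly one solution; on the kernel a count in two variables remains. The geometric definitions
    of the four classes need only imply the conditions on coefficients, because each of these
    conditions already describes a single orbit up to scalars. *)

Section Char2Constants.
Variables (R : nzRingType) (h : 2%:R = 0 :> R).
Lemma char2N1 : - 1 = 1 :> R.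
Proof. by apply/esym/eqP; rewrite -addr_eq0 -(natrD _ 1 1) h. Qed.
Lemma char2_oppr (x : R) : - x = x.
Proof. by rewrite -mulN1r char2N1 mul1r. Qed.
Lemma char2_3 : 3%:R = 1 :> R. Proof. by rewrite (natrD _ 2 1) h add0r. Qed.
Lemma char2_4 : 4%:R = 0 :> R. Proof. by rewrite (natrM _ 2 2) h mul0r. Qed.
Lemma char2_5 : 5%:R = 1 :> R. Proof. by rewrite (natrD _ 4 1) char2_4 add0r. Qed.
Lemma char2_6 : 6%:R = 0 :> R. Proof. by rewrite (natrM _ 2 3) h mul0r. Qed.
Lemma char2_8 : 8%:R = 0 :> R. Proof. by rewrite (natrM _ 2 4) h mul0r. Qed.
Lemma char2_7 : 7%:R = 1 :> R. Proof. by rewrite (natrD _ 6 1) char2_6 add0r. Qed.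
Lemma char2_9 : 9%:R = 1 :> R. Proof. by rewrite (natrD _ 8 1) char2_8 add0r. Qed.
Lemma char2_10 : 10%:R = 0 :> R. Proof. by rewrite (natrM _ 2 5) h mul0r. Qed.
Lemma char2_11 : 11%:R = 1 :> R. Proof. by rewrite (natrD _ 10 1) char2_10 add0r. Qed.
Lemma char2_12 : 12%:R = 0 :> R. Proof. by rewrite (natrM _ 2 6) h mul0r. Qed.
Lemma char2N2 : - 2%:R = 0 :> R. Proof. by rewrite h oppr0. Qed.
Lemma char2N4 : - 4%:R = 0 :> R. Proof. by rewrite char2_4 oppr0. Qed.
Lemma char2_addrr (x : R) : x + x = 0.
Proof. by rewrite -mulr2n -mulr_natr h mulr0. Qed.
Lemma char2_addr_eq0 (x y : R) : (x + y == 0) = (x == y).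
Proof. by rewrite addr_eq0 char2_oppr. Qed.
Lemma char2N3 : - 3%:R = 1 :> R.
Proof. by rewrite char2_oppr char2_3. Qed.
End Char2Constants.

(* [ring] and [field] divide a monomial only by a syntactically equal
   coefficient, so every coefficient that occurs has to be listed. *)
Ltac ring2 h := ring: h (char2_3 h) (char2_4 h) (char2_5 h)
  (char2_6 h) (char2_7 h) (char2_8 h)
  (char2_9 h) (char2_10 h) (char2_11 h) (char2_12 h) (char2N1 h) (char2N2 h)
  (char2N3 h) (char2N4 h).
Ltac field2 h := field: h (char2_3 h) (char2_4 h) (char2_5 h)
  (char2_6 h) (char2_7 h) (char2_8 h)
  (char2_9 h) (char2_10 h) (char2_11 h) (char2_12 h) (char2N1 h) (char2N2 h)
  (char2N3 h) (char2N4 h).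

(** * 3 x 3 matrices and ternary quadratic forms *)

Section Mat3.
Variable R : comNzRingType.
Implicit Types (A B : 'M[R]_3).

(* [mx3] of [Defs] is restricted to finite fields. *)
Definition mat3 (a b c d e f g h k : R) : 'M[R]_3 :=
  \matrix_(i < 3, j < 3)
    nth 0 (nth [::] [:: [:: a; b; c]; [:: d; e; f]; [:: g; h; k]] i) j.

Lemma ord3P (P : 'I_3 -> Prop) : P 0 -> P 1 -> P (2%:R) -> forall i, P i.
Proof.
move=> P0 P1 P2 [[|[|[|//]]] hi].
- by rewrite (_ : Ordinal hi = 0) //; apply: val_inj.
- by rewrite (_ : Ordinal hi = 1) //; apply: val_inj.
- by rewrite (_ : Ordinal hi = 2%:R) //; apply: val_inj.
Qed.

Lemma mat3_eta A : A = mat3 (A 0 0) (A 0 1) (A 0 2%:R) (A 1 0) (A 1 1)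
  (A 1 2%:R) (A 2%:R 0) (A 2%:R 1) (A 2%:R 2%:R).
Proof. by apply/matrixP; elim/ord3P; elim/ord3P; rewrite mxE. Qed.

Lemma mat3_ind (P : 'M[R]_3 -> Prop) :
  (forall a b c d e f g h k, P (mat3 a b c d e f g h k)) -> forall A, P A.
Proof. by move=> PA A; rewrite [A]mat3_eta; apply: PA. Qed.

Lemma mat3P a b c d e f g h k a' b' c' d' e' f' g' h' k' :
  mat3 a b c d e f g h k = mat3 a' b' c' d' e' f' g' h' k' ->
  [/\ [/\ a = a', b = b' & c = c'], [/\ d = d', e = e' & f = f']
    & [/\ g = g', h = h' & k = k']].
Proof.
move/matrixP=> E.
by move: (E 0 0) (E 0 1) (E 0 2%:R) (E 1 0) (E 1 1) (E 1 2%:R) (E 2%:R 0)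
  (E 2%:R 1) (E 2%:R 2%:R); rewrite !mxE /=; do 9! move->.
Qed.

Lemma mul_mat3 a b c d e f g h k a' b' c' d' e' f' g' h' k' :
  mat3 a b c d e f g h k *m mat3 a' b' c' d' e' f' g' h' k' =
  mat3 (a * a' + b * d' + c * g') (a * b' + b * e' + c * h')
       (a * c' + b * f' + c * k')
       (d * a' + e * d' + f * g') (d * b' + e * e' + f * h')
       (d * c' + e * f' + f * k')
       (g * a' + h * d' + k * g') (g * b' + h * e' + k * h')
       (g * c' + h * f' + k * k').
Proof.
apply/matrixP; elim/ord3P; elim/ord3P;
  by rewrite !mxE !big_ord_recl big_ord0 !mxE /= addr0 addrA.
Qed.

Lemma tr_mat3 a b c d e f g h k :
  (mat3 a b c d e f g h k)^T = mat3 a d g b e h c f k.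
Proof. by apply/matrixP; elim/ord3P; elim/ord3P; rewrite !mxE. Qed.

Lemma add_mat3 a b c d e f g h k a' b' c' d' e' f' g' h' k' :
  mat3 a b c d e f g h k + mat3 a' b' c' d' e' f' g' h' k' =
  mat3 (a + a') (b + b') (c + c') (d + d') (e + e') (f + f') (g + g') (h + h')
       (k + k').
Proof. by apply/matrixP; elim/ord3P; elim/ord3P; rewrite !mxE. Qed.

Lemma scale_mat3 x a b c d e f g h k :
  x *: mat3 a b c d e f g h k =
  mat3 (x * a) (x * b) (x * c) (x * d) (x * e) (x * f) (x * g) (x * h) (x * k).
Proof. by apply/matrixP; elim/ord3P; elim/ord3P; rewrite !mxE. Qed.

Lemma one_mat3 : 1%:M = mat3 1 0 0 0 1 0 0 0 1.
Proof. by apply/matrixP; elim/ord3P; elim/ord3P; rewrite !mxE. Qed.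

Lemma det_mat3 a b c d e f g h k :
  \det (mat3 a b c d e f g h k) =
  a * (e * k - f * h) - b * (d * k - f * g) + c * (d * h - e * g).
Proof.
rewrite (expand_det_row _ ord0) !big_ord_recl big_ord0.
rewrite /cofactor !(expand_det_row _ ord0) !big_ord_recl !big_ord0.
rewrite /cofactor !det_mx11 !mxE /=.
rewrite /bump /= !expr0 !expr1 ?expr2.
ring.
Qed.

End Mat3.

Lemma map_mat3 (R S : comNzRingType) (f : R -> S) (a b c d e g h k l : R) :
  map_mx f (mat3 a b c d e g h k l) =
  mat3 (f a) (f b) (f c) (f d) (f e) (f g) (f h) (f k) (f l).
Proof. by apply/matrixP; elim/ord3P; elim/ord3P; rewrite !mxE. Qed.

Local Notation mat3E := (tr_mat3, mul_mat3, scale_mat3, add_mat3).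
Local Notation simp0 := (mul0r, mulr0, mul1r, mulr1, add0r, addr0).

Section Forms.

Variable F : finFieldType.
Hypothesis char2 : 2%:R = 0 :> F.

Local Notation vec := (F * F * F)%type.

(* (a, b, c, l, m, n) is the form a x^2 + b y^2 + c z^2 + l yz + m xz + n xy *)
Local Notation form := (F * F * F * F * F * F)%type.

Implicit Types (t : form) (v w : vec) (A B M : 'M[F]_3).

(** The left-hand side of the equation of the hyperplane attached to t. Only the upper triangle of M
    is read, which is enough for symmetric M; at M = v v^T the value is that of the form t at v. *)
Definition pairing t M : F :=
  let: (a, b, c, l, m, n) := t in
  a * M 0 0 + b * M 1 1 + c * M 2%:R 2%:R
  + l * M 1 2%:R + m * M 0 2%:R + n * M 0 1.

Definition qeval t v : F :=
  let: (a, b, c, l, m, n) := t in let: (x, y, z) := v in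
  a * x ^+ 2 + b * y ^+ 2 + c * z ^+ 2 + l * (y * z) + m * (x * z) + n * (x * y).

Definition polar t v w : F :=
  let: (a, b, c, l, m, n) := t in
  let: (x, y, z) := v in let: (x', y', z') := w in
  l * (y * z' + z * y') + m * (x * z' + z * x') + n * (x * y' + y * x').

Definition addv3 v w : vec :=
  let: (x, y, z) := v in let: (x', y', z') := w in (x + x', y + y', z + z').

Definition scalev3 (c : F) v : vec :=
  let: (x, y, z) := v in (c * x, c * y, c * z).

Definition colv A (i : 'I_3) : vec := (A 0 i, A 1 i, A 2%:R i).

Definition mulv3 A v : vec :=
  let: (x, y, z) := v in
  addv3 (addv3 (scalev3 x (colv A 0)) (scalev3 y (colv A 1)))
        (scalev3 z (colv A 2%:R)).

Definition pullback t A : form :=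
  (qeval t (colv A 0), qeval t (colv A 1), qeval t (colv A 2%:R),
   polar t (colv A 1) (colv A 2%:R), polar t (colv A 0) (colv A 2%:R),
   polar t (colv A 0) (colv A 1)).

Definition scalef (c : F) t : form :=
  let: (a, b, c', l, m, n) := t in (c * a, c * b, c * c', c * l, c * m, c * n).

Lemma pairing_mat3 a b c l m n x0 x1 x2 x3 x4 x5 x6 x7 x8 :
  pairing (a, b, c, l, m, n) (mat3 x0 x1 x2 x3 x4 x5 x6 x7 x8) =
  a * x0 + b * x4 + c * x8 + l * x5 + m * x2 + n * x1.
Proof. by rewrite /pairing !mxE. Qed.

Lemma pairing_scalef c t M : pairing (scalef c t) M = c * pairing t M.
Proof. by case: t => [[[[[? ?] ?] ?] ?] ?]; rewrite /pairing /=; ring. Qed.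

Lemma qeval_scalef c t v : qeval (scalef c t) v = c * qeval t v.
Proof. by case: t v => [[[[[? ?] ?] ?] ?] ?] [[? ?] ?] /=; ring. Qed.

Lemma colv_mat3 a b c d e f g h k :
  (colv (mat3 a b c d e f g h k) 0 = (a, d, g)) *
  (colv (mat3 a b c d e f g h k) 1 = (b, e, h)) *
  (colv (mat3 a b c d e f g h k) 2%:R = (c, f, k)).
Proof. by rewrite /colv !mxE. Qed.

Lemma qevalD t v w : qeval t (addv3 v w) = qeval t v + qeval t w + polar t v w.
Proof.
by case: t v w => [[[[[? ?] ?] ?] ?] ?] [[? ?] ?] [[? ?] ?] /=; ring2 char2.
Qed.

Lemma qeval_pullback t A v : qeval (pullback t A) v = qeval t (mulv3 A v).
Proof.
elim/mat3_ind: A => a b c d e f g h k; rewrite /pullback /mulv3 !colv_mat3.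
by case: t v => [[[[[? ?] ?] ?] ?] ?] [[? ?] ?] /=; ring2 char2.
Qed.

Lemma mulv3M A B v : mulv3 (A *m B) v = mulv3 A (mulv3 B v).
Proof.
elim/mat3_ind: A => ? ? ? ? ? ? ? ? ?; elim/mat3_ind: B => ? ? ? ? ? ? ? ? ?.
rewrite mul_mat3; case: v => [[? ?] ?]; rewrite /mulv3 !colv_mat3 /=.
by congr (_, _, _); ring.
Qed.

Lemma mulv31 v : mulv3 1%:M v = v.
Proof.
rewrite one_mat3; case: v => [[? ?] ?]; rewrite /mulv3 !colv_mat3 /=.
by congr (_, _, _); ring.
Qed.

(** Diagonal coefficients are values at basis vectors and mixed coefficients are polar values, so
    this holds even over F_2. Identities between pullbacks can thus be checked pointwise. *)
Lemma formP s t : (forall v, qeval s v = qeval t v) -> s = t.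
Proof.
case: s t => [[[[[a b] c] l] m] n] [[[[[a' b'] c'] l'] m'] n'] E.
have P v w : polar (a, b, c, l, m, n) v w = polar (a', b', c', l', m', n') v w.
  have := E (addv3 v w); rewrite !qevalD (E v) (E w); exact: addrI.
have := (E (1, 0, 0), E (0, 1, 0), E (0, 0, 1), P (0, 1, 0) (0, 0, 1),
  P (1, 0, 0) (0, 0, 1), P (1, 0, 0) (0, 1, 0)).
rewrite /qeval /polar !(expr1n, expr0n, mulr0, mul0r, mulr1, addr0, add0r) /=.
by case=> [[[[[-> ->] ->] ->] ->] ->].
Qed.

Lemma pullback_mul t A B : pullback (pullback t A) B = pullback t (A *m B).
Proof. by apply: formP => v; rewrite !qeval_pullback mulv3M. Qed.

Lemma pullback1 t : pullback t 1%:M = t.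
Proof. by apply: formP => v; rewrite !qeval_pullback mulv31. Qed.

Lemma pullback_scalef c t A : pullback (scalef c t) A = scalef c (pullback t A).
Proof. by apply: formP => v; rewrite !(qeval_pullback, qeval_scalef). Qed.

Lemma scalef_scalef c d t : scalef c (scalef d t) = scalef (c * d) t.
Proof. by apply: formP => v; rewrite !qeval_scalef mulrA. Qed.

Lemma scalef1 t : scalef 1 t = t.
Proof. by apply: formP => v; rewrite !qeval_scalef mul1r. Qed.

(** The adjunction behind the double count: congruence on symmetric matrices is dual to substitution
    in forms. *)
Lemma pairing_pullback t A M : M^T = M -> pairing (pullback t A) M = pairing t (A *m M *m A^T).
Proof.
elim/mat3_ind: A => ? ? ? ? ? ? ? ? ?; elim/mat3_ind: M => ? ? ? ? ? ? ? ? ?.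
rewrite tr_mat3 => /mat3P[[_ -> ->] [_ _ ->] _]; rewrite /pullback !colv_mat3.
case: t => [[[[[? ?] ?] ?] ?] ?]; rewrite tr_mat3 !mul_mat3 !pairing_mat3 /=.
ring2 char2.
Qed.

End Forms.

(** * Double counting *)

Section Counting.

Variable F : finFieldType.
Hypothesis char2 : 2%:R = 0 :> F.
Local Notation vec := (F * F * F)%type.
Local Notation form := (F * F * F * F * F * F)%type.
Implicit Types (t : form) (v w : vec) (A B M : 'M[F]_3).

Lemma congruenceM A B : congruence (A *m B) = (congruence A \o congruence B)%VF.
Proof.
by apply/lfunP => M; rewrite comp_lfunE !congruenceE trmx_mul !mulmxA.
Qed.

Lemma congruence1 : congruence 1%:M = \1%VF :> 'End('M[F]_3).
Proof. by apply/lfunP => M; rewrite congruenceE id_lfunE trmx1 mul1mx mulmx1. Qed.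

Lemma unitmx_mull A B : A \in unitmx -> (A *m B \in unitmx) = (B \in unitmx).
Proof. by move=> uA; rewrite unitmx_mul uA. Qed.

Lemma reindex_unit A (g : 'M[F]_3 -> nat) : A \in unitmx ->
  (\sum_(B | B \in unitmx) g B = \sum_(B | B \in unitmx) g (A *m B))%N.
Proof.
move=> uA; rewrite (reindex (fun B => A *m B)) /=.
  by apply: eq_bigl => B; rewrite unitmx_mull.
by exists (fun B => invmx A *m B) => B _; rewrite (mulKmx uA, mulKVmx uA).
Qed.

Definition form_equiv s t : Prop :=
  exists A (c : F), [/\ A \in unitmx, c != 0 & s = scalef c (pullback t A)].

Lemma form_equiv_sym s t : form_equiv s t -> form_equiv t s.
Proof.
move=> [A [c [uA c0 ->]]]; exists (invmx A), c^-1.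
rewrite unitmx_inv invr_eq0 pullback_scalef // pullback_mul // mulmxV //.
by rewrite pullback1 // scalef_scalef // mulVf // scalef1.
Qed.

Lemma form_equiv_trans s t r : form_equiv s t -> form_equiv t r -> form_equiv s r.
Proof.
move=> [A [c [uA c0 ->]]] [B [d [uB d0 ->]]]; exists (B *m A), (c * d).
rewrite unitmx_mul uA uB mulf_neq0 // pullback_scalef // pullback_mul //.
by rewrite scalef_scalef.
Qed.

Section Orbit.
Variables (M1 M2 : 'M[F]_3).
Hypotheses (sym1 : M1^T = M1) (sym2 : M2^T = M2).

Let L : {vspace 'M[F]_3} := <<[:: M1; M2]>>%VS.

Definition perp t : bool := (pairing t M1 == 0) && (pairing t M2 == 0).

Definition stab : {set 'M[F]_3} :=
  [set A in unitmx | [&& A *m M1 *m A^T \in L & A *m M2 *m A^T \in L]].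

Lemma congruence_sub A (U : {vspace 'M[F]_3}) :
  (congruence A @: L <= U)%VS =
  (A *m M1 *m A^T \in U) && (A *m M2 *m A^T \in U).
Proof.
rewrite /L limg_span; apply/span_subvP/andP => /= [sub|[U1 U2] M].
  by split; apply: sub; rewrite !inE -congruenceE eqxx ?orbT.
by rewrite !inE => /orP[]/eqP->; rewrite congruenceE.
Qed.

(** Containment of the images of the two generators suffices, since an invertible A preserves
    dimension. *)
Lemma stabE A : (A \in stab) = (A \in unitmx) && (congruence A @: L == L)%VS.
Proof.
rewrite inE; case: (boolP (A \in unitmx)) => //= uA.
rewrite -congruence_sub; apply/idP/eqP => [sub|->] //.
apply/eqP; rewrite eqEdim sub /= limg_dim_eq //.
apply/eqP; rewrite -subv0; apply/subvP => M; rewrite memv_cap => /andP[_].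
rewrite memv_ker congruenceE memv0 => /eqP/(congr1 (fun N => invmx A *m N *m invmx A^T)).
by rewrite -mulmxA mulmxK ?unitmx_tr // mulKmx // mulmx0 mul0mx => ->.
Qed.

(** Orbit-stabilizer restricted to the lines inside U: the fibres of A |-> A L are the left cosets
    of the stabilizer. *)
Lemma orbit_count (U : {vspace 'M[F]_3}) :
  (#|[set l in K_orbit L | (l <= U)%VS]| * #|stab| =
   \sum_(A | A \in unitmx) (congruence A @: L <= U)%VS)%N.
Proof.
rewrite -big_mkcondr /= (partition_big (fun A => (congruence A @: L)%VS)
  (mem [set l in K_orbit L | (l <= U)%VS])) /=; last first.
  by move=> A /andP[uA sub]; rewrite inE sub andbT; apply/imsetP; exists A.
rewrite -sum_nat_const; apply: eq_bigr => l; rewrite inE => /andP[/imsetP[A uA ->] sub].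
have uA' : invmx A \in unitmx by rewrite unitmx_inv.
rewrite -sum1_card big_mkcond -big_mkcondr big_mkcond [RHS]big_mkcond.
rewrite (reindex (fun B => invmx A *m B)) /=; last first.
  by exists (fun B => A *m B) => B _; rewrite (mulKmx uA, mulKVmx uA).
apply: eq_bigr => B _; rewrite stabE unitmx_mull //; case: (B \in unitmx) => //=.
rewrite congruenceM limg_comp.
have -> : (congruence (invmx A) @: (congruence B @: L) == L)%VS =
          (congruence B @: L == congruence A @: L)%VS.
  apply/eqP/eqP => [{2}<-|->]; rewrite -!limg_comp -!congruenceM ?mulmxA.
    by rewrite mulmxV // mul1mx.
  by rewrite mulVmx // congruence1 lim1g.
by case: eqP => [->|_]; rewrite ?sub ?andbF.
Qed.

Lemma perp_pullback t A : perp (pullback t A) =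
  (pairing t (A *m M1 *m A^T) == 0) && (pairing t (A *m M2 *m A^T) == 0).
Proof. by rewrite /perp !pairing_pullback. Qed.

Lemma perp_scalef c t : c != 0 -> perp (scalef c t) = perp t.
Proof. by move=> c0; rewrite /perp !pairing_scalef !mulf_eq0 (negPf c0). Qed.

(* Counting pairs (A, s) with s in X and s o A orthogonal to L in two ways. *)
Lemma incidence_count (X : pred form) t :
  (forall s A, A \in unitmx -> X s -> X (pullback s A)) ->
  (forall s, X s -> form_equiv s t) ->
  ((\sum_(A : 'M[F]_3 | A \in unitmx) perp (pullback t A)) * #|[pred s | X s]| =
   #|[pred A : 'M[F]_3 | A \in unitmx]| * #|[pred s | X s && perp s]|)%N.
Proof.
move=> Xinv Xtrans.
transitivity (\sum_(s | X s) \sum_(A : 'M[F]_3 | A \in unitmx) perp (pullback s A))%N.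
  rewrite mulnC -sum_nat_const; apply: eq_bigr => s /Xtrans[B [c [uB c0 ->]]].
  rewrite (reindex_unit _ uB); apply: eq_bigr => A _.
  by rewrite pullback_scalef // perp_scalef // pullback_mul.
rewrite exchange_big -sum_nat_const; apply: eq_bigr => A uA.
rewrite -sum1_card big_mkcond [RHS]big_mkcond /=.
rewrite (reindex (fun s => pullback s (invmx A))) /=; last first.
  by exists (fun s => pullback s A) => s _; rewrite pullback_mul // (mulmxV, mulVmx) // pullback1.
apply: eq_bigr => s _; rewrite pullback_mul // mulVmx // pullback1 //.
have -> : X (pullback s (invmx A)) = X s.
  apply/idP/idP => [/(Xinv _ A uA)|]; last by apply: Xinv; rewrite unitmx_inv.
  by rewrite pullback_mul // mulVmx // pullback1.
by rewrite !inE; case: (X s); case: (perp s).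
Qed.

(** Combines the two counts: by the adjunction, A L lies in the hyperplane U of t exactly when t o A
    is orthogonal to L. The result stays a product, so that division waits until the other factors
    are known to be nonzero. *)
Lemma class_count (X : pred form) t (U : {vspace 'M[F]_3}) :
  (forall s A, A \in unitmx -> X s -> X (pullback s A)) ->
  (forall s, X s -> form_equiv s t) ->
  (forall M, M^T = M -> (M \in U) = (pairing t M == 0)) ->
  (#|[set l in K_orbit L | (l <= U)%VS]| * #|stab| * #|[pred s | X s]| =
   #|[pred A : 'M[F]_3 | A \in unitmx]| * #|[pred s | X s && perp s]|)%N.
Proof.
move=> Xinv Xtrans UE; rewrite orbit_count -(incidence_count Xinv Xtrans).
congr (_ * _)%N; apply: eq_bigr => A _; rewrite congruence_sub perp_pullback.
by rewrite !UE // !trmx_mul trmxK (sym1, sym2) mulmxA.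
Qed.

End Orbit.

End Counting.

(** * The four classes of conics *)

Section Classes.

Variable F : finFieldType.
Hypothesis char2 : 2%:R = 0 :> F.
Local Notation vec := (F * F * F)%type.
Local Notation form := (F * F * F * F * F * F)%type.
Implicit Types (t : form) (v w : vec) (A B M : 'M[F]_3).

(** In characteristic 2 squaring is additive with trivial kernel, hence bijective on a finite
    field. *)
Lemma sqrtP (x : F) : exists r, r ^+ 2 = x.
Proof.
have inj : injective (fun y : F => y ^+ 2).
  move=> y z /eqP; rewrite -subr_eq0 => /eqP E; apply/eqP; rewrite -subr_eq0.
  by rewrite -sqrf_eq0 -E; apply/eqP; ring2 char2.
by exists (invF inj x); rewrite (f_invF inj).
Qed.

(* The radical of the polar form, when the latter is nonzero. *)
Definition nucleus t : vec := let: (_, _, _, l, m, n) := t in (l, m, n).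
Definition nucleus_value t : F := qeval t (nucleus t).
(** Separates the line pairs without leaving F: the zeros of a real pair form the union of two
    planes of F^3, which is not closed under addition, and those of an imaginary pair a single line
    through the origin. *)
Definition zeros_additive t : bool := [forall v, forall w,
  (qeval t v == 0) ==> (qeval t w == 0) ==> (qeval t (addv3 v w) == 0)].

(** This and [form_degenerate] express the vanishing of [nucleus] and of [nucleus_value] by values
    of t alone. Their invariance under [pullback] is then mere substitution, and no formula for the
    nucleus of a pullback is needed. *)
Definition form_additive t : bool :=
  [forall v, forall w, qeval t (addv3 v w) == qeval t v + qeval t w].
Definition form_degenerate t : bool := [exists n,
  (n != (0, 0, 0)) && [forall v, qeval t (addv3 v n) == qeval t v]].

(* Double lines, real line pairs, imaginary line pairs, nonsingular conics. *)
Definition class1 t := (nucleus t == (0, 0, 0)) && (t != (0, 0, 0, 0, 0, 0)).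
Definition class2r t :=
  [&& nucleus t != (0, 0, 0), nucleus_value t == 0 & ~~ zeros_additive t].
Definition class2i t :=
  [&& nucleus t != (0, 0, 0), nucleus_value t == 0 & zeros_additive t].
Definition class3 t := nucleus_value t != 0.

Lemma polar_nucleusr t v : polar t v (nucleus t) = 0.
Proof. by case: t v => [[[[[? ?] ?] ?] ?] ?] [[? ?] ?] /=; ring2 char2. Qed.
Lemma polar_nucleusl t v : polar t (nucleus t) v = 0.
Proof. by case: t v => [[[[[? ?] ?] ?] ?] ?] [[? ?] ?] /=; ring2 char2. Qed.
Lemma polarC t v w : polar t v w = polar t w v.
Proof. by case: t v w => [[[[[? ?] ?] ?] ?] ?] [[? ?] ?] [[? ?] ?] /=; ring. Qed.
Lemma polarvv t v : polar t v v = 0.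
Proof. by case: t v => [[[[[? ?] ?] ?] ?] ?] [[? ?] ?] /=; ring2 char2. Qed.
Lemma polarDr t v w u : polar t v (addv3 w u) = polar t v w + polar t v u.
Proof.
by case: t v w u => [[[[[? ?] ?] ?] ?] ?] [[? ?] ?] [[? ?] ?] [[? ?] ?] /=; ring.
Qed.
Lemma polarDl t v w u : polar t (addv3 w u) v = polar t w v + polar t u v.
Proof. by rewrite polarC polarDr !(polarC t v). Qed.
Lemma polarZr t c v w : polar t v (scalev3 c w) = c * polar t v w.
Proof. by case: t v w => [[[[[? ?] ?] ?] ?] ?] [[? ?] ?] [[? ?] ?] /=; ring. Qed.
Lemma polarZl t c v w : polar t (scalev3 c v) w = c * polar t v w.
Proof. by rewrite polarC polarZr polarC. Qed.
Lemma qevalZ t c v : qeval t (scalev3 c v) = c ^+ 2 * qeval t v.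
Proof. by case: t v => [[[[[? ?] ?] ?] ?] ?] [[? ?] ?] /=; ring. Qed.
Lemma qeval0 t : qeval t (0, 0, 0) = 0.
Proof. by case: t => [[[[[? ?] ?] ?] ?] ?] /=; ring. Qed.
Lemma qeval_zero v : qeval (0, 0, 0, 0, 0, 0) v = 0.
Proof. by case: v => [[? ?] ?] /=; ring. Qed.
Lemma add0v3 v : addv3 (0, 0, 0) v = v.
Proof. by case: v => [[? ?] ?] /=; rewrite !add0r. Qed.
Lemma mulv3D A v w : mulv3 A (addv3 v w) = addv3 (mulv3 A v) (mulv3 A w).
Proof.
elim/mat3_ind: A => ? ? ? ? ? ? ? ? ?; case: v w => [[? ?] ?] [[? ?] ?].
by rewrite /mulv3 !colv_mat3 /=; congr (_, _, _); ring.
Qed.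
Lemma mulv30 A : mulv3 A (0, 0, 0) = (0, 0, 0).
Proof. by rewrite /mulv3 /= !mul0r !addr0. Qed.
Lemma mulv3K A : A \in unitmx -> cancel (mulv3 A) (mulv3 (invmx A)).
Proof. by move=> uA v; rewrite -mulv3M mulVmx // mulv31. Qed.
Lemma mulv3VK A : A \in unitmx -> cancel (mulv3 (invmx A)) (mulv3 A).
Proof. by move=> uA v; rewrite -mulv3M mulmxV // mulv31. Qed.
Lemma mulv3_eq0 A v : A \in unitmx -> (mulv3 A v == (0, 0, 0)) = (v == (0, 0, 0)).
Proof.
by move=> uA; rewrite -{1}(mulv30 A) (inj_eq (can_inj (mulv3K uA))).
Qed.

Lemma nucleus_eq0 t : (nucleus t == (0, 0, 0)) = form_additive t.
Proof.
have Hp v w : (qeval t (addv3 v w) == qeval t v + qeval t w) = (polar t v w == 0).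
  by rewrite qevalD // -subr_eq0 addrC addKr.
apply/idP/forallP => [n0 v|add].
  apply/forallP=> w; rewrite Hp; move: n0.
  case: t v w {Hp} => [[[[[? ?] ?] ?] ?] ?] [[? ?] ?] [[? ?] ?] /=.
  by rewrite !xpair_eqE => /andP[/andP[/eqP-> /eqP->] /eqP->]; rewrite !mul0r !addr0.
have {add Hp} P v w : polar t v w == 0 by rewrite -Hp; move/forallP: (add v).
move: (P (0, 1, 0) (0, 0, 1)) (P (1, 0, 0) (0, 0, 1)) (P (1, 0, 0) (0, 1, 0)).
case: t {P} => [[[[[? ?] ?] ?] ?] ?] /=; rewrite !xpair_eqE.
by rewrite !(mulr0, mul0r, mulr1, addr0, add0r) => -> -> ->.
Qed.

(** A vector n whose translation preserves t is a zero of t and lies in the radical of the polar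
    form. That radical is the line spanned by the nucleus, so for n nonzero the nucleus is a
    multiple of n. *)
Lemma degenerate_nucleus t : nucleus t != (0, 0, 0) ->
  (nucleus_value t == 0) = form_degenerate t.
Proof.
move=> n0; apply/idP/existsP => [v0|[n /andP[nz /forallP inv]]].
  exists (nucleus t); rewrite n0; apply/forallP => v.
  by rewrite qevalD // polar_nucleusr -/(nucleus_value t) (eqP v0) !addr0.
have Qn : qeval t n = 0 by move: (inv (0, 0, 0)); rewrite add0v3 qeval0 => /eqP.
have Pn v : polar t v n = 0.
  by move: (inv v); rewrite qevalD // Qn addr0 -subr_eq0 addrC addKr => /eqP.
suff [c ->] : exists c, nucleus_value t = c * qeval t n by rewrite Qn mulr0.
rewrite /nucleus_value.
suff [c ->] : exists c, nucleus t = scalev3 c n by rewrite qevalZ; exists (c ^+ 2).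
(* Orthogonality to the three basis vectors says that the cross product of n with the nucleus
   vanishes. *)
move: (Pn (1, 0, 0)) (Pn (0, 1, 0)) (Pn (0, 0, 1)) nz.
case: t n {n0 inv Qn Pn} => [[[[[a b] c] l] m] n] [[x y] z] /=.
rewrite !(mulr0, mul0r, mul1r, mulr1, addr0, add0r).
move=> /eqP; rewrite char2_addr_eq0 // => /eqP E1.
move=> /eqP; rewrite char2_addr_eq0 // => /eqP E2.
move=> /eqP; rewrite char2_addr_eq0 // => /eqP E3.
rewrite !xpair_eqE !negb_and => /orP[/orP[]|] nz; [exists (l/x)|exists (m/y)|exists (n/z)].
- by congr (_, _, _); apply: (mulIf nz); rewrite mulrAC divfK.
- by congr (_, _, _); apply: (mulIf nz); rewrite mulrAC divfK.
- by congr (_, _, _); apply: (mulIf nz); rewrite mulrAC divfK.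
Qed.

Lemma pullback_invariant (P : pred form) :
  (forall t A, A \in unitmx -> P t -> P (pullback t A)) ->
  forall t A, A \in unitmx -> P (pullback t A) = P t.
Proof.
move=> inv t A uA; apply/idP/idP; last exact: inv.
have uA' : invmx A \in unitmx by rewrite unitmx_inv.
by move=> /(inv _ _ uA'); rewrite pullback_mul // mulmxV // pullback1.
Qed.

Lemma nucleus_pullback t A : A \in unitmx ->
  (nucleus (pullback t A) == (0, 0, 0)) = (nucleus t == (0, 0, 0)).
Proof.
move=> uA; rewrite !nucleus_eq0; move: t A uA; apply: pullback_invariant.
move=> t A uA /forallP add; apply/forallP => v; apply/forallP => w.
by rewrite !qeval_pullback // mulv3D; move/forallP: (add (mulv3 A v)).
Qed.

(** [degenerate_nucleus] needs a nonzero nucleus; when the nucleus is zero, so is that of the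
    pullback, and both values are values at 0. *)
Lemma nucleus_value_pullback t A : A \in unitmx ->
  (nucleus_value (pullback t A) == 0) = (nucleus_value t == 0).
Proof.
move=> uA; have := nucleus_pullback t uA.
have [E|n0] := eqVneq (nucleus t) (0, 0, 0).
  by move=> /eqP E'; rewrite /nucleus_value E E' !qeval0.
move/negbT => n0'; rewrite !degenerate_nucleus //.
move: t A uA {n0 n0'}; apply: pullback_invariant => t A uA /existsP[n /andP[nz /forallP inv]].
apply/existsP; exists (mulv3 (invmx A) n); rewrite mulv3_eq0 ?unitmx_inv // nz.
by apply/forallP => v; rewrite !qeval_pullback // mulv3D mulv3VK.
Qed.

Lemma zeros_additive_pullback t A : A \in unitmx ->
  zeros_additive (pullback t A) = zeros_additive t.
Proof.
move: t A; apply: pullback_invariant.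
move=> t A uA /forallP add; apply/forallP => v; apply/forallP => w.
by rewrite !qeval_pullback // mulv3D; move/forallP: (add (mulv3 A v)).
Qed.

Lemma class1_pullback t A : A \in unitmx -> class1 t -> class1 (pullback t A).
Proof.
move=> uA; rewrite /class1 nucleus_pullback // => /andP[-> /=].
apply: contraNneq => /(congr1 (fun s => pullback s (invmx A))).
rewrite pullback_mul // mulmxV // pullback1 // => ->.
by apply/eqP/(formP char2) => v; rewrite qeval_pullback // !qeval_zero.
Qed.
Lemma class2r_pullback t A : A \in unitmx -> class2r t -> class2r (pullback t A).
Proof.
by move=> uA; rewrite /class2r nucleus_pullback // nucleus_value_pullback //
  zeros_additive_pullback.
Qed.
Lemma class2i_pullback t A : A \in unitmx -> class2i t -> class2i (pullback t A).
Proof.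
by move=> uA; rewrite /class2i nucleus_pullback // nucleus_value_pullback //
  zeros_additive_pullback.
Qed.
Lemma class3_pullback t A : A \in unitmx -> class3 t -> class3 (pullback t A).
Proof. by move=> uA; rewrite /class3 nucleus_value_pullback. Qed.

Definition cols (u v w : vec) : 'M[F]_3 :=
  let: (x, y, z) := u in let: (x', y', z') := v in let: (x'', y'', z'') := w in
  mat3 x x' x'' y y' y'' z z' z''.

Lemma pullback_cols t u v w : pullback t (cols u v w) =
  (qeval t u, qeval t v, qeval t w, polar t v w, polar t u w, polar t u v).
Proof.
by case: u v w => [[? ?] ?] [[? ?] ?] [[? ?] ?]; rewrite /pullback /cols !colv_mat3.
Qed.

(** In three variables an alternating form is a triple product with a fixed vector, here the
    nucleus. So two vectors with nonzero polar value always form a basis together with the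
    nucleus. *)
Lemma det_cols_nucleus t v w : \det (cols v w (nucleus t)) = polar t v w.
Proof.
case: t v w => [[[[[? ?] ?] ?] ?] ?] [[? ?] ?] [[? ?] ?] /=.
by rewrite det_mat3; ring2 char2.
Qed.

Lemma nucleus_polar t : nucleus t != (0, 0, 0) -> exists v w, polar t v w != 0.
Proof.
case: t => [[[[[a b] c] l] m] n] /=; rewrite !xpair_eqE !negb_and.
move=> /orP[/orP[]|] nz; [exists (0, 1, 0), (0, 0, 1)|exists (1, 0, 0), (0, 0, 1)
  |exists (1, 0, 0), (0, 1, 0)];
by rewrite !(mulr0, mul0r, mul1r, mulr1, addr0, add0r).
Qed.

Lemma normal_form1 t : class1 t -> form_equiv t (1, 0, 0, 0, 0, 0).
Proof.
case: t => [[[[[a b] c] l] m] n] /andP[/eqP/= [-> -> ->]].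
have [x <-] := sqrtP a; have [y <-] := sqrtP b; have [z <-] := sqrtP c.
move=> nz.
(* t is the square of the linear form (x, y, z), and the pullback of X^2 reads only the first row of
   A; the other rows just have to make A invertible. *)
suff [A uA [d [e [f [g [h [k E]]]]]]] : exists2 A : 'M[F]_3, A \in unitmx &
    exists d e f g h k, A = mat3 x y z d e f g h k.
  exists A, 1; split; rewrite ?oner_neq0 // scalef1 // E.
  by rewrite /pullback !colv_mat3 /=; congr (_, _, _, _, _, _); ring.
move: nz; rewrite !xpair_eqE eqxx !andbT !sqrf_eq0 !negb_and.
case/orP=> [/orP[]|] nz.
- exists (mat3 x y z 0 1 0 0 0 1); last by do 6 eexists.
  by rewrite unitmxE det_mat3 unitfE; apply: contraNneq nz => <-; apply/eqP; ring.
- exists (mat3 x y z 1 0 0 0 0 1); last by do 6 eexists.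
  by rewrite unitmxE det_mat3 unitfE; apply: contraNneq nz => <-; apply/eqP; ring2 char2.
- exists (mat3 x y z 1 0 0 0 1 0); last by do 6 eexists.
  by rewrite unitmxE det_mat3 unitfE; apply: contraNneq nz => <-; apply/eqP; ring2 char2.
Qed.

Lemma cols_unit t v w : polar t v w != 0 -> cols v w (nucleus t) \in unitmx.
Proof. by move=> nz; rewrite unitmxE det_cols_nucleus unitfE. Qed.

(** Adding r n to a vector, n being the nucleus, keeps polar values and changes its value by r^2
    t(n). Square roots thus turn two vectors with nonzero polar value into zeros of t. With n as
    third basis vector and the second one rescaled, t becomes t(n) (z^2 + xy). *)
Lemma normal_form3 t : class3 t -> form_equiv t (0, 0, 1, 0, 0, 1).
Proof.
rewrite /class3 => phi0; apply: form_equiv_sym => //.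
have /nucleus_polar[v [w d0]] : nucleus t != (0, 0, 0).
  by apply: contraNneq phi0; rewrite /nucleus_value => ->; rewrite qeval0.
pose shift u r := addv3 u (scalev3 r (nucleus t)).
have shift0 u : exists r, qeval t (shift u r) = 0.
  have [r Er] := sqrtP (qeval t u / nucleus_value t); exists r.
  rewrite qevalD // qevalZ polarZr polar_nucleusr -/(nucleus_value t) Er divfK //.
  by rewrite mulr0 addr0 char2_addrr.
have [r Er] := shift0 v; have [s Es] := shift0 w.
have Ep : polar t (shift v r) (shift w s) = polar t v w.
  rewrite polarDr !polarDl !polarZr !polarZl !polar_nucleusr !polar_nucleusl.
  by rewrite !mulr0 !addr0.
set e := nucleus_value t / polar t v w.
exists (cols (shift v r) (scalev3 e (shift w s)) (nucleus t)), (nucleus_value t)^-1.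
rewrite invr_eq0 phi0 cols_unit; last by rewrite polarZr Ep mulf_neq0 // mulf_neq0 ?invr_eq0.
split=> //; rewrite pullback_cols !polarZl !polarZr Ep !polar_nucleusr qevalZ Er Es.
rewrite -/(nucleus_value t) /= !mulr0 mulVf // /e divfK // mulVf //.
Qed.

(** Failure of additivity provides two zeros with nonzero polar value. Together with the nucleus,
    itself a zero, they form a basis in which t is a multiple of xy. *)
Lemma normal_form2r t : class2r t -> form_equiv t (0, 0, 0, 0, 0, 1).
Proof.
move=> /and3P[n0 /eqP phi0 /forallPn[v /forallPn[w]]]; rewrite !negb_imply.
move=> /and3P[/eqP Qv /eqP Qw]; rewrite qevalD // Qv Qw !add0r => d0.
apply: form_equiv_sym => //; exists (cols v w (nucleus t)), (polar t v w)^-1.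
rewrite invr_eq0 cols_unit //; split=> //.
rewrite pullback_cols !polar_nucleusr Qv Qw -/(nucleus_value t) phi0.
by rewrite /= !mulr0 mulVf.
Qed.

(** A zero v with nonzero polar value against some w could be completed by a zero u = w + c v, and v
    + u would not be a zero. Hence t is anisotropic off the radical, and a multiple of x^2 + xy + d
    y^2 in a basis ending with the nucleus. *)
Lemma normal_form2i t : class2i t -> exists d : F,
  (forall x, x ^+ 2 + x + d != 0) /\ form_equiv t (1, d, 0, 0, 0, 1).
Proof.
move=> /and3P[n0 /eqP phi0 /forallP add].
have aniso v w : polar t v w != 0 -> qeval t v != 0.
  move=> d0; apply/eqP => Qv.
  pose u := addv3 w (scalev3 (qeval t w / polar t v w) v).
  have Qu : qeval t u = 0.
    rewrite qevalD // qevalZ Qv mulr0 addr0 polarZr (polarC t w v) divfK //.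
    exact: char2_addrr.
  have /forallP/(_ u) := add v; rewrite Qv Qu eqxx /= qevalD // Qv Qu !add0r.
  by rewrite polarDr polarZr polarvv mulr0 addr0 (negPf d0).
have [v [w d0]] := nucleus_polar n0.
have a0 := aniso _ _ d0; set a := qeval t v in a0.
pose e := a / polar t v w.
have e0 : e != 0 by rewrite mulf_neq0 // invr_eq0.
have Ep : polar t v (scalev3 e w) = a by rewrite polarZr divfK.
exists (qeval t (scalev3 e w) / a); split=> [x|].
  have /aniso : polar t (addv3 (scalev3 x v) (scalev3 e w)) v != 0.
    by rewrite polarDl polarZl polarvv mulr0 add0r polarC Ep.
  rewrite qevalD // qevalZ -/a polarZl Ep; apply: contraNneq => E.
  have -> : qeval t (scalev3 e w) = a * (x ^+ 2 + x).
    move/eqP: E; rewrite char2_addr_eq0 // => /eqP->; by rewrite mulrC divfK.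
  by apply/eqP; ring2 char2.
apply: form_equiv_sym => //; exists (cols v (scalev3 e w) (nucleus t)), a^-1.
rewrite invr_eq0 cols_unit ?Ep //; split=> //.
rewrite pullback_cols !polar_nucleusr -/(nucleus_value t) phi0 Ep -/a.
by rewrite /= !mulr0 mulVf // mulrC.
Qed.

(** The map x |-> x^2 + x is additive with kernel {0, 1}, so its image has index 2 in F, and the sum
    of two elements outside the image lies inside it. *)
Lemma artin_schreier (d e : F) :
  (forall x, x ^+ 2 + x + d != 0) -> (forall x, x ^+ 2 + x + e != 0) ->
  exists x, x ^+ 2 + x = d + e.
Proof.
move=> hd he; pose p (x : F) := x ^+ 2 + x.
have pD x y : p (x + y) = p x + p y by rewrite /p; ring2 char2.
have fib x y : p x = p y -> y = x \/ y = x + 1.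
  move=> E; have : p (x + y) = 0 by rewrite pD E char2_addrr.
  rewrite /p expr2 -{3}[x + y]mulr1 -mulrDr => /eqP; rewrite mulf_eq0.
  case/orP=> [|/eqP E1]; first by rewrite char2_addr_eq0 // => /eqP; left.
  by right; apply: (addrI x); rewrite addrA char2_addrr // add0r; apply/eqP;
     rewrite -(char2_addr_eq0 char2) E1.
pose I := [set p x | x : F].
have cI : (2 * #|I| = #|F|)%N.
  rewrite mulnC -sum_nat_const -[RHS]sum1_card.
  rewrite [RHS](partition_big p (mem I)) /=; last by move=> x _; apply: imset_f.
  apply: eq_bigr => z /imsetP[x _ ->].
  rewrite (eq_bigl (mem [set x; x + 1])) => [|y].
    rewrite sum1_card cards2 -subr_eq0 opprD addrA subrr add0r oppr_eq0.
    by rewrite oner_eq0.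
  rewrite !inE; apply/eqP/orP => [/esym/fib|[]/eqP->//].
    by case=> ->; rewrite eqxx; [left|right].
  by rewrite /p; ring2 char2.
have dI : [disjoint I & [set z + d | z in I]].
  rewrite -setI_eq0; apply/eqP/setP => z; rewrite !inE; apply/negP.
  case/andP=> /imsetP[x _ ->] /imsetP[_ /imsetP[y _ ->]] E.
  by have := hd (x + y); rewrite -/(p (x + y)) pD E -addrA char2_addrr // eqxx.
have full : I :|: [set z + d | z in I] = setT.
  apply/eqP; rewrite eqEcard subsetT cardsT cardsU (disjoint_setI0 dI) cards0 subn0.
  by rewrite (card_imset _ (addIr d)) addnn -mul2n cI /= leqnn.
have := in_setT e; rewrite -full.
rewrite inE => /orP[/imsetP[x _ E]|/imsetP[_ /imsetP[x _ ->] ->]].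
  by have := he x; rewrite -/(p x) -E char2_addrr // eqxx.
by exists x; rewrite -/(p x) addrCA char2_addrr // addr0.
Qed.

Lemma anisotropic_equiv (d e : F) :
  (forall x, x ^+ 2 + x + d != 0) -> (forall x, x ^+ 2 + x + e != 0) ->
  form_equiv (1, d, 0, 0, 0, 1) (1, e, 0, 0, 0, 1).
Proof.
move=> hd he; have [x E] := artin_schreier hd he.
(* Replacing the second basis vector e_2 by e_2 + x e_1 changes its value from e to x^2 + x + e =
   d. *)
exists (cols (1, 0, 0) (x, 1, 0) (0, 0, 1)), 1; rewrite oner_neq0 scalef1 //; split=> //.
  rewrite unitmxE /= det_mat3 unitfE (_ : _ - _ + _ = 1) ?oner_neq0 //; ring.
rewrite pullback_cols /=; congr (_, _, _, _, _, _); try ring2 char2.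
have -> : d = x ^+ 2 + x + e by rewrite E -addrA char2_addrr // addr0.
by ring2 char2.
Qed.

End Classes.

(** * Counting zeros *)

Section Sums.

Variable F : finFieldType.
Local Notation vec := (F * F * F)%type.
Local Notation form := (F * F * F * F * F * F)%type.

Definition qF : rat := #|F|%:R.
Local Notation Q := qF.

Lemma card_rat (T : finType) (P : pred T) : #|[pred x | P x]|%:R = \sum_x (P x)%:R :> rat.
Proof.
rewrite -sum1_card natr_sum big_mkcond /=.
by apply: eq_bigr => x _; rewrite inE; case: (P x).
Qed.

Lemma cardF_gt1 : (1 < #|F|)%N.
Proof.
by rewrite (cardD1 0) (cardD1 1) !inE oner_neq0.
Qed.

Lemma qF_neq0 : Q != 0.
Proof. by rewrite Num.Theory.pnatr_eq0 -lt0n (ltnW cardF_gt1). Qed.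
Lemma qF_sub1_neq0 : Q - 1 != 0.
Proof. by rewrite subr_eq0 /qF Num.Theory.pnatr_eq1 gtn_eqF // cardF_gt1. Qed.

Lemma sum3 (g : vec -> rat) : \sum_v g v = \sum_x \sum_y \sum_z g (x, y, z).
Proof.
rewrite pair_big pair_big /=.
by apply: eq_bigr => [[[x y] z] _].
Qed.

Lemma sum4 (g : F * F * F * F -> rat) :
  \sum_v g v = \sum_a \sum_b \sum_c \sum_d g (a, b, c, d).
Proof.
rewrite !pair_big /=; by apply: eq_bigr => [[[[? ?] ?] ?] _].
Qed.

Lemma sum6 (g : form -> rat) : \sum_t g t =
  \sum_a \sum_b \sum_c \sum_l \sum_m \sum_n g (a, b, c, l, m, n).
Proof. by rewrite !pair_big /=; apply: eq_bigr => [[[[[[? ?] ?] ?] ?] ?] _]. Qed.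

Lemma sumF_const (c : rat) : \sum_(x : F) c = Q * c.
Proof. by rewrite sumr_const mulr_natl. Qed.

Lemma sumF_affine (u w : F) :
  \sum_x (x * u + w == 0)%:R = if u == 0 then Q * (w == 0)%:R else 1 :> rat.
Proof.
case: eqP => [->|/eqP u0].
  by rewrite -sumF_const; apply: eq_bigr => x _; rewrite mulr0 add0r.
rewrite (bigD1 (- w / u)) //= divfK // addNr eqxx big1 ?addr0 // => x.
by rewrite addr_eq0; case: (eqVneq _ (- w)) => // <-; rewrite mulfK ?eqxx.
Qed.

Lemma sumF_affine1 (w u : F) : u != 0 -> \sum_x (x * u + w == 0)%:R = 1 :> rat.
Proof. by rewrite sumF_affine => /negPf->. Qed.

Lemma sumF_eq (e : F) (g : F -> rat) : \sum_x (x == e)%:R * g x = g e.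
Proof.
rewrite (bigD1 e) //= eqxx mul1r big1 ?addr0 // => x /negPf->; exact: mul0r.
Qed.

Lemma sumF_eq1 (e : F) : \sum_x (x == e)%:R = 1 :> rat.
Proof. by rewrite -[RHS](sumF_eq e (fun=> 1)); apply: eq_bigr => x _; rewrite mulr1. Qed.

Lemma sumF_neq (e : F) : \sum_x (x != e)%:R = Q - 1 :> rat.
Proof.
rewrite (eq_bigr (fun x => 1 - (x == e)%:R)) => [|x _].
  by rewrite sumrB sumF_const sumF_eq1 mulr1.
by case: eqP => _; rewrite ?subrr ?subr0.
Qed.

Lemma sumF_split (e : F) (g : F -> rat) (h : rat) :
  (forall x, x != e -> g x = h) -> \sum_x g x = g e + (Q - 1) * h.
Proof.
move=> gh; rewrite (bigD1 e) //=; congr (_ + _).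
rewrite (eq_bigr (fun=> h)) // big_mkcond /= -(sumF_neq e) mulr_suml.
by apply: eq_bigr => x _; case: eqP => _; rewrite ?mul0r ?mul1r.
Qed.

Lemma sum_affine3 (u v w r : F) : (u, v, w) != (0, 0, 0) ->
  \sum_a \sum_b \sum_c (a * u + b * v + c * w + r == 0)%:R = Q ^+ 2 :> rat.
Proof.
rewrite !xpair_eqE !negb_and => /orP[/orP[]|] nz.
- rewrite exchange_big /= -[RHS]mulr1 expr2 -mulrA -sumF_const; apply: eq_bigr => b _.
  rewrite exchange_big /= -sumF_const; apply: eq_bigr => c _.
  rewrite -[RHS](sumF_affine1 (b * v + c * w + r) nz).
  by apply: eq_bigr => a _; congr (nat_of_bool (_ == 0))%:R; ring.
- rewrite -[RHS]mulr1 expr2 -mulrA -sumF_const; apply: eq_bigr => a _.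
  rewrite exchange_big /= -sumF_const; apply: eq_bigr => c _.
  rewrite -[RHS](sumF_affine1 (a * u + c * w + r) nz).
  by apply: eq_bigr => b _; congr (nat_of_bool (_ == 0))%:R; ring.
- rewrite -[RHS]mulr1 expr2 -mulrA -sumF_const; apply: eq_bigr => a _.
  rewrite -sumF_const; apply: eq_bigr => b _.
  rewrite -[RHS](sumF_affine1 (a * u + b * v + r) nz).
  by apply: eq_bigr => c _; congr (nat_of_bool (_ == 0))%:R; ring.
Qed.

Lemma sum_linear4 (u v w r : F) :
  \sum_a \sum_b \sum_c \sum_d (a * u + b * v + c * w + d * r == 0)%:R =
  if [&& u == 0, v == 0, w == 0 & r == 0] then Q ^+ 4 else Q ^+ 3 :> rat.
Proof.
have [->|r0] := eqVneq r 0; last first.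
  rewrite !andbF -[RHS]mulr1 !exprSr expr0 mul1r -!mulrA -sumF_const; apply: eq_bigr => a _.
  rewrite -sumF_const; apply: eq_bigr => b _; rewrite -sumF_const; apply: eq_bigr => c _.
  rewrite -[RHS](sumF_affine1 (a * u + b * v + c * w) r0).
  by apply: eq_bigr => d _; rewrite addrC.
rewrite andbT; have [/and3P[/eqP-> /eqP-> /eqP->]|nz] := ifP.
  rewrite !exprSr expr0 mul1r -!mulrA -[X in Q * (Q * (Q * X))]mulr1.
  do 4 (rewrite -sumF_const; apply: eq_bigr => ? _).
  by rewrite !mulr0 !addr0 eqxx.
rewrite exprS -(@sum_affine3 u v w 0); last by rewrite !xpair_eqE -andbA nz.
rewrite mulr_sumr; apply: eq_bigr => a _; rewrite mulr_sumr; apply: eq_bigr => b _.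
rewrite mulr_sumr; apply: eq_bigr => c _; rewrite -sumF_const; apply: eq_bigr => d _.
by rewrite mulr0.
Qed.
End Sums.

Section Zeros.
Variable F : finFieldType.
Hypothesis char2 : 2%:R = 0 :> F.
Local Notation vec := (F * F * F)%type.
Local Notation form := (F * F * F * F * F * F)%type.
Local Notation Q := (qF F).
Implicit Types (t : form) (v w : vec).

(** Vectors are counted, not projective points, and the zero vector is among them. *)
Definition zeros t : rat := \sum_v (qeval t v == 0)%:R.

Lemma zeros_equiv s t : form_equiv s t -> zeros s = zeros t.
Proof.
move=> [A [c [uA c0 ->]]]; rewrite /zeros [RHS](reindex (mulv3 A)); last first.
  by exists (mulv3 (invmx A)) => v _; rewrite (mulv3K uA, mulv3VK uA).
by apply: eq_bigr => v _; rewrite qeval_scalef mulf_eq0 (negPf c0) qeval_pullback.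
Qed.

Lemma zeros1 t : class1 t -> zeros t = Q ^+ 2.
Proof.
move=> /(normal_form1 char2)/zeros_equiv ->; rewrite /zeros sum3.
rewrite (@sumF_split F 0 _ 0) => [|x x0]; last first.
  rewrite big1 // => y _; rewrite big1 // => z _ /=.
  by rewrite !mul0r !addr0 mul1r expf_eq0 /= (negPf x0).
rewrite mulr0 addr0 (eq_bigr (fun=> Q)) ?sumF_const // => y _.
rewrite (eq_bigr (fun=> 1)) ?sumF_const ?mulr1 // => z _ /=.
by rewrite expr0n !mul0r mulr0 !addr0 eqxx.
Qed.

Lemma zeros3 t : class3 t -> zeros t = Q ^+ 2.
Proof.
move=> /(normal_form3 char2)/zeros_equiv ->; rewrite /zeros sum3.
rewrite (eq_bigr (fun=> Q)) ?sumF_const // => x _.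
rewrite (eq_bigr (fun=> 1)) ?sumF_const ?mulr1 // => y _.
have [r Er] := sqrtP char2 (x * y); rewrite -[RHS](sumF_eq1 r); apply: eq_bigr => z _ /=.
rewrite !mul0r !add0r !addr0 !mul1r -Er char2_addr_eq0 //.
congr (nat_of_bool _)%:R; apply/eqP/eqP => [E|-> //]; apply/eqP.
by rewrite -(char2_addr_eq0 char2) -sqrf_eq0; apply/eqP; rewrite sqrrD E; ring2 char2.
Qed.

Lemma zeros2r t : class2r t -> zeros t = Q * (2%:R * Q - 1).
Proof.
move=> /(normal_form2r char2)/zeros_equiv ->; rewrite /zeros sum3.
have E x y z : (qeval (0, 0, 0, 0, 0, 1) (x, y, z) == 0) = (x == 0) || (y == 0) :> bool.
  by rewrite /= !mul0r !add0r mul1r mulf_eq0.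
under eq_bigr do under eq_bigr do under eq_bigr do rewrite E.
under eq_bigr do under eq_bigr do rewrite sumF_const.
rewrite (@sumF_split F 0 _ Q) => [|x /negPf x0].
  by under eq_bigr do rewrite eqxx /=; rewrite sumF_const; ring.
by under eq_bigr do rewrite x0 /=; rewrite -mulr_sumr sumF_eq1 mulr1.
Qed.

Lemma zeros2i t : class2i t -> zeros t = Q.
Proof.
move=> /(normal_form2i char2)[d [hd /zeros_equiv ->]]; rewrite /zeros sum3.
have E x y z : (qeval (1, d, 0, 0, 0, 1) (x, y, z) == 0) = (x == 0) && (y == 0) :> bool.
  rewrite /= !mul0r !addr0 !mul1r; have [->|y0] := eqVneq y 0.
    by rewrite expr0n !mulr0 !addr0 sqrf_eq0 andbT.
  rewrite andbF; apply/negbTE; apply: contra (hd (x / y)) => /eqP E.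
  have -> : (x / y) ^+ 2 + x / y + d = (x ^+ 2 + d * y ^+ 2 + x * y) / y ^+ 2 by field.
  by rewrite E mul0r.
under eq_bigr do under eq_bigr do under eq_bigr do rewrite E.
under eq_bigr do under eq_bigr do rewrite sumF_const.
rewrite (@sumF_split F 0 _ 0) => [|x /negPf x0].
  by under eq_bigr do rewrite eqxx /=; rewrite -mulr_sumr sumF_eq1; ring.
by under eq_bigr do rewrite x0 /=; rewrite -mulr_sumr big1 ?mulr0.
Qed.

(** [zeros] is q^3 at the zero form and q^2 + e q(q-1) at any other, with e = 1 on real pairs, -1 on
    imaginary pairs and 0 elsewhere; summing over [W] gives the formula for [Z]. The lemma serves
    for the set of all forms and for the forms orthogonal to a line. *)
Lemma class_sizes (W : pred form) (N K T Z : rat) :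
  W (0, 0, 0, 0, 0, 0) ->
  \sum_(t | W t) 1 = N -> \sum_(t | W t) (nucleus t == (0, 0, 0))%:R = K ->
  \sum_(t | W t) (nucleus_value t == 0)%:R = T -> \sum_(t | W t) zeros t = Z ->
  let n c := #|[pred s | c s && W s]|%:R : rat in
  [/\ n (@class1 F) = K - 1, n (@class3 F) = N - T,
   n (@class2r F) + n (@class2i F) = T - K &
   Z = Q ^+ 3 + Q ^+ 2 * (N - 1) + Q * (Q - 1) * (n (@class2r F) - n (@class2i F))].
Proof.
move=> W0 <- <- <- <- n.
have nE c : n c = \sum_(t | W t) (c t)%:R.
  rewrite /n card_rat [RHS]big_mkcond /=; apply: eq_bigr => t _.
  by case: (W t); rewrite (andbT, andbF).
have zE : \sum_(t | W t) (t == (0, 0, 0, 0, 0, 0))%:R = 1 :> rat.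
  rewrite (bigD1 (0, 0, 0, 0, 0, 0)) //= eqxx big1 ?addr0 // => t /andP[_].
  by move/negPf->.
have nv0 t : nucleus t = (0, 0, 0) -> nucleus_value t = 0.
  by rewrite /nucleus_value => ->; rewrite qeval0.
split.
- rewrite nE -[X in _ - X]zE -sumrB; apply: eq_bigr => t _; rewrite /class1.
  have [->|_] := eqVneq t (0, 0, 0, 0, 0, 0); last by rewrite andbT subr0.
  by rewrite andbF /= eqxx subrr.
- by rewrite nE -sumrB; apply: eq_bigr => t _; rewrite /class3; case: eqP.
- rewrite !nE -big_split -sumrB; apply: eq_bigr => t _; rewrite /class2r /class2i /=.
  case: eqP => [/nv0->|_]; rewrite /= ?eqxx ?subrr ?addr0 //.
  by case: (_ == 0); case: (zeros_additive t); rewrite /=; ring.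
rewrite (eq_bigr (fun t => Q ^+ 3 * (t == (0, 0, 0, 0, 0, 0))%:R
  + Q ^+ 2 * (1 - (t == (0, 0, 0, 0, 0, 0))%:R)
  + Q * (Q - 1) * ((class2r t)%:R - (class2i t)%:R))) => [|t _].
  by rewrite !nE !big_split /= -!mulr_sumr !sumrB zE mulr1.
have [->|t0] := eqVneq t (0, 0, 0, 0, 0, 0).
  rewrite /class2r /class2i /= eqxx /= /zeros (eq_bigr (fun=> 1)) => [|v _].
    by rewrite sum3 !sumF_const; ring.
  by rewrite qeval_zero eqxx.
have [n0|n0] := eqVneq (nucleus t) (0, 0, 0).
  rewrite /class2r /class2i n0 eqxx /= zeros1 ?/class1 ?n0 ?eqxx //; ring.
have [v0|v0] := eqVneq (nucleus_value t) 0; last first.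
  by rewrite /class2r /class2i n0 (negPf v0) /= zeros3 //; ring.
have [a|a] := boolP (zeros_additive t).
  rewrite /class2r /class2i n0 v0 eqxx a /= zeros2i /class2i ?n0 ?v0 ?eqxx //; ring.
rewrite /class2r /class2i n0 v0 eqxx a (negPf a) /= zeros2r /class2r ?n0 ?v0 ?eqxx //; ring.
Qed.

End Zeros.

(** * Sizes of the classes, and the numbers of an orbit in terms of K, T, R and S *)

Section Lines.
Variable F : finFieldType.
Hypothesis char2 : 2%:R = 0 :> F.
Local Notation vec := (F * F * F)%type.
Local Notation form := (F * F * F * F * F * F)%type.
Local Notation Q := (qF F).
Implicit Types (t : form) (v w : vec).

Lemma vec_split (g : vec -> rat) (h : rat) :
  (forall v, v != (0, 0, 0) -> g v = h) -> \sum_v g v = g (0, 0, 0) + (Q ^+ 3 - 1) * h.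
Proof.
move=> gh; rewrite (bigD1 (0, 0, 0)) //=; congr (_ + _).
have -> : Q ^+ 3 - 1 = \sum_(v : vec | v != (0, 0, 0)) 1.
  have : \sum_(v : vec) 1 = Q ^+ 3 by rewrite sum3 !sumF_const; ring.
  by rewrite (bigD1 (0, 0, 0)) //= => <-; ring.
by rewrite mulr_suml; apply: eq_bigr => v /gh->; rewrite mul1r.
Qed.

Lemma class_totals : let n c := #|[pred s : form | c s]|%:R : rat in
  [/\ n (@class1 F) = Q ^+ 3 - 1, n (@class3 F) = Q ^+ 2 * (Q - 1) * (Q ^+ 3 - 1),
   n (@class2r F) = Q * (Q + 1) * (Q ^+ 3 - 1) / 2%:R &
   n (@class2i F) = Q * (Q - 1) * (Q ^+ 3 - 1) / 2%:R].
Proof.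
move=> n.
have nE c : n c = #|[pred s | c s && predT s]|%:R.
  by congr _%:R; apply: eq_card => s; rewrite !inE andbT.
(* For [T], a zero nucleus admits all q^3 diagonals and any other nucleus imposes one affine
   equation on the diagonal. For [Z], the zero vector is a zero of all q^6 forms and any other
   vector of q^5 of them. *)
have [] := @class_sizes F char2 predT (Q ^+ 6) (Q ^+ 3)
    (Q ^+ 3 + (Q ^+ 3 - 1) * Q ^+ 2) (Q ^+ 6 + (Q ^+ 3 - 1) * Q ^+ 5) isT.
- by rewrite sum6 !sumF_const; ring.
- rewrite sum6 (eq_bigr (fun=> Q ^+ 2)) => [|a _]; first by rewrite sumF_const; ring.
  rewrite (eq_bigr (fun=> Q)) => [|b _]; first by rewrite sumF_const.
  rewrite (eq_bigr (fun=> 1)) => [|c _]; first by rewrite sumF_const mulr1.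
  rewrite -[LHS](sum3 (fun v => (v == (0, 0, 0))%:R)).
  by rewrite (@vec_split _ 0) => [|v /negPf->] //; rewrite eqxx mulr0 addr0.
- transitivity (\sum_(v : vec) \sum_a \sum_b \sum_c
     (nucleus_value ((a, b, c), v.1.1, v.1.2, v.2) == 0)%:R : rat).
    rewrite sum6 [RHS]exchange_big; apply: eq_bigr => a _.
    rewrite [RHS]exchange_big; apply: eq_bigr => b _.
    rewrite [RHS]exchange_big; apply: eq_bigr => c _.
    by rewrite [RHS]sum3.
  rewrite (@vec_split _ (Q ^+ 2)) => [|[[l m] k] nz].
    congr (_ + _); rewrite -[RHS]mulr1 !exprSr expr0 mul1r -!mulrA.
    do 3 (rewrite -sumF_const; apply: eq_bigr => ? _).
    rewrite /nucleus_value /= (_ : _ == 0) //; apply/eqP; ring.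
  rewrite -(@sum_affine3 _ (l ^+ 2) (m ^+ 2) (k ^+ 2) (l * (m * k) + m * (l * k) + k * (l * m))).
    do 3 (apply: eq_bigr => ? _); rewrite /nucleus_value /=.
    by congr (nat_of_bool (_ == 0))%:R; ring.
  by move: nz; rewrite !xpair_eqE !sqrf_eq0.
- rewrite exchange_big /= (@vec_split _ (Q ^+ 5)) => [|[[x y] z] nz].
    congr (_ + _); rewrite (eq_bigr (fun=> 1)) => [|t _]; last by rewrite qeval0 eqxx.
    by rewrite sum6 !sumF_const; ring.
  transitivity (\sum_(v : vec) \sum_a \sum_b \sum_c
     (qeval ((a, b, c), v.1.1, v.1.2, v.2) (x, y, z) == 0)%:R : rat).
    rewrite sum6 [RHS]exchange_big; apply: eq_bigr => a _.
    rewrite [RHS]exchange_big; apply: eq_bigr => b _.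
    rewrite [RHS]exchange_big; apply: eq_bigr => c _.
    by rewrite [RHS]sum3.
  rewrite (eq_bigr (fun=> Q ^+ 2)) => [|[[l m] k] _].
    by rewrite sum3 !sumF_const; ring.
  rewrite -(@sum_affine3 _ (x ^+ 2) (y ^+ 2) (z ^+ 2) (l * (y * z) + m * (x * z) + k * (x * y))).
    do 3 (apply: eq_bigr => ? _); rewrite /=.
    by congr (nat_of_bool (_ == 0))%:R; ring.
  by move: nz; rewrite !xpair_eqE !sqrf_eq0.
rewrite -!nE => -> -> E1 E2.
have E3 : n (@class2r F) - n (@class2i F) = Q * (Q ^+ 3 - 1).
  have nz : Q * (Q - 1) != 0 by rewrite mulf_neq0 ?qF_neq0 ?qF_sub1_neq0.
  apply: (mulfI nz); apply: (addrI (Q ^+ 3 + Q ^+ 2 * (Q ^+ 6 - 1))).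
  by rewrite -E2; ring.
split; [by ring | by ring | |].
  have -> : n (@class2r F) = (n (@class2r F) + n (@class2i F)
    + (n (@class2r F) - n (@class2i F))) / 2%:R by field.
  by rewrite E1 E3; field.
have -> : n (@class2i F) = (n (@class2r F) + n (@class2i F)
  - (n (@class2r F) - n (@class2i F))) / 2%:R by field.
by rewrite E1 E3; field.
Qed.

Lemma card_unitmx3 : #|[pred A : 'M[F]_3 | A \in unitmx]|%:R =
  Q ^+ 3 * (Q ^+ 3 - 1) * (Q ^+ 2 - 1) * (Q - 1) :> rat.
Proof.
have -> : #|[pred A : 'M[F]_3 | A \in unitmx]| = #|'GL_3[F]%g|.
  rewrite -[RHS](card_imset _ val_inj); apply: eq_card => A; rewrite inE.
  apply/idP/imsetP => [uA|[B _ ->]]; last exact: valP.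
  by exists (Sub A uA); rewrite ?SubK.
rewrite card_GL //.
have q1 k : (0 < #|F| ^ k)%N by rewrite expn_gt0 (ltnW (cardF_gt1 F)).
do 3 rewrite big_ltn //; rewrite big_geq // !natrM !natrB ?q1 // !natrX.
rewrite -/qF; ring.
Qed.

Lemma qF_add1_neq0 : Q + 1 != 0.
Proof. by rewrite -(natrD _ _ 1) Num.Theory.pnatr_eq0 addn1. Qed.
Lemma qF_cube_sub1_neq0 : Q ^+ 3 - 1 != 0.
Proof.
rewrite subr_eq0 -natrX Num.Theory.pnatr_eq1 -(exp1n 3) eqn_exp2r //.
by rewrite gtn_eqF // cardF_gt1.
Qed.

Section Line.
Variables (M1 M2 : 'M[F]_3).
Hypotheses (sym1 : M1^T = M1) (sym2 : M2^T = M2).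
Variables (par : F * F * F * F -> form) (pr : form -> F * F * F * F).
Hypotheses (parK : forall p, pr (par p) = p) (par_perp : forall p, perp M1 M2 (par p))
  (prK : forall t, perp M1 M2 t -> par (pr t) = t).
(** The values of four forms spanning the forms orthogonal to the line. Their common zeros are the v
    with v v^T in the span of [M1] and [M2], so the number [R] below is 1 plus q - 1 for each
    rank-one point of the line. *)
Variables (P1 P2 P3 P4 : vec -> F).
Hypothesis qeval_par : forall a b c d v,
  qeval (par (a, b, c, d)) v = a * P1 v + b * P2 v + c * P3 v + d * P4 v.
Variables K T R S : rat.
Hypotheses
  (KE : \sum_a \sum_b \sum_c \sum_d (nucleus (par (a, b, c, d)) == (0, 0, 0))%:R = K)
  (TE : \sum_a \sum_b \sum_c \sum_d (nucleus_value (par (a, b, c, d)) == 0)%:R = T)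
  (RE : \sum_x \sum_y \sum_z [&& P1 (x, y, z) == 0, P2 (x, y, z) == 0,
          P3 (x, y, z) == 0 & P4 (x, y, z) == 0]%:R = R)
  (SE : #|stab M1 M2|%:R = S).

Lemma sum_perp (g : form -> rat) : \sum_(t | perp M1 M2 t) g t =
  \sum_a \sum_b \sum_c \sum_d g (par (a, b, c, d)).
Proof.
rewrite (reindex_onto par pr) /= => [|t /prK//].
rewrite -(sum4 (fun p => g (par p))).
by apply: eq_bigl => p; rewrite par_perp parK eqxx.
Qed.

Lemma perp_class_sizes : let n c := #|[pred s : form | c s && perp M1 M2 s]|%:R : rat in
  [/\ n (@class1 F) = K - 1, n (@class3 F) = Q ^+ 4 - T,
   n (@class2r F) = (T - K + Q ^+ 2 * R - Q) / 2%:R &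
   n (@class2i F) = (T - K - Q ^+ 2 * R + Q) / 2%:R].
Proof.
move=> n.
(* Each of the [R] common zeros is a zero of all q^4 forms, any other vector of q^3 of them: the
   total is R q^4 + (q^3 - R) q^3. *)
have [] := @class_sizes F char2 (perp M1 M2) (Q ^+ 4) K T (Q ^+ 6 + Q ^+ 3 * (Q - 1) * R).
- by rewrite /perp /=; rewrite !mul0r !addr0 eqxx.
- by rewrite sum_perp !sumF_const; ring.
- by rewrite sum_perp.
- by rewrite sum_perp.
- rewrite exchange_big /= -RE sum3.
  have -> : Q ^+ 6 = \sum_(x : F) \sum_(y : F) \sum_(z : F) Q ^+ 3.
    by rewrite !sumF_const; ring.
  do 3 (rewrite mulr_sumr -big_split /=; apply: eq_bigr => ? _).
  rewrite sum_perp.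
  under eq_bigr do under eq_bigr do under eq_bigr do under eq_bigr do rewrite qeval_par.
  by rewrite sum_linear4; case: [&& _, _, _ & _]; rewrite /=; ring.
rewrite -!/(n _) => -> -> E1 E2.
have E3 : n (@class2r F) - n (@class2i F) = Q ^+ 2 * R - Q.
  have nz : Q * (Q - 1) != 0 by rewrite mulf_neq0 ?qF_neq0 ?qF_sub1_neq0.
  apply: (mulfI nz); apply: (addrI (Q ^+ 3 + Q ^+ 2 * (Q ^+ 4 - 1))).
  by rewrite -E2; ring.
split=> //.
  have -> : n (@class2r F) = (n (@class2r F) + n (@class2i F)
    + (n (@class2r F) - n (@class2i F))) / 2%:R by field.
  by rewrite E1 E3; field.
have -> : n (@class2i F) = (n (@class2r F) + n (@class2i F)
  - (n (@class2r F) - n (@class2i F))) / 2%:R by field.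
by rewrite E1 E3; field.
Qed.

Hypothesis S0 : S != 0.

Variables (t : form) (U : {vspace 'M[F]_3}).
Hypothesis UE : forall M, M^T = M -> (M \in U) = (pairing t M == 0).

Let lines := lines_in (K_orbit <<[:: M1; M2]>>) U.

Lemma lines_in_class (c : pred form) (N n r : rat) :
  (forall s A, A \in unitmx -> c s -> c (pullback s A)) ->
  (forall s, c s -> form_equiv s t) ->
  #|[pred s : form | c s]|%:R = N -> N != 0 ->
  #|[pred s : form | c s && perp M1 M2 s]|%:R = n ->
  r * S * N = Q ^+ 3 * (Q ^+ 3 - 1) * (Q ^+ 2 - 1) * (Q - 1) * n -> lines = r.
Proof.
move=> cinv ctrans NE N0 nE rE.
have /(congr1 (fun k => k%:R : rat)) := class_count char2 sym1 sym2 cinv ctrans UE.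
rewrite !natrM SE NE nE card_unitmx3 -rE => E.
by apply: (mulIf S0); apply: (mulIf N0).
Qed.

(** Here and in the next three lemmas the right-hand side is the order of GL(3,q) divided by the
    size of the class, times the number of conics of the class containing the line. The factor q^3 -
    1 always cancels, and for line pairs so do the two halves. *)
Lemma lines_in_class1 r : class1 t ->
  r * S = Q ^+ 3 * (Q ^+ 2 - 1) * (Q - 1) * (K - 1) -> lines = r.
Proof.
move=> ct rE; have [/= n1 _ _ _] := perp_class_sizes; have [/= N1 _ _ _] := class_totals.
apply: (lines_in_class (@class1_pullback _ char2) _ N1 _ n1).
- move=> s /(normal_form1 char2) E; apply: (form_equiv_trans char2 E).
  exact/(form_equiv_sym char2)/(normal_form1 char2).
- exact: qF_cube_sub1_neq0.
- by rewrite rE; ring.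
Qed.

Lemma lines_in_class3 r : class3 t ->
  r * S = Q * (Q ^+ 2 - 1) * (Q ^+ 4 - T) -> lines = r.
Proof.
move=> ct rE; have [/= _ n1 _ _] := perp_class_sizes; have [/= _ N1 _ _] := class_totals.
apply: (lines_in_class (@class3_pullback _ char2) _ N1 _ n1).
- move=> s /(normal_form3 char2) E; apply: (form_equiv_trans char2 E).
  exact/(form_equiv_sym char2)/(normal_form3 char2).
- by rewrite !mulf_neq0 ?expf_neq0 ?qF_neq0 ?qF_sub1_neq0 ?qF_cube_sub1_neq0.
- by rewrite rE; ring.
Qed.

Lemma lines_in_class2r r : class2r t ->
  r * S = Q ^+ 2 * (Q - 1) ^+ 2 * (T - K + Q ^+ 2 * R - Q) -> lines = r.
Proof.
move=> ct rE; have [/= _ _ n1 _] := perp_class_sizes; have [/= _ _ N1 _] := class_totals.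
apply: (lines_in_class (@class2r_pullback _ char2) _ N1 _ n1).
- move=> s /(normal_form2r char2) E; apply: (form_equiv_trans char2 E).
  exact/(form_equiv_sym char2)/(normal_form2r char2).
- by rewrite !mulf_neq0 ?invr_eq0 ?qF_neq0 ?qF_add1_neq0 ?qF_cube_sub1_neq0.
- by rewrite rE; field.
Qed.

Lemma lines_in_class2i r : class2i t ->
  r * S = Q ^+ 2 * (Q ^+ 2 - 1) * (T - K - Q ^+ 2 * R + Q) -> lines = r.
Proof.
move=> ct rE; have [/= _ _ _ n1] := perp_class_sizes; have [/= _ _ _ N1] := class_totals.
apply: (lines_in_class (@class2i_pullback _ char2) _ N1 _ n1).
- move=> s /(normal_form2i char2)[d [hd E]]; apply: (form_equiv_trans char2 E).
  have [e [he E']] := normal_form2i char2 ct.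
  apply: (form_equiv_trans char2 (anisotropic_equiv char2 hd he)).
  exact/(form_equiv_sym char2).
- by rewrite !mulf_neq0 ?invr_eq0 ?qF_neq0 ?qF_sub1_neq0 ?qF_cube_sub1_neq0.
- by rewrite rE; field.
Qed.

End Line.
End Lines.

(** * From polynomials to coefficients *)

Section LinearForms.
Variable F : finFieldType.
Implicit Types (l m f : {mpoly F[3]}).

Definition coeffs f : F * F * F * F * F * F :=
  (coef2 f 0 0, coef2 f 1 1, coef2 f 2%:R 2%:R, coef2 f 1 2%:R, coef2 f 0 2%:R,
   coef2 f 0 1).

Lemma hyperplane_formE f M : hyperplane_form f M = pairing (coeffs f) M.
Proof.
rewrite /hyperplane_form /pairing /=.
have e1 : lift ord0 ord0 = 1 :> 'I_3 by apply: val_inj.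
have e2 : lift ord0 (lift ord0 ord0) = 2%:R :> 'I_3 by apply: val_inj.
have e0 : ord0 = 0 :> 'I_3 by apply: val_inj.
under eq_bigr do rewrite big_mkcond.
rewrite !big_ord_recl !big_ord0 /= e1 e2 e0.
move: (coef2 f 0 0) (coef2 f 1 1) (coef2 f 2%:R 2%:R) (coef2 f 1 2%:R).
by move: (coef2 f 0 2%:R) (coef2 f 0 1) => *; ring.
Qed.

Lemma mnm_pairE (i j k n : 'I_3) : (U_(i) + U_(j) == U_(k) + U_(n))%MM =
  ((i == k) && (j == n)) || ((i == n) && (j == k)).
Proof.
have inj (a b : 'I_3) : U_(a)%MM = U_(b)%MM -> a = b.
  by move=> /mnmP/(_ a); rewrite !mnm1E eqxx; case: eqP.
apply/eqP/idP => [E|/orP[]/andP[/eqP-> /eqP->] //]; last by rewrite addmC.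
have /mnmP/(_ i) := E; rewrite !mnmDE !mnm1E eqxx; move: E.
have [<- /addmI/inj<- _|_] := eqVneq k i; first by rewrite !eqxx.
have [<-|_ _ //] := eqVneq n i.
by rewrite [RHS]addmC => /addmI/inj<- _; rewrite !eqxx orbT.
Qed.

Lemma linear_formE l : l \is 1.-homog ->
  l = l@_U_(0) *: 'X_0 + l@_U_(1) *: 'X_1 + l@_U_(2%:R) *: 'X_(2%:R).
Proof.
move=> hl; apply/mpolyP => m; rewrite !mcoeffD !mcoeffZ !mcoeffX.
have [/eqP|d] := eqVneq (mdeg m) 1%N; last first.
  rewrite (dhomog_nemf_coeff hl d).
  have nz i : (U_(i)%MM == m) = false.
    by apply: contraNF d => /eqP<-; rewrite mdeg1.
  by rewrite !nz !mulr0 !addr0.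
rewrite mdeg_eq1 => /existsP[i /eqP->].
have inj (j k : 'I_3) : (U_(j) == U_(k) :> 'X_{1..3})%MM = (j == k).
  apply/eqP/eqP => [/mnmP/(_ k)|->] //; rewrite !mnm1E eqxx; by case: eqP.
rewrite !inj; elim/ord3P: i; rewrite /= ?mulr1 ?mulr0 ?addr0 ?add0r //.
Qed.

Lemma coef2_mul l m i j : l \is 1.-homog -> m \is 1.-homog ->
  coef2 (l * m) i j = if i == j then l@_U_(i) * m@_U_(i)
                      else l@_U_(i) * m@_U_(j) + l@_U_(j) * m@_U_(i).
Proof.
move=> /linear_formE {1}-> /linear_formE {1}->.
rewrite /coef2 !(mulrDl, mulrDr) -!(scalerAl, scalerAr) -!mpolyXD.
rewrite !(mcoeffD, mcoeffZ, mcoeffX) !mnm_pairE.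
elim/ord3P: i; elim/ord3P: j; rewrite /=;
  move: (l@_U_(0)) (l@_U_(1)) (l@_U_(2%:R)) (m@_U_(0)) (m@_U_(1)) (m@_U_(2%:R));
  by move=> *; ring.
Qed.
End LinearForms.

Section Products.
Variable F : finFieldType.
Implicit Types (l m f : {mpoly F[3]}).

Lemma coeffs_mul l m : l \is 1.-homog -> m \is 1.-homog ->
  coeffs (l * m) = (l@_U_(0) * m@_U_(0), l@_U_(1) * m@_U_(1),
    l@_U_(2%:R) * m@_U_(2%:R), l@_U_(1) * m@_U_(2%:R) + l@_U_(2%:R) * m@_U_(1),
    l@_U_(0) * m@_U_(2%:R) + l@_U_(2%:R) * m@_U_(0),
    l@_U_(0) * m@_U_(1) + l@_U_(1) * m@_U_(0)).
Proof. by move=> hl hm; rewrite /coeffs !coef2_mul. Qed.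

Lemma coeffsZ c f : coeffs (c *: f) = scalef c (coeffs f).
Proof. by rewrite /coeffs /coef2 !mcoeffZ. Qed.

Lemma linear_form_neq0 l : l \is 1.-homog -> l != 0 ->
  [|| l@_U_(0) != 0, l@_U_(1) != 0 | l@_U_(2%:R) != 0].
Proof.
move=> /linear_formE E; apply: contraNT; rewrite !negb_or !negbK.
by case/and3P=> /eqP e0 /eqP e1 /eqP e2; rewrite E e0 e1 e2 !scale0r !addr0.
Qed.

(** Used through its contrapositive: non-proportional linear forms have a nonzero 2 x 2 minor. *)
Lemma proportional_minors l m : l \is 1.-homog -> m \is 1.-homog -> l != 0 ->
  l@_U_(1) * m@_U_(2%:R) = l@_U_(2%:R) * m@_U_(1) ->
  l@_U_(0) * m@_U_(2%:R) = l@_U_(2%:R) * m@_U_(0) ->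
  l@_U_(0) * m@_U_(1) = l@_U_(1) * m@_U_(0) -> proportional l m.
Proof.
move=> hl hm /(linear_form_neq0 hl) nz E0 E1 E2.
suff [c [e0 e1 e2]] : exists c, [/\ m@_U_(0) = c * l@_U_(0), m@_U_(1) = c * l@_U_(1)
    & m@_U_(2%:R) = c * l@_U_(2%:R)].
  exists c; rewrite {1}(linear_formE hm) e0 e1 e2 {4}(linear_formE hl).
  by rewrite !scalerDr !scalerA.
move: E0 E1 E2 nz.
move: (l@_U_(0)) (l@_U_(1)) (l@_U_(2%:R)) (m@_U_(0)) (m@_U_(1)) (m@_U_(2%:R)).
move=> a b c a' b' c' E0 E1 E2 /or3P[] nz; [exists (a'/a)|exists (b'/b)|exists (c'/c)].
- by split; apply: (mulfI nz); rewrite [RHS]mulrA [a * (a' / a)]mulrC divfK // ?E2 ?E1 mulrC.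
- by split; apply: (mulfI nz); rewrite [RHS]mulrA [b * (b' / b)]mulrC divfK // -?E2 ?E0 mulrC.
- by split; apply: (mulfI nz); rewrite [RHS]mulrA [c * (c' / c)]mulrC divfK // -?E0 -?E1 mulrC.
Qed.
End Products.

(** The additive group of F is a 2-group, so the exponent is a power of 2. *)
Lemma frobeniusD (F : finFieldType) (K : comNzRingType) (x y : K) :
  2%:R = 0 :> F -> 2%:R = 0 :> K -> (x + y) ^+ #|F| = x ^+ #|F| + y ^+ #|F|.
Proof.
move=> h2 h2'; apply: exprDn_pchar.
have p2 : 2%N \in [pchar F] by rewrite inE h2 eqxx.
have /and3P[+ _ _] := fin_ring_pchar_abelem p2; rewrite /pgroup cardsT => n2.
apply: sub_in_pnat n2 => p _; rewrite !inE => /eqP->.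
by rewrite h2' eqxx.
Qed.

(** * From the geometric definitions of the four classes to conditions on coefficients *)

Section Hyperplanes.
Variable F : finFieldType.
Hypothesis char2 : 2%:R = 0 :> F.
Implicit Types (f : {mpoly F[3]}) (H : {vspace 'M[F]_3}).

Lemma hyperplane_pairing f M : M^T = M ->
  (M \in hyperplane f) = (pairing (coeffs f) M == 0).
Proof. by move=> sM; rewrite mem_hyperplane sM eqxx hyperplane_formE. Qed.

Lemma double_line_class f : conic f -> double_line f -> class1 (coeffs f).
Proof.
move=> /andP[f0 _] [c [l [hl fE]]].
have c0 : c != 0 by apply: contraNneq f0 => c0; rewrite fE c0 scale0r.
have l0 : l != 0 by apply: contraNneq f0 => l0; rewrite fE l0 expr0n scaler0.
have := linear_form_neq0 hl l0; rewrite fE expr2 coeffsZ coeffs_mul //.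
move: (l@_U_(0)) (l@_U_(1)) (l@_U_(2%:R)) => x y z nz.
rewrite /class1 /= ![_ + z * _]addrC ![_ + y * _]addrC.
rewrite ![z * _]mulrC ![y * x]mulrC !char2_addrr // mulr0 eqxx !xpair_eqE !mulf_eq0.
by rewrite (negPf c0) /= !orbb eqxx !andbT !negb_and orbA in nz *.
Qed.

(** f is the pullback of xy by any invertible matrix whose first two rows are the two linear forms,
    so it suffices to treat xy. *)
Lemma real_line_pair_class f : conic f -> real_line_pair f -> class2r (coeffs f).
Proof.
move=> /andP[f0 _] [l [m [hl hm np fE]]].
have l0 : l != 0 by apply: contraNneq f0 => l0; rewrite fE l0 mul0r.
have := fun E0 E1 E2 => np (proportional_minors hl hm l0 E0 E1 E2).
rewrite fE coeffs_mul //.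
move: (l@_U_(0)) (l@_U_(1)) (l@_U_(2%:R)) (m@_U_(0)) (m@_U_(1)) (m@_U_(2%:R)).
move=> a b c a' b' c' nz.
(* The third row is a unit vector selecting a nonzero 2 x 2 minor of the first two. *)
have [r [s [t dt]]] : exists r s t, \det (mat3 a b c a' b' c' r s t) != 0.
  have [E0|n0] := eqVneq (b * c') (c * b'); last first.
    by exists 1, 0, 0; apply: contraNneq n0; rewrite det_mat3 => E; rewrite -subr_eq0 -E;
      apply/eqP; ring.
  have [E1|n1] := eqVneq (a * c') (c * a'); last first.
    by exists 0, 1, 0; apply: contraNneq n1; rewrite det_mat3 => E;
      rewrite -subr_eq0 -oppr_eq0 -E; apply/eqP; ring.
  have [E2|n2] := eqVneq (a * b') (b * a'); last first.
    by exists 0, 0, 1; apply: contraNneq n2; rewrite det_mat3 => E; rewrite -subr_eq0 -E;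
      apply/eqP; ring.
  by case: nz.
have uA : mat3 a b c a' b' c' r s t \in unitmx by rewrite unitmxE unitfE.
have -> : (a * a', b * b', c * c', b * c' + c * b', a * c' + c * a', a * b' + b * a')
    = pullback (0, 0, 0, 0, 0, 1) (mat3 a b c a' b' c' r s t).
  by rewrite /pullback !colv_mat3 /=; congr (_, _, _, _, _, _); ring.
apply: class2r_pullback => //; rewrite /class2r /nucleus_value /=.
rewrite !xpair_eqE oner_eq0 andbF expr0n !(mul0r, mulr0, addr0) eqxx /=.
apply/forallPn; exists (1, 0, 0); apply/forallPn; exists (0, 1, 0).
by rewrite /= !(mul0r, mulr0, mulr1, mul1r, addr0, add0r) eqxx /= oner_eq0.
Qed.

(** At a vector v over F the conjugate of l takes the value l(v)^q, so f(v) = c l(v)^(q+1). The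
    zeros of f are thus those of l, which are closed under addition. The nucleus is a multiple of
    the cross product of l and its conjugate, on which l vanishes. *)
Lemma imaginary_line_pair_class f : conic f -> imaginary_line_pair f ->
  class2i (coeffs f).
Proof.
move=> /andP[f0 _] [L [iota [c [l /= [cL hl np fE]]]]].
have char2L : 2%:R = 0 :> L by rewrite -(rmorph_nat iota) char2 rmorph0.
set m := map_mpoly _ l in np fE.
have iotaK : injective iota by apply: fmorph_inj.
have f0' : map_mpoly iota f != 0.
  apply: contra f0 => /eqP E; apply/eqP/mpolyP => k.
  by have := congr1 (mcoeff k) E; rewrite mcoeff_map_mpoly !mcoeff0 => /eqP;
    rewrite fmorph_eq0 => /eqP.
have c0 : iota c != 0 by apply: contraNneq f0' => c0; rewrite fE c0 scale0r.
have l0 : l != 0 by apply: contraNneq f0' => l0; rewrite fE l0 mul0r scaler0.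
have qB : {morph (fun x : L => x ^+ #|F|) : x y / x - y}.
  by move=> x y; rewrite !(char2_oppr char2L) (frobeniusD _ _ char2 char2L).
(* Bundled as an additive map so that [mcoeff_map_mpoly] applies. *)
pose fr : {additive L -> L} := HB.pack (fun x : L => x ^+ #|F|)
  (GRing.isZmodMorphism.Build L L (fun x : L => x ^+ #|F|) qB).
have mE k : m@_k = l@_k ^+ #|F| by rewrite -[RHS]/(fr l@_k) -mcoeff_map_mpoly.
have hm : m \is 1.-homog.
  apply/dhomogP => k; rewrite mcoeff_msupp mE expf_eq0 negb_and.
  by case/orP=> [|nz]; [rewrite -eqn0Ngt (gtn_eqF (ltnW (cardF_gt1 F)))|
     by apply: (dhomog_mf hl); rewrite mcoeff_msupp].
have npE := fun E0 E1 E2 => np (proportional_minors hl hm l0 E0 E1 E2).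
have := coeffs_mul hl hm; move: npE; rewrite !mE.
clearbody m; move: (l@_U_(0)) (l@_U_(1)) (l@_U_(2%:R)) => p q r npE.
move=> /(congr1 (scalef (iota c))); rewrite -coeffsZ -fE /coeffs /coef2 !mcoeff_map_mpoly /=.
rewrite -!/(coef2 _ _ _).
move: (coef2 f 0 0) (coef2 f 1 1) (coef2 f 2%:R 2%:R) (coef2 f 1 2%:R)
  (coef2 f 0 2%:R) (coef2 f 0 1) => x0 x1 x2 x3 x4 x5 [E0 E1 E2 E3 E4 E5].
have norm v : iota (qeval (x0, x1, x2, x3, x4, x5) v) =
    iota c * (p * iota v.1.1 + q * iota v.1.2 + r * iota v.2) ^+ (#|F|.+1).
  case: v => [[x y] z] /=; rewrite [X in iota c * X]exprS !(frobeniusD _ _ char2 char2L) !exprMn.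
  rewrite -!rmorphXn !expf_card !(rmorphD, rmorphM, rmorphXn) /= E0 E1 E2 E3 E4 E5.
  by ring.
have zE v : (qeval (x0, x1, x2, x3, x4, x5) v == 0) =
    (p * iota v.1.1 + q * iota v.1.2 + r * iota v.2 == 0).
  by rewrite -(fmorph_eq0 iota) norm mulf_eq0 (negPf c0) expf_eq0.
apply/and3P; split.
- apply/eqP => -[e3 e4 e5]; apply: npE.
  + move: E3; rewrite e3 rmorph0 => /esym/eqP; rewrite mulf_eq0 (negPf c0) /=.
    by rewrite char2_addr_eq0 // => /eqP.
  + move: E4; rewrite e4 rmorph0 => /esym/eqP; rewrite mulf_eq0 (negPf c0) /=.
    by rewrite char2_addr_eq0 // => /eqP.
  + move: E5; rewrite e5 rmorph0 => /esym/eqP; rewrite mulf_eq0 (negPf c0) /=.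
    by rewrite char2_addr_eq0 // => /eqP.
- by rewrite /nucleus_value zE /= E3 E4 E5; apply/eqP; ring2 char2L.
- apply/forallP => v; apply/forallP => w; rewrite !zE.
  apply/implyP => /eqP v0; apply/implyP => /eqP w0.
  rewrite -(addr0 0) -{1}v0 -w0; apply/eqP; case: v w {v0 w0} => [[? ?] ?] [[? ?] ?] /=.
  by rewrite !rmorphD; ring.
Qed.

(** The discriminant reduces in characteristic 2 to the value of the form at its nucleus: 4
    vanishes, signs disappear, and the mixed terms contribute 3 = 1 times a_01 a_02 a_12. *)
Lemma nonsingular_class f : nonsingular f -> class3 (coeffs f).
Proof.
have i0 : inord 0 = 0 :> 'I_3 by apply: val_inj; rewrite /= inordK.
have i1 : inord 1 = 1 :> 'I_3 by apply: val_inj; rewrite /= inordK.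
have i2 : inord 2 = 2%:R :> 'I_3 by apply: val_inj; rewrite /= inordK.
rewrite /nonsingular i0 i1 i2 /class3 /nucleus_value /=.
move: (coef2 f 0 0) (coef2 f 1 1) (coef2 f 2%:R 2%:R) (coef2 f 1 2%:R)
  (coef2 f 0 2%:R) (coef2 f 0 1) => x0 x1 x2 x3 x4 x5.
by congr (_ != 0); ring2 char2.
Qed.

Section Line.
Variables (M1 M2 : 'M[F]_3) (par : F * F * F * F -> F * F * F * F * F * F)
  (pr : F * F * F * F * F * F -> F * F * F * F) (P1 P2 P3 P4 : F * F * F -> F).
Variables K T R S : rat.
Local Notation Q := (qF F).

Theorem line_hyperplane_numbers n1 n2r n2i n3 :
  M1^T = M1 -> M2^T = M2 ->
  (forall p, pr (par p) = p) -> (forall p, perp M1 M2 (par p)) ->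
  (forall t, perp M1 M2 t -> par (pr t) = t) ->
  (forall a b c d v,
    qeval (par (a, b, c, d)) v = a * P1 v + b * P2 v + c * P3 v + d * P4 v) ->
  \sum_a \sum_b \sum_c \sum_d (nucleus (par (a, b, c, d)) == (0, 0, 0))%:R = K ->
  \sum_a \sum_b \sum_c \sum_d (nucleus_value (par (a, b, c, d)) == 0)%:R = T ->
  \sum_x \sum_y \sum_z [&& P1 (x, y, z) == 0, P2 (x, y, z) == 0,
     P3 (x, y, z) == 0 & P4 (x, y, z) == 0]%:R = R ->
  #|stab M1 M2|%:R = S -> S != 0 ->
  n1 * S = Q ^+ 3 * (Q ^+ 2 - 1) * (Q - 1) * (K - 1) ->
  n2r * S = Q ^+ 2 * (Q - 1) ^+ 2 * (T - K + Q ^+ 2 * R - Q) ->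
  n2i * S = Q ^+ 2 * (Q ^+ 2 - 1) * (T - K - Q ^+ 2 * R + Q) ->
  n3 * S = Q * (Q ^+ 2 - 1) * (Q ^+ 4 - T) ->
  hyperplane_numbers (K_orbit <<[:: M1; M2]>>) n1 n2r n2i n3.
Proof.
move=> sym1 sym2 parK par_perp prK qE KE TE RE SE S0 E1 E2r E2i E3 H.
split=> -[f [cf Pf ->]].
- by apply: (lines_in_class1 char2 sym1 sym2 parK par_perp prK qE KE TE RE SE S0
    (@hyperplane_pairing f) _ E1); apply: double_line_class.
- by apply: (lines_in_class2r char2 sym1 sym2 parK par_perp prK qE KE TE RE SE S0
    (@hyperplane_pairing f) _ E2r); apply: real_line_pair_class.
- by apply: (lines_in_class2i char2 sym1 sym2 parK par_perp prK qE KE TE RE SE S0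
    (@hyperplane_pairing f) _ E2i); apply: imaginary_line_pair_class.
- by apply: (lines_in_class3 char2 sym1 sym2 parK par_perp prK qE KE TE RE SE S0
    (@hyperplane_pairing f) _ E3); apply: nonsingular_class.
Qed.
End Line.
End Hyperplanes.

(** * Stabilizers *)

Section DomainLemmas.
Variable F : idomainType.
Hypothesis char2 : 2%:R = 0 :> F.

Lemma mulxx_eq0 (x : F) : x * x = 0 -> x = 0.
Proof. by move/eqP; rewrite mulf_eq0 orbb => /eqP. Qed.

Lemma mulxxx_eq0 (x : F) : x * x * x = 0 -> x = 0.
Proof. by move/eqP; rewrite !mulf_eq0 !orbb => /eqP. Qed.

Lemma mulf_eq0l (x y : F) : x * y = 0 -> y != 0 -> x = 0.
Proof. by move/eqP; rewrite mulf_eq0 => /orP[/eqP//|->]. Qed.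

Lemma mulf_eq0r (x y : F) : x * y = 0 -> x != 0 -> y = 0.
Proof. by rewrite mulrC => /mulf_eq0l. Qed.

(** Certificates: an equation is derived as an explicit combination of known ones, with the
    cofactors given at each use and the remaining identity left to [ring]. *)
Lemma lincomb1 (P1 P2 l r c : F) : l = r -> P1 - P2 = (l - r) * c -> P1 = P2.
Proof. by move=> ->; rewrite subrr mul0r => /eqP; rewrite subr_eq0 => /eqP. Qed.
Lemma lincomb2 (P1 P2 l r c l' r' c' : F) : l = r -> l' = r' ->
  P1 - P2 = (l - r) * c + (l' - r') * c' -> P1 = P2.
Proof. by move=> -> ->; rewrite !subrr !mul0r addr0 => /eqP; rewrite subr_eq0 => /eqP. Qed.
Lemma lincomb3 (P1 P2 l r c l' r' c' l2 r2 c2 : F) : l = r -> l' = r' -> l2 = r2 ->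
  P1 - P2 = (l - r) * c + (l' - r') * c' + (l2 - r2) * c2 -> P1 = P2.
Proof. by move=> -> -> ->; rewrite !subrr !mul0r !addr0 => /eqP; rewrite subr_eq0 => /eqP. Qed.
Lemma mulxx_inj (x y : F) : x * x = y * y -> x = y.
Proof.
move=> E; apply/eqP; rewrite -(char2_addr_eq0 char2); apply/eqP/mulxx_eq0.
by apply: (lincomb1 (c := 1) E); ring2 char2.
Qed.

End DomainLemmas.

(** * The stabilizer of the diagonal pencil over any field of characteristic 2 *)

Section Monomial.
Variable F : fieldType.
Hypothesis char2 : 2%:R = 0 :> F.

Lemma disjoint_column (x y z : F) : x * y = 0 -> x * z = 0 -> y * z = 0 ->
  [\/ y = 0 /\ z = 0, x = 0 /\ z = 0 | x = 0 /\ y = 0].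
Proof.
have [->|x0] := eqVneq x 0.
  by move=> _ _ /eqP; rewrite mulf_eq0 => /orP[]/eqP->; [apply: Or33|apply: Or32].
move/eqP; rewrite mulf_eq0 (negPf x0) => /eqP->.
by move/eqP; rewrite mulf_eq0 (negPf x0) => /eqP->; move=> _; apply: Or31.
Qed.

(* The first three are the multiples of the powers of the 3-cycle [cycle3]. *)
Definition scaled_perms (d : F) : seq 'M[F]_3 :=
  [:: mat3 d 0 0 0 d 0 0 0 d; mat3 0 d 0 0 0 d d 0 0; mat3 0 0 d d 0 0 0 d 0;
      mat3 d 0 0 0 0 d 0 d 0; mat3 0 d 0 d 0 0 0 0 d; mat3 0 0 d 0 d 0 d 0 0].

(* If a d <> 0, the equalities make the 2 x 2 minors of the last two rows vanish. *)
Lemma proportional_rows (a b c d e f g h k : F) :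
  a * d = b * e -> b * e = c * f -> a * g = b * h -> b * h = c * k ->
  \det (mat3 a b c d e f g h k) != 0 -> a * d = 0.
Proof.
move=> E1 E2 E3 E4; rewrite det_mat3; apply: contraNeq => n0.
have a0 : a != 0 by apply: contraNneq n0 => ->; rewrite mul0r.
have b0 : b != 0 by apply: contraNneq n0 => b0; rewrite E1 b0 mul0r.
have c0 : c != 0 by apply: contraNneq n0 => c0; rewrite E1 E2 c0 mul0r.
have m1 : d * h = e * g.
  apply: (mulfI a0); apply: (mulfI b0).
  by apply: (lincomb2 (c := b * h) (c' := - b * e) E1 E3); ring.
have m2 : e * k = f * h.
  apply: (mulfI b0); apply: (mulfI c0).
  by apply: (lincomb2 (c := c * k) (c' := - c * f) E2 E4); ring.
have m3 : d * k = f * g.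
  apply: (mulfI a0); apply: (mulfI c0).
  by apply: (lincomb2 (c := c * k) (c' := - c * f) (etrans E1 E2) (etrans E3 E4)); ring.
by rewrite m1 m2 m3; apply/eqP; ring.
Qed.

(** All matrices of the pencil are diagonal, so for any two rows of A the three entrywise products
    are equal; invertibility then makes them vanish. Hence each column of A has a single nonzero
    entry. The field is arbitrary because the lemma also serves for o17, over an algebraic
    closure. *)
Lemma stab_diagonal (A : 'M[F]_3) x y x' y' : \det A != 0 ->
  A *m mat3 1 0 0 0 1 0 0 0 0 *m A^T = x *: mat3 1 0 0 0 1 0 0 0 0 + y *: mat3 0 0 0 0 1 0 0 0 1 ->
  A *m mat3 0 0 0 0 1 0 0 0 1 *m A^T = x' *: mat3 1 0 0 0 1 0 0 0 0 + y' *: mat3 0 0 0 0 1 0 0 0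
    1 ->
  exists d, d != 0 /\ A \in scaled_perms d.
Proof.
elim/mat3_ind: A => a b c d e f g h k D.
rewrite !mat3E !simp0 => /mat3P[[E1 E2 E3] [_ E4 E5] [_ _ E6]] /mat3P[[E7 E8 E9] [_ E10 E11] [_
  _ E12]].
have ad : a * d = b * e by apply: (lincomb1 (c := 1) E2); ring2 char2.
have be : b * e = c * f by apply: (lincomb1 (c := 1) E8); ring2 char2.
have ag : a * g = b * h by apply: (lincomb1 (c := 1) E3); ring2 char2.
have bh : b * h = c * k by apply: (lincomb1 (c := 1) E9); ring2 char2.
have dg : d * g = e * h by apply: (lincomb1 (c := 1) E5); ring2 char2.
have eh : e * h = f * k by apply: (lincomb1 (c := 1) E11); ring2 char2.
(* The matrices of the pencil have trace 0; as squaring is additive and injective, this equates the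
   column sums of A. *)
have s1 : a + d + g = b + e + h.
  apply: mulxx_inj => //.
  by apply: (lincomb3 (c := 1) (c' := 1) (c2 := 1) E1 E4 E6); ring2 char2.
have s2 : b + e + h = c + f + k.
  apply: mulxx_inj => //.
  by apply: (lincomb3 (c := 1) (c' := 1) (c2 := 1) E7 E10 E12); ring2 char2.
have ad0 := proportional_rows ad be ag bh D.
have ag0 : a * g = 0.
  apply: (proportional_rows ag bh ad be); apply: contraNneq D => E.
  by apply/eqP; apply: (lincomb1 (c := -1) E); rewrite !det_mat3; ring.
have dg0 : d * g = 0.
  apply: (@proportional_rows d e f g h k a b c) => //.
  + by rewrite mulrC ad mulrC.
  + by rewrite ![_ * b]mulrC be mulrC.
  by apply: contraNneq D => E; apply/eqP; apply: (lincomb1 (c := 1) E); rewrite !det_mat3; ring.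
have be0 : b * e = 0 by rewrite -ad.
have cf0 : c * f = 0 by rewrite -be.
have bh0 : b * h = 0 by rewrite -ag.
have ck0 : c * k = 0 by rewrite -bh.
have eh0 : e * h = 0 by rewrite -dg.
have fk0 : f * k = 0 by rewrite -eh.
(* The scalar is the common column sum. Of the 27 ways to place one possibly nonzero entry in each
   column, those that are not permutations have zero determinant. *)
exists (a + d + g); move: D s1 s2; rewrite det_mat3.
case: (disjoint_column ad0 ag0 dg0) => -[-> ->];
case: (disjoint_column be0 bh0 eh0) => -[-> ->];
case: (disjoint_column cf0 ck0 fk0) => -[-> ->];
  rewrite !simp0 => D;
  try (by case/eqP: D; ring);
  move=> E E'; (split; last by rewrite -E' -E !inE eqxx ?orbT);
  apply: contraNneq D => ->; apply/eqP; ring.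
Qed.
End Monomial.

(** * The q-th power map on an extension of F and its fixed field *)

Section Frobenius.
Variables (F : finFieldType) (K : fieldType) (iota : {rmorphism F -> K}).
Hypothesis char2 : 2%:R = 0 :> F.

Lemma char2_morph : 2%:R = 0 :> K.
Proof. by rewrite -(rmorph_nat iota) char2 rmorph0. Qed.

Definition frob (x : K) : K := x ^+ #|F|.

Lemma frob_is_zmod_morphism : {morph frob : x y / x - y}.
Proof.
move=> x y; rewrite /frob !(char2_oppr char2_morph).
by rewrite (frobeniusD _ _ char2 char2_morph).
Qed.

Lemma frob_is_monoid_morphism : monoid_morphism frob.
Proof. by split; [exact: expr1n|move=> x y; exact: exprMn]. Qed.

Lemma frob_morph : exists f : {rmorphism K -> K}, f =1 frob.
Proof.
pose f : {rmorphism K -> K} := HB.pack frob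
  (GRing.isZmodMorphism.Build K K frob frob_is_zmod_morphism)
  (GRing.isMonoidMorphism.Build K K frob frob_is_monoid_morphism).
by exists f.
Qed.

Lemma frob_iota a : frob (iota a) = iota a.
Proof. by rewrite /frob -rmorphXn expf_card. Qed.

(** The polynomial X^q - X has at most q roots, and the images of the q elements of F are roots. *)
Lemma frob_fixed x : frob x = x -> exists a, x = iota a.
Proof.
move=> fx; have [/imageP[a _ ->]|nx] := boolP (x \in image iota F); first by exists a.
have q1 := cardF_gt1 F.
have sp : size ('X^#|F| - 'X : {poly K}) = #|F|.+1.
  by rewrite size_addl size_polyXn // size_opp size_polyX ltnS.
have p0 : 'X^#|F| - 'X != 0 :> {poly K} by rewrite -size_poly_gt0 sp.
have rts : all (root ('X^#|F| - 'X)) (x :: image iota F).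
  rewrite /= {1}/root !hornerE -/(frob x) fx subrr eqxx; apply/allP => _ /mapP[a _ ->].
  by rewrite /root !hornerE -/(frob _) frob_iota subrr.
have urts : uniq (x :: image iota F).
  by rewrite /= nx map_inj_uniq ?enum_uniq //; exact: fmorph_inj.
by have := max_poly_roots p0 rts urts; rewrite sp /= size_map -cardE ltnn.
Qed.
End Frobenius.

(** * Diagonalizing the pencil of o17 over an extension *)

Section Cubic.
Variable F : finFieldType.
Hypothesis char2 : 2%:R = 0 :> F.
Variables (alpha beta gamma : F).
Hypothesis habc : forall x : F, x ^+ 3 + gamma * x ^+ 2 - beta * x + alpha != 0.

Lemma cubic_alpha_neq0 : alpha != 0.
Proof. by have := habc 0; rewrite expr0n /= expr0n !mulr0 subr0 !add0r. Qed.

Section Roots.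
Variables (K : fieldType) (iota : {rmorphism F -> K}) (f : {rmorphism K -> K}).
Hypothesis fE : f =1 @frob F K.
Let h2 : 2%:R = 0 :> K := char2_morph iota char2.
Local Notation a := (iota alpha).
Local Notation b := (iota beta).
Local Notation c := (iota gamma).

Lemma f_iota x : f (iota x) = iota x. Proof. by rewrite fE frob_iota. Qed.

Lemma cubic_conjugates (x y z : K) : x ^+ 3 + c * x ^+ 2 + b * x + a = 0 ->
  f x = y -> f y = z ->
  [/\ x != y, x != z, y != z & [/\ f z = x, x + y + z = c, x * y + x * z + y * z = b
    & x * y * z = a]].
Proof.
move=> rx fx fy.
have fr w : w ^+ 3 + c * w ^+ 2 + b * w + a = 0 -> f w ^+ 3 + c * f w ^+ 2 + b * f w + a = 0.
  move=> /(congr1 f); rewrite rmorph0 !(rmorphD, rmorphM, rmorphXn) /= !f_iota.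
  by [].
have ry := fr _ rx; rewrite fx in ry; have rz := fr _ ry; rewrite fy in rz.
have nF s : x != iota s.
  apply: contraNneq (habc s) => xE; rewrite -(fmorph_eq0 iota) (char2_oppr char2).
  by rewrite !(rmorphD, rmorphM, rmorphXn) /= -xE rx.
have xy : x != y.
  apply/eqP => E; have [s /eqP] : exists s, x = iota s by apply: frob_fixed; rewrite -fE fx.
  exact/negP/nF.
have yz : y != z by rewrite -fx -fy -fx (inj_eq (fmorph_inj f)) fx.
(* The difference of the cubic at two distinct roots, divided by their difference. *)
have cE p r : p != r -> p ^+ 3 + c * p ^+ 2 + b * p + a = 0 ->
    r ^+ 3 + c * r ^+ 2 + b * r + a = 0 -> p ^+ 2 + p * r + r ^+ 2 + c * (p + r) + b = 0.
  rewrite -(char2_addr_eq0 h2) => pr rp rr; apply: (mulfI pr).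
  by apply: (lincomb2 (c := 1) (c' := 1) rp rr); ring2 h2.
(* If x were fixed by the square of f, then x + y would lie in F, and so would the third root c + x
   + y. *)
have xz : x != z.
  apply/eqP => E.
  have [s sE] : exists s, x + y = iota s.
    by apply: frob_fixed; rewrite -fE rmorphD /= fx fy -E addrC.
  have /eqP := cE _ _ xy rx ry; rewrite char2_addr_eq0 // => /eqP bE.
  have := habc (gamma + s); rewrite -(fmorph_eq0 iota) (char2_oppr char2).
  rewrite !(rmorphD, rmorphM, rmorphXn) /= -sE => /eqP[].
  by apply: (lincomb1 (c := 1) rx); rewrite -bE; ring2 h2.
have e1 : x + y + z = c.
  have yz' : y + z != 0 by rewrite char2_addr_eq0.
  apply: (mulfI yz').
  by apply: (lincomb2 (c := 1) (c' := 1) (cE _ _ xy rx ry) (cE _ _ xz rx rz)); ring2 h2.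
have e2 : x * y + x * z + y * z = b.
  by apply: (lincomb1 (c := 1) (cE _ _ xy rx ry)); rewrite -e1; ring2 h2.
have e3 : x * y * z = a.
  by apply: (lincomb1 (c := 1) rx); rewrite -e1 -e2; ring2 h2.
split=> //; split=> //.
have := congr1 f e1; rewrite !rmorphD /= f_iota fx fy => E.
by apply: (lincomb2 (c := 1) (c' := 1) E e1); ring2 h2.
Qed.

Definition cycle3 : 'M[K]_3 := mat3 0 1 0 0 0 1 1 0 0.

(** The rows of P are multiples of (a, X, X^2) for the three conjugate roots X; in this basis both
    matrices become diagonal, with ratios of entries equal to the roots. Frobenius permutes the rows
    cyclically, whence the 3-cycle. *)
Lemma cubic_diagonalization (x : K) : x ^+ 3 + c * x ^+ 2 + b * x + a = 0 ->
  (exists m, m ^+ 2 = x) ->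
  exists (P : 'M[K]_3) (l0 l2 w0 w2 : K), [/\ \det P != 0, map_mx f P = cycle3 *m P,
    [/\ l0 != l2, w0 != 0 & w2 != 0],
    P *m mat3 a^-1 0 0 0 c 1 0 1 0 *m P^T = w0 *: mat3 1 0 0 0 1 0 0 0 0 + w2 *: mat3 0 0 0 0 1
      0 0 0 1
  & P *m mat3 0 1 0 1 b 0 0 0 1 *m P^T =
      (l0 * w0) *: mat3 1 0 0 0 1 0 0 0 0 + (l2 * w2) *: mat3 0 0 0 0 1 0 0 0 1].
Proof.
move=> rx [m mE].
have [y fx] : exists y, f x = y by exists (f x).
have [z fy] : exists z, f y = z by exists (f y).
have [n fm] : exists n, f m = n by exists (f m).
have [k fn] : exists k, f n = k by exists (f n).
have [] := cubic_conjugates rx fx fy.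
rewrite -(char2_addr_eq0 h2 x y) -(char2_addr_eq0 h2 x z) -(char2_addr_eq0 h2 y z) => xy xz yz
  [fz e1 e2 e3].
have a0 : a != 0 by rewrite fmorph_eq0 cubic_alpha_neq0.
have x0 : x != 0 by apply: contraNneq a0 => x0; rewrite -e3 x0 !mul0r.
have y0 : y != 0 by apply: contraNneq a0 => y0; rewrite -e3 y0 mulr0 mul0r.
have z0 : z != 0 by apply: contraNneq a0 => z0; rewrite -e3 z0 mulr0.
have nE : n ^+ 2 = y by rewrite -fm -fx -mE rmorphXn.
have kE : k ^+ 2 = z by rewrite -fn -fy -nE rmorphXn.
have fk : f k = m by apply: (mulxx_inj h2); rewrite -!expr2 mE -fz -kE rmorphXn.
have m0 : m != 0 by apply: contraNneq x0 => m0; rewrite -mE m0 expr0n.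
have n0 : n != 0 by rewrite -fm fmorph_eq0.
have k0 : k != 0 by rewrite -fn fmorph_eq0.
(* Unscaled, the first diagonal matrix has entry x (x + y) (x + z) at the root x. This scaling,
   which needs the square root m of x, makes it 1 / ((x + y) (x + z)). Such entries sum to 0 over
   the three roots, also when multiplied by the roots, so both matrices land in the pencil of
   diagonal matrices of trace 0. *)
have [p pE] : exists p, p = (m * (x + y) * (x + z))^-1 by eexists.
have [q qE] : exists q, q = (n * (x + y) * (y + z))^-1 by eexists.
have [r rE] : exists r, r = (k * (x + z) * (y + z))^-1 by eexists.
have fp : f p = q.
  rewrite pE qE fmorphV !(rmorphM, rmorphD) /= fm fx fy fz; congr (_^-1); ring.
have fq : f q = r.
  rewrite rE qE fmorphV !(rmorphM, rmorphD) /= fn fx fy fz; congr (_^-1); ring.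
have fr : f r = p.
  rewrite rE pE fmorphV !(rmorphM, rmorphD) /= fk fx fy fz; congr (_^-1); ring.
(* [B1] and [B2] are the two bilinear forms evaluated at the rows s (a, X, X^2) and t (a, Y,
   Y^2). *)
pose B1 s X t Y := s * t * (a + c * X * Y + X * Y ^+ 2 + X ^+ 2 * Y).
pose B2 s X t Y := s * t * (a * (X + Y) + b * X * Y + X ^+ 2 * Y ^+ 2).
have offdiag X Y Z s t : X + Y + Z = c -> X * Y + X * Z + Y * Z = b -> X * Y * Z = a ->
    B1 s X t Y = 0 /\ B2 s X t Y = 0.
  by rewrite /B1 /B2 => <- <- <-; split; ring2 h2.
have diag X Y Z M s : X + Y + Z = c -> X * Y + X * Z + Y * Z = b -> X * Y * Z = a ->
    M ^+ 2 = X -> M != 0 -> X + Y != 0 -> X + Z != 0 -> s = (M * (X + Y) * (X + Z))^-1 ->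
    B1 s X s X = ((X + Y) * (X + Z))^-1 /\ B2 s X s X = X * ((X + Y) * (X + Z))^-1.
  rewrite /B1 /B2 => <- <- <- <- M0 XY XZ ->; split; field2 h2; by rewrite M0 XY XZ.
have ds s X t Y : B1 s X t Y = B1 t Y s X by rewrite /B1; ring.
have ds' s X t Y : B2 s X t Y = B2 t Y s X by rewrite /B2; ring.
have e1' : x + z + y = c by rewrite -e1; ring.
have e2' : x * z + x * y + z * y = b by rewrite -e2; ring.
have e3' : x * z * y = a by rewrite -e3; ring.
have f1 : y + z + x = c by rewrite -e1; ring.
have f2 : y * z + y * x + z * x = b by rewrite -e2; ring.
have f3 : y * z * x = a by rewrite -e3; ring.
have [o1 o1'] := offdiag _ _ _ p q e1 e2 e3.
have [o2 o2'] := offdiag _ _ _ p r e1' e2' e3'.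
have [o3 o3'] := offdiag _ _ _ q r f1 f2 f3.
have [d1 d1'] := diag _ _ _ _ _ e1 e2 e3 mE m0 xy xz pE.
have g1 : z + x + y = c by rewrite -e1; ring.
have g2 : z * x + z * y + x * y = b by rewrite -e2; ring.
have g3 : z * x * y = a by rewrite -e3; ring.
have i1 : y + x + z = c by rewrite -e1; ring.
have i2 : y * x + y * z + x * z = b by rewrite -e2; ring.
have i3 : y * x * z = a by rewrite -e3; ring.
have [d2 d2'] : B1 q y q y = ((x + y) * (y + z))^-1 /\ B2 q y q y = y * ((x + y) * (y + z))^-1.
  by rewrite (addrC x y); apply: (diag _ _ _ n _ i1 i2 i3) => //; rewrite (addrC y x).
have [d3 d3'] : B1 r z r z = ((x + z) * (y + z))^-1 /\ B2 r z r z = z * ((x + z) * (y + z))^-1.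
  rewrite (addrC x z) (addrC y z).
  by apply: (diag _ _ _ k _ g1 g2 g3) => //; rewrite ?(addrC z x) // (addrC z y).
exists (mat3 (p * a) (p * x) (p * x ^+ 2) (q * a) (q * y) (q * y ^+ 2)
  (r * a) (r * z) (r * z ^+ 2)), x, z, ((x + y) * (x + z))^-1, ((x + z) * (y + z))^-1.
split.
- rewrite det_mat3 (_ : _ - _ + _ = p * q * r * a * ((x + y) * (x + z) * (y + z))).
    by rewrite !mulf_neq0 // ?pE ?qE ?rE invr_eq0 !mulf_neq0.
  by ring2 h2.
- rewrite /cycle3 mul_mat3 !simp0; apply/matrixP; elim/ord3P; elim/ord3P; rewrite !mxE /=;
    by rewrite !(rmorphM, rmorphXn) /= ?fp ?fq ?fr ?fx ?fy ?fz ?f_iota.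
- by split; rewrite ?invr_eq0 ?mulf_neq0 // -(char2_addr_eq0 h2).
- have -> : mat3 (p * a) (p * x) (p * x ^+ 2) (q * a) (q * y) (q * y ^+ 2)
    (r * a) (r * z) (r * z ^+ 2) *m mat3 a^-1 0 0 0 c 1 0 1 0 *m
    (mat3 (p * a) (p * x) (p * x ^+ 2) (q * a) (q * y) (q * y ^+ 2)
    (r * a) (r * z) (r * z ^+ 2))^T = mat3 (B1 p x p x) (B1 p x q y) (B1 p x r z)
      (B1 q y p x) (B1 q y q y) (B1 q y r z) (B1 r z p x) (B1 r z q y) (B1 r z r z).
    by rewrite /B1 !mat3E; congr mat3; field.
  rewrite d1 d2 d3 (ds q y p x) (ds r z) (ds r z q y) o1 o2 o3 !mat3E !simp0.
  by congr mat3; field2 h2; rewrite xy xz yz.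
have -> : mat3 (p * a) (p * x) (p * x ^+ 2) (q * a) (q * y) (q * y ^+ 2)
    (r * a) (r * z) (r * z ^+ 2) *m mat3 0 1 0 1 b 0 0 0 1 *m
    (mat3 (p * a) (p * x) (p * x ^+ 2) (q * a) (q * y) (q * y ^+ 2)
    (r * a) (r * z) (r * z ^+ 2))^T = mat3 (B2 p x p x) (B2 p x q y) (B2 p x r z)
      (B2 q y p x) (B2 q y q y) (B2 q y r z) (B2 r z p x) (B2 r z q y) (B2 r z r z).
  by rewrite /B2 !mat3E; congr mat3; ring.
rewrite d1' d2' d3' (ds' q y p x) (ds' r z) (ds' r z q y) o1' o2' o3' !mat3E !simp0.
by congr mat3; field2 h2; rewrite xy xz yz.
Qed.
End Roots.
End Cubic.

(** * Orders of the stabilizers in GL(3,q) *)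

Section Stabilizers.
Variable F : finFieldType.
Hypothesis char2 : 2%:R = 0 :> F.
Local Notation Q := (qF F).
Local Notation U := {x : F | x != 0}.

Lemma mem_span2 (N M1 M2 : 'M[F]_3) :
  reflect (exists x y, N = x *: M1 + y *: M2) (N \in <<[:: M1; M2]>>%VS).
Proof.
rewrite span_cons span_seq1; apply: (iffP memv_addP) => [[_ /vlineP[x ->] [_ /vlineP[y ->] ->]]|].
  by exists x, y.
case=> x [y ->]; exists (x *: M1); first exact/vlineP/(ex_intro _ x).
by exists (y *: M2) => //; apply/vlineP; exists y.
Qed.

(** A stabilizer is counted by a bijective parametrization [g]; solving the equations for A is the
    last premise. *)
Lemma stab_card (M1 M2 : 'M[F]_3) (T : finType) (g : T -> 'M[F]_3) :
  injective g -> (forall p, \det (g p) != 0) ->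
  (forall p, exists x y, g p *m M1 *m (g p)^T = x *: M1 + y *: M2) ->
  (forall p, exists x y, g p *m M2 *m (g p)^T = x *: M1 + y *: M2) ->
  (forall A x y x' y', \det A != 0 -> A *m M1 *m A^T = x *: M1 + y *: M2 ->
     A *m M2 *m A^T = x' *: M1 + y' *: M2 -> exists p, A = g p) ->
  #|stab M1 M2| = #|T|.
Proof.
move=> ginj gdet g1 g2 gsurj; rewrite -(card_imset _ ginj); apply: eq_card => A.
rewrite inE unitmxE unitfE; apply/idP/imsetP => [/and3P[dA /mem_span2[x [y E1]] /mem_span2[x'
  [y' E2]]]|[p _ ->]].
  by have [p ->] := gsurj _ _ _ _ _ dA E1 E2; exists p.
by rewrite gdet /=; apply/andP; split; apply/mem_span2; [apply: g1|apply: g2].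
Qed.

Lemma card_nonzero : #|{: U}|%:R = Q - 1 :> rat.
Proof. by rewrite card_sig card_rat sumF_neq. Qed.

Local Notation GL2 := {p : F * F * F * F | p.1.1.1 * p.2 + p.1.1.2 * p.1.2 != 0}.
Lemma card_GL2 : #|{: GL2}|%:R = Q ^+ 4 - Q ^+ 3 - Q ^+ 2 + Q :> rat.
Proof.
rewrite card_sig card_rat sum4.
transitivity (\sum_(a : F) \sum_(b : F) \sum_(c : F) (if a == 0 then Q * (b * c != 0)%:R else Q
  - 1)).
  apply: eq_bigr => a _; apply: eq_bigr => b _; apply: eq_bigr => c _ /=.
  rewrite (eq_bigr (fun d => 1 - (d * a + b * c == 0)%:R)) => [|d _].
    rewrite sumrB sumF_const sumF_affine mulr1; case: eqP => // _.
    by case: eqP => _ /=; ring.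
  by rewrite [a * d]mulrC; case: eqP; rewrite ?subr0 ?subrr.
rewrite (@sumF_split _ 0 _ (Q ^+ 2 * (Q - 1))) => [|a /negPf->].
  rewrite (@sumF_split _ 0 _ (Q * (Q - 1))) => [|b b0].
    rewrite big1 => [|c _]; first by ring.
    by rewrite eqxx mul0r eqxx mulr0.
  rewrite eqxx -mulr_sumr -(sumF_neq 0); congr (_ * _); apply: eq_bigr => c _.
  by rewrite mulf_eq0 (negPf b0).
by rewrite !sumF_const; ring.
Qed.

Ltac nzfrom D := apply: contraNneq D => ->; apply/eqP; ring.
Ltac stab_ring := rewrite !mat3E; congr mat3; ring2 char2.

(** The boolean records whether the two rank-one points of the line are fixed or exchanged. *)
Lemma stab_o5 : #|stab (mat3 1 0 0 0 0 0 0 0 0 : 'M[F]_3) (mat3 0 0 0 0 1 0 0 0 0)|%:R =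
  2%:R * Q ^+ 2 * (Q - 1) ^+ 3.
Proof.
rewrite (@stab_card _ _ (bool * (U * U * U) * (F * F))%type (fun '(s, (x, y, k), (c, f)) =>
  if s then mat3 (val x) 0 c 0 (val y) f 0 0 (val k)
  else mat3 0 (val x) c (val y) 0 f 0 0 (val k))).
- by rewrite !card_prod card_bool !natrM card_nonzero -/qF; ring.
- move=> [[s [[x y] k]] [c f]] [[s' [[x' y'] k']] [c' f']].
  case: s s' => [] [] /mat3P[].
  + by move=> [/val_inj-> _ ->] [_ /val_inj-> ->] [_ _ /val_inj->].
  + by case=> E; case/eqP: (valP x).
  + by case=> E; case/eqP: (valP x').
  + by move=> [_ /val_inj-> ->] [/val_inj-> _ ->] [_ _ /val_inj->].
- move=> [[s [[[x x0] [y y0]] [k k0]]] [c f]]; case: s; rewrite /= det_mat3.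
  + by rewrite (_ : _ + _ = x * y * k) ?mulf_neq0 //; ring.
  + by rewrite (_ : _ + _ = x * y * k) ?mulf_neq0 //; ring2 char2.
- move=> [[s [[[x x0] [y y0]] [k k0]]] [c f]]; case: s => /=.
  + by exists (x * x), 0; stab_ring.
  + by exists 0, (y * y); stab_ring.
- move=> [[s [[[x x0] [y y0]] [k k0]]] [c f]]; case: s => /=.
  + by exists 0, (y * y); stab_ring.
  + by exists (x * x), 0; stab_ring.
elim/mat3_ind => a b c d e f g h k x y x' y'.
rewrite det_mat3 !mat3E !simp0 => D.
move=> /mat3P[[_ E1 _] _ [_ _ /mulxx_eq0 g0]] /mat3P[[_ E2 _] _ [_ _ /mulxx_eq0 h0]].
subst g h; have k0 : k != 0 by nzfrom D.
have [a0|a0] := eqVneq a 0.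
  subst a; have b0 : b != 0 by nzfrom D.
  have d0 : d != 0 by nzfrom D.
  have e0 := mulf_eq0r E2 b0; subst e.
  by exists (false, (Sub b b0, Sub d d0, Sub k k0), (c, f)).
have d0 := mulf_eq0r E1 a0; subst d; have e0 : e != 0 by nzfrom D.
have b0 := mulf_eq0l E2 e0; subst b.
by exists (true, (Sub a a0, Sub e e0, Sub k k0), (c, f)).
Qed.

Lemma stab_o6 : #|stab (mat3 1 0 0 0 0 0 0 0 0 : 'M[F]_3) (mat3 0 1 0 1 0 0 0 0 0)|%:R =
  Q ^+ 3 * (Q - 1) ^+ 3.
Proof.
rewrite (@stab_card _ _ (U * U * U * (F * F * F))%type (fun '(a, e, k, (b, c, f)) =>
  mat3 (val a) b c 0 (val e) f 0 0 (val k))).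
- by rewrite !card_prod !natrM card_nonzero -/qF; ring.
- move=> [[[a e] k] [[b c] f]] [[[a' e'] k'] [[b' c'] f']] /mat3P[].
  by move=> [/val_inj-> -> ->] [_ /val_inj-> ->] [_ _ /val_inj->].
- move=> [[[[a a0] [e e0]] [k k0]] [[b c] f]] /=; rewrite det_mat3.
  by rewrite (_ : _ + _ = a * e * k) ?mulf_neq0 //; ring.
- move=> [[[[a a0] [e e0]] [k k0]] [[b c] f]] /=.
  by exists (a * a), 0; stab_ring.
- move=> [[[[a a0] [e e0]] [k k0]] [[b c] f]] /=.
  by exists (b * a + a * b), (a * e); stab_ring.
elim/mat3_ind => a b c d e f g h k x y x' y'.
rewrite det_mat3 !mat3E !simp0 => D.
move=> /mat3P[_ [_ /mulxx_eq0 d0 _] [_ _ /mulxx_eq0 g0]].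
subst d g; rewrite !simp0 => /mat3P[[_ _ E1] _ _].
have a0 : a != 0 by nzfrom D.
have h0 := mulf_eq0r E1 a0; subst h.
have e0 : e != 0 by nzfrom D.
have k0 : k != 0 by nzfrom D.
by exists (Sub a a0, Sub e e0, Sub k k0, (b, c, f)).
Qed.

(** The lower block B has B B^T scalar, which in characteristic 2 forces B = s I + f J with J the
    all-ones matrix. *)
Lemma stab_o8_1 : #|stab (mat3 1 0 0 0 0 0 0 0 0 : 'M[F]_3) (mat3 0 0 0 0 1 0 0 0 1)|%:R =
  Q * (Q - 1) ^+ 2.
Proof.
rewrite (@stab_card _ _ (U * U * F)%type (fun '(a, s, f) =>
  mat3 (val a) 0 0 0 (f + val s) f 0 f (f + val s))).
- by rewrite !card_prod !natrM card_nonzero -/qF; ring.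
- move=> [[a s] f] [[a' s'] f'] /mat3P[].
  by move=> [/val_inj-> _ _] [_ E Ef] _; move: E; rewrite Ef => /addrI/val_inj->.
- move=> [[[a a0] [s s0]] f] /=; rewrite det_mat3.
  by rewrite (_ : _ + _ = a * s * s) ?mulf_neq0 //; ring2 char2.
- by move=> [[[a a0] [s s0]] f] /=; exists (a * a), 0; stab_ring.
- by move=> [[[a a0] [s s0]] f] /=; exists 0, (s * s); stab_ring.
elim/mat3_ind => a b c d e f g h k x y x' y'.
rewrite det_mat3 !mat3E !simp0 => D.
move=> /mat3P[_ [_ E1 E2] [_ _ E3]] /mat3P[[_ E4 E5] [_ E6 E7] [_ _ E8]].
have dg : d = g by apply: mulxx_inj => //; rewrite E1 E3.
subst d; have g0 := mulxx_eq0 E2; subst g => {E1 E2 E3}.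
have a0 : a != 0 by nzfrom D.
have m0 : e * k - f * h != 0 by nzfrom D.
have b0 : b = 0.
  apply: (mulf_eq0l _ m0); apply: (lincomb2 (c := k) (c' := - f) E4 E5); ring.
have c0 : c = 0.
  apply: (mulf_eq0l _ m0); apply: (lincomb2 (c := - h) (c' := e) E4 E5); ring.
subst b c; have kE : k = e + f + h.
  by apply: mulxx_inj => //; apply: (lincomb2 (c := 1) (c' := -1) E6 E8); ring2 char2.
subst k; have : (e + f) * (f + h) = 0 by apply: (lincomb1 (c := 1) E7); ring2 char2.
move/eqP; rewrite mulf_eq0 !char2_addr_eq0 // => /orP[]/eqP E.
  by case/eqP: m0; rewrite E; ring2 char2.
subst h; have s0 : e + f != 0.
  by apply: contraNneq m0 => s0; rewrite -(mulr0 (e + f)) -s0; apply/eqP; ring2 char2.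
exists (Sub a a0, Sub (e + f) s0, f) => /=; congr mat3; ring2 char2.
Qed.

Lemma minors_eq0 (b c e f h k : F) : e * k - f * h != 0 ->
  b * f + c * e = 0 -> b * k + c * h = 0 -> b = 0 /\ c = 0.
Proof.
move=> m0 E1 E2; split; apply: (mulf_eq0l _ m0).
  by apply: (lincomb2 (c := h) (c' := e) E1 E2); ring2 char2.
by apply: (lincomb2 (c := k) (c' := f) E1 E2); ring2 char2.
Qed.

(** The lower block is arbitrary: congruence multiplies a 2 x 2 alternating matrix by the
    determinant. *)
Lemma stab_o8_3 : #|stab (mat3 1 0 0 0 0 0 0 0 0 : 'M[F]_3) (mat3 0 0 0 0 0 1 0 1 0)|%:R =
  (Q - 1) * (Q ^+ 4 - Q ^+ 3 - Q ^+ 2 + Q).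
Proof.
rewrite (@stab_card _ _ (U * GL2)%type (fun '(a, g) => let: (e, f, h, k) := val g in
  mat3 (val a) 0 0 0 e f 0 h k)).
- by rewrite !card_prod !natrM card_nonzero card_GL2 // -/qF; ring.
- move=> [a g] [a' g'].
  case E: (val g) => [[[e f] h] k]; case E': (val g') => [[[e' f'] h'] k'].
  move=> /mat3P[[/val_inj-> _ _] [_ e0 f0] [_ h0 k0]]; congr (_, _).
  by apply: val_inj; rewrite E E' e0 f0 h0 k0.
- move=> [[a a0] [[[[e f] h] k] /= g0]] /=; rewrite det_mat3.
  by rewrite (_ : _ + _ = a * (e * k + f * h)) ?mulf_neq0 //; ring2 char2.
- by move=> [[a a0] [[[[e f] h] k] /= g0]] /=; exists (a * a), 0; stab_ring.
- by move=> [[a a0] [[[[e f] h] k] /= g0]] /=; exists 0, (e * k + f * h); stab_ring.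
elim/mat3_ind => a b c d e f g h k x y x' y'.
rewrite det_mat3 !mat3E !simp0 => D.
move=> /mat3P[_ [_ /mulxx_eq0 d0 _] [_ _ /mulxx_eq0 g0]]; subst d g.
move=> /mat3P[[_ E1 E2] _ _].
have a0 : a != 0 by nzfrom D.
have m0 : e * k - f * h != 0 by nzfrom D.
have [b0 c0] : b = 0 /\ c = 0.
  apply: (minors_eq0 m0); [apply: (lincomb1 (c := 1) E1)|apply: (lincomb1 (c := 1) E2)]; ring.
subst b c; have g0 : e * k + f * h != 0 by rewrite -[f * h](char2_oppr char2).
by exists (Sub a a0, Sub (e, f, h, k) g0).
Qed.

Lemma stab_o9 : #|stab (mat3 1 0 0 0 0 0 0 0 0 : 'M[F]_3) (mat3 0 0 1 0 1 0 1 0 0)|%:R =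
  Q ^+ 2 * (Q - 1) ^+ 2.
Proof.
rewrite (@stab_card _ _ (U * U * (F * F))%type (fun '(a, e, (b, c)) =>
  mat3 (val a) b c 0 (val e) (b * val e / val a) 0 0 (val e ^+ 2 / val a))).
- by rewrite !card_prod !natrM card_nonzero -/qF; ring.
- move=> [[a e] [b c]] [[a' e'] [b' c']] /mat3P[].
  by move=> [/val_inj-> -> ->] [_ /val_inj-> _] _.
- move=> [[[a a0] [e e0]] [b c]] /=; rewrite det_mat3.
  by rewrite (_ : _ + _ = e * e * e) ?mulf_neq0 //; field.
- by move=> [[[a a0] [e e0]] [b c]] /=; exists (a * a), 0; stab_ring.
- move=> [[[a a0] [e e0]] [b c]] /=; exists (b * b), (e * e); rewrite !mat3E.
  by congr mat3; field2 char2.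
elim/mat3_ind => a b c d e f g h k x y x' y'.
rewrite det_mat3 !mat3E !simp0 => D.
move=> /mat3P[[_ _ E0] [_ E1 _] [_ _ /mulxx_eq0 g0]]; subst g.
move=> /mat3P[[_ E2 E3] [_ E4 _] [_ _ E5]].
have d0 : d = 0 by apply: mulxx_eq0; rewrite E1 -E0 mulr0.
have h0 : h = 0 by apply: mulxx_eq0; rewrite -E5; ring.
subst d h; have a0 : a != 0 by nzfrom D.
have e0 : e != 0 by nzfrom D.
exists (Sub a a0, Sub e e0, (b, c)) => /=; congr mat3.
  by apply: (mulfI a0); apply: (lincomb1 (c := 1) E2); field2 char2.
apply: (mulfI a0); apply: (lincomb2 (c := 1) (c' := -1) E3 E4); field2 char2.
by [].
Qed.

(** The line consists of the alternating matrices e_2 w^T + w e_2^T, so A stabilizes it exactly when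
    it fixes the point e_2. *)
Lemma stab_o12_1 : #|stab (mat3 0 1 0 1 0 0 0 0 0 : 'M[F]_3) (mat3 0 0 0 0 0 1 0 1 0)|%:R =
  Q ^+ 2 * (Q - 1) * (Q ^+ 4 - Q ^+ 3 - Q ^+ 2 + Q).
Proof.
rewrite (@stab_card _ _ (U * GL2 * (F * F))%type (fun '(e, t, (d, f)) =>
  let: (a, c, g, k) := val t in mat3 a 0 c d (val e) f g 0 k)).
- by rewrite !card_prod !natrM card_nonzero card_GL2 // -/qF; ring.
- move=> [[e t] [d f]] [[e' t'] [d' f']].
  case E: (val t) => [[[a c] g] k]; case E': (val t') => [[[a' c'] g'] k'].
  move=> /mat3P[[a0 _ c0] [-> /val_inj-> ->] [g0 _ k0]]; congr (_, _, _).
  by apply: val_inj; rewrite E E' a0 c0 g0 k0.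
- move=> [[[e e0] [[[[a c] g] k] /= t0]] [d f]] /=; rewrite det_mat3.
  by rewrite (_ : _ + _ = e * (a * k + c * g)) ?mulf_neq0 //; ring2 char2.
- by move=> [[[e e0] [[[[a c] g] k] /= t0]] [d f]] /=; exists (a * e), (g * e); stab_ring.
- by move=> [[[e e0] [[[[a c] g] k] /= t0]] [d f]] /=; exists (c * e), (e * k); stab_ring.
elim/mat3_ind => a b c d e f g h k x y x' y'.
rewrite det_mat3 !mat3E !simp0 => D.
move=> /mat3P[[_ _ E1] _ _] /mat3P[[_ _ E2] _ _].
have b0 : b = 0.
  by apply: (mulf_eq0l _ D); apply: (lincomb2 (c := c * e + b * f) (c' := a * e - b * d) E1 E2);
     ring2 char2.
have h0 : h = 0.
  by apply: (mulf_eq0l _ D); apply: (lincomb2 (c := e * k + f * h) (c' := d * h + g * e) E1 E2);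
     ring2 char2.
subst b h; have e0 : e != 0 by nzfrom D.
have t0 : a * k + c * g != 0.
  by apply: contraNneq D => t0; apply/eqP; apply: (lincomb1 (c := e) t0); ring2 char2.
by exists (Sub e e0, Sub (a, c, g, k) t0, (d, f)).
Qed.

Lemma stab_o12_3 : #|stab (mat3 0 1 0 1 1 0 0 0 0 : 'M[F]_3) (mat3 0 0 0 0 1 1 0 1 0)|%:R =
  Q ^+ 3 * (Q - 1) ^+ 2.
Proof.
rewrite (@stab_card _ _ (U * U * (F * F * F))%type (fun '(e, s, (c, d, f)) =>
  mat3 (c + val s) 0 c d (val e) f (c + val s + val e) 0 (c + val e))).
- by rewrite !card_prod !natrM card_nonzero -/qF; ring.
- move=> [[e s] [[c d] f]] [[e' s'] [[c' d'] f']] /mat3P[].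
  by move=> [E _ Ec] [-> /val_inj-> ->] _; move: E; rewrite Ec => /addrI/val_inj->.
- move=> [[[e e0] [s s0]] [[c d] f]] /=; rewrite det_mat3.
  by rewrite (_ : _ + _ = e * e * s) ?mulf_neq0 //; ring2 char2.
- by move=> [[[e e0] [s s0]] [[c d] f]] /=; exists ((c + s) * e), ((c + s + e) * e); stab_ring.
- by move=> [[[e e0] [s s0]] [[c d] f]] /=; exists (c * e), (e * (c + e)); stab_ring.
elim/mat3_ind => a b c d e f g h k x y x' y'.
rewrite det_mat3 !mat3E !simp0 => D.
move=> /mat3P[[E1 E2 _] [_ E3 E4] [_ _ E5]] /mat3P[[_ E6 _] [_ E7 E8] _].
have b0 : b = 0 by apply: mulxx_eq0; rewrite -E1; ring2 char2.
have h0 : h = 0 by apply: mulxx_eq0; rewrite -E5; ring2 char2.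
subst b h; have e0 : e != 0 by nzfrom D.
have gE : g = a + e.
  by apply: (mulfI e0); apply: (lincomb3 (c := 1) (c' := -1) (c2 := -1) E3 E2 E4); ring2 char2.
have kE : k = c + e.
  by apply: (mulfI e0); apply: (lincomb3 (c := 1) (c' := -1) (c2 := -1) E7 E6 E8); ring2 char2.
(* The parameter s = a + c is the determinant divided by e^2. *)
subst g k; have s0 : a + c != 0.
  by apply: contraNneq D => s0; apply/eqP; apply: (lincomb1 (c := e * e) s0); ring2 char2.
exists (Sub e e0, Sub (a + c) s0, (c, d, f)) => /=; congr mat3; ring2 char2.
Qed.

Lemma stab_o13_1 : #|stab (mat3 0 1 0 1 0 0 0 0 0 : 'M[F]_3) (mat3 0 0 0 0 1 0 0 0 1)|%:R =
  Q * (Q - 1) ^+ 2.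
Proof.
rewrite (@stab_card _ _ (U * U * F)%type (fun '(a, e, d) =>
  mat3 (val a) 0 0 d (val e) 0 0 0 (val e))).
- by rewrite !card_prod !natrM card_nonzero -/qF; ring.
- move=> [[a e] d] [[a' e'] d'] /mat3P[].
  by move=> [/val_inj-> _ _] [-> /val_inj-> _] _.
- move=> [[[a a0] [e e0]] d] /=; rewrite det_mat3.
  by rewrite (_ : _ + _ = a * e * e) ?mulf_neq0 //; ring.
- by move=> [[[a a0] [e e0]] d] /=; exists (a * e), 0; stab_ring.
- by move=> [[[a a0] [e e0]] d] /=; exists 0, (e * e); stab_ring.
elim/mat3_ind => a b c d e f g h k x y x' y'.
rewrite det_mat3 !mat3E !simp0 => D.
move=> /mat3P[[_ _ E1] [_ _ E2] _] /mat3P[[E3 _ E4] [_ E5 E6] [_ _ E7]].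
have cE : c = b by apply: mulxx_inj => //; apply: (lincomb1 (c := 1) E3); ring2 char2.
have kE : k = e + f + h.
  by apply: mulxx_inj => //; apply: (lincomb2 (c := 1) (c' := -1) E5 E7); ring2 char2.
subst c k.
have b0 : b = 0.
  have : b * (e + f) = 0 by apply: (lincomb1 (c := 1) E4); ring2 char2.
  move/eqP; rewrite mulf_eq0 char2_addr_eq0 // => /orP[/eqP//|/eqP fE].
  by case/eqP: D; rewrite fE; ring2 char2.
subst b; have a0 : a != 0 by nzfrom D.
have h0 : h = 0 by apply: (mulf_eq0r _ a0); apply: (lincomb1 (c := 1) E1); ring.
subst h; have e0 : e != 0 by nzfrom D.
have g0 : g = 0 by apply: (mulf_eq0r _ e0); apply: (lincomb1 (c := 1) E2); ring.
have m0 : e + f != 0.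
  by apply: contraNneq D => m0; apply/eqP; apply: (lincomb1 (c := a * e) m0); ring2 char2.
have f0 : f = 0 by apply: (mulf_eq0l _ m0); apply: (lincomb1 (c := 1) E6); ring.
by subst f g; exists (Sub a a0, Sub e e0, d); rewrite /= !simp0.
Qed.

Lemma stab_o13_3 : #|stab (mat3 0 1 0 1 1 0 0 0 0 : 'M[F]_3) (mat3 0 0 0 0 1 0 0 0 1)|%:R =
  Q * (Q - 1).
Proof.
rewrite (@stab_card _ _ (U * F)%type (fun '(a, d) =>
  mat3 (val a) 0 0 d (val a) 0 0 0 (val a))).
- by rewrite !card_prod !natrM card_nonzero -/qF; ring.
- by move=> [a d] [a' d'] /mat3P[[/val_inj-> _ _] [-> _ _] _].
- move=> [[a a0] d] /=; rewrite det_mat3.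
  by rewrite (_ : _ + _ = a * a * a) ?mulf_neq0 //; ring.
- by move=> [[a a0] d] /=; exists (a * a), 0; stab_ring.
- by move=> [[a a0] d] /=; exists 0, (a * a); stab_ring.
elim/mat3_ind => a b c d e f g h k x y x' y'.
rewrite det_mat3 !mat3E !simp0 => D.
move=> /mat3P[[E1 E2 E3] [_ E4 E5] [_ _ E6]] /mat3P[[E7 E7' _] [_ E8 E9] [_ _ E10]].
have b0 : b = 0 by apply: mulxx_eq0; rewrite -E1; ring2 char2.
have c0 : c = 0 by apply: mulxx_eq0; rewrite -E7 b0; ring2 char2.
subst b c; have a0 : a != 0 by nzfrom D.
have h0 : h = 0 by apply: (mulf_eq0l _ a0); apply: (lincomb1 (c := 1) E3); ring.
subst h; have e0 : e != 0 by nzfrom D.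
have k0 : k != 0 by nzfrom D.
have g0 : g = 0 by apply: (mulf_eq0l _ e0); apply: (lincomb1 (c := 1) E5); ring.
have f0 : f = 0 by apply: (mulf_eq0l _ k0); apply: (lincomb1 (c := 1) E9); ring.
subst g f; have ea : e = a.
  by apply: (mulfI e0); apply: (lincomb3 (c := 1) (c' := -1) (c2 := -1) E4 E2 E6); ring2 char2.
subst e; have ka : k = a.
  apply: mulxx_inj => //.
  by apply: (lincomb3 (c := 1) (c' := -1) (c2 := 1) E10 E8 E7'); ring2 char2.
by subst k; exists (Sub a a0, d).
Qed.

Lemma stab_o16_1 : #|stab (mat3 0 0 1 0 1 0 1 0 0 : 'M[F]_3) (mat3 0 0 0 0 0 1 0 1 0)|%:R =
  Q ^+ 2 * (Q - 1) ^+ 2.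
Proof.
rewrite (@stab_card _ _ (U * U * (F * F))%type (fun '(e, k, (d, g)) =>
  mat3 (val e ^+ 2 / val k) 0 0 d (val e) 0 g 0 (val k))).
- by rewrite !card_prod !natrM card_nonzero -/qF; ring.
- by move=> [[e k] [d g]] [[e' k'] [d' g']] /mat3P[_ [-> /val_inj-> _] [-> _ /val_inj->]].
- move=> [[[e e0] [k k0]] [d g]] /=; rewrite det_mat3.
  by rewrite (_ : _ + _ = e * e * e) ?mulf_neq0 //; field.
- move=> [[[e e0] [k k0]] [d g]] /=; exists (e * e), (d * k); rewrite !mat3E.
  by congr mat3; field2 char2.
- by move=> [[[e e0] [k k0]] [d g]] /=; exists 0, (e * k); stab_ring.
elim/mat3_ind => a b c d e f g h k x y x' y'.
rewrite det_mat3 !mat3E !simp0 => D.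
move=> /mat3P[[E1 E2 E3] [_ E4 E5] [_ _ E6]] /mat3P[[_ E7 E8] [_ E9 _] _].
have x'0 : x' = 0 by rewrite -E9; ring2 char2.
rewrite x'0 in E8; have m0 : e * k - f * h != 0.
  apply: contraNneq D => m0; apply/eqP.
  by apply: (lincomb3 (c := a) (c' := d) (c2 := g) m0 E8 E7); ring2 char2.
have [b0 c0] : b = 0 /\ c = 0.
  apply: (minors_eq0 m0); [apply: (lincomb1 (c := 1) E7)|apply: (lincomb1 (c := 1) E8)]; ring.
subst b c; have a0 : a != 0 by nzfrom D.
have f0 : f = 0 by apply: (mulf_eq0l _ a0); apply: (lincomb1 (c := 1) E2); ring.
subst f; have e0 : e != 0 by nzfrom D.
have k0 : k != 0 by nzfrom D.
have h0 : h = 0 by apply: mulxx_eq0; apply: (lincomb1 (c := 1) E6); ring2 char2.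
subst h; have aE : a = e ^+ 2 / k.
  by apply: (mulIf k0); apply: (lincomb2 (c := 1) (c' := -1) E3 E4); field2 char2.
by exists (Sub e e0, Sub k k0, (d, g)); rewrite /= -aE.
Qed.

Lemma stab_o16_3 : #|stab (mat3 0 0 1 0 1 0 1 0 0 : 'M[F]_3) (mat3 0 0 0 0 0 1 0 1 1)|%:R =
  Q ^+ 2 * (Q - 1).
Proof.
rewrite (@stab_card _ _ (U * (F * F))%type (fun '(e, (g, h)) =>
  mat3 (val e) 0 0 ((h ^+ 2 + val e * h) / val e) (val e) 0 g h (val e))).
- by rewrite !card_prod !natrM card_nonzero -/qF; ring.
- by move=> [e [g h]] [e' [g' h']] /mat3P[[/val_inj-> _ _] _ [-> -> _]].
- move=> [[e e0] [g h]] /=; rewrite det_mat3.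
  by rewrite (_ : _ - _ + _ = e * e * e) ?mulf_neq0 //; field.
- move=> [[e e0] [g h]] /=; exists (e * e), (h * h); rewrite !mat3E.
  by congr mat3; field2 char2.
- by move=> [[e e0] [g h]] /=; exists 0, (e * e); stab_ring.
elim/mat3_ind => a b c d e f g h k x y x' y'.
rewrite det_mat3 !mat3E !simp0 => D.
move=> /mat3P[[E1 E2 E3] [_ E4 E5] [_ _ E6]] /mat3P[[E7 E8 E9] [_ E10 E11] [_ _ E12]].
have b0 : b = 0 by apply: mulxx_eq0; rewrite -E1; ring2 char2.
have c0 : c = 0 by apply: mulxx_eq0; rewrite -E7 b0; ring2 char2.
subst b c; have a0 : a != 0 by nzfrom D.
have f0 : f = 0 by apply: (mulf_eq0l _ a0); apply: (lincomb1 (c := 1) E2); ring.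
subst f; have e0 : e != 0 by nzfrom D.
have k0 : k != 0 by nzfrom D.
have ke : k = e.
  by apply: (mulfI k0); apply: (lincomb2 (c := 1) (c' := -1) E12 E11); ring2 char2.
subst k; have ae : a = e.
  by apply: (mulfI e0); apply: (lincomb2 (c := 1) (c' := -1) E3 E4); ring2 char2.
subst a; have dE : d = (h ^+ 2 + e * h) / e.
  by apply: (mulfI e0); apply: (lincomb2 (c := 1) (c' := -1) E5 E6); field2 char2.
by exists (Sub e e0, (g, h)); rewrite /= -dE.
Qed.

Section QuadraticParameters.
Variables (u v : F).
Hypothesis (v0 : v != 0) (huv : forall x, v * x ^+ 2 + u * v * x - 1 != 0).

(** With u = 0 the square root of 1/v would be a root. *)
Lemma quadratic_u_neq0 : u != 0.
Proof.
have [r rE] := sqrtP char2 v^-1.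
by apply: contraNneq (huv r) => ->; rewrite rE; apply/eqP; field.
Qed.

(** This is the norm of a + d w in the quadratic extension F(w) with w^2 = uv w + v; it is the
    hypothesis homogenized at a / (v d). *)
Lemma norm_neq0 a d : (a, d) != (0, 0) -> a ^+ 2 + u * v * a * d + v * d ^+ 2 != 0.
Proof.
rewrite xpair_eqE negb_and; have [->|d0] := eqVneq d 0.
  by rewrite orbF expr0n !mulr0 !addr0 sqrf_eq0.
move=> _; have := huv (a / (v * d)); apply: contraNneq => E.
apply/eqP; have vd : v * d ^+ 2 != 0 by rewrite mulf_neq0 ?expf_neq0.
apply: (mulIf vd); apply: (lincomb1 (c := 1) E); field2 char2.
by rewrite v0 d0.
Qed.

(** The upper left block is multiplication by a + d w in the extension with w^2 = uv w + v, in the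
    basis 1, w, possibly composed with the conjugation w |-> w + uv; the boolean tells which. *)
Lemma stab_o10 : #|stab (mat3 v 0 0 0 1 0 0 0 0 : 'M[F]_3) (mat3 0 1 0 1 u 0 0 0 0)|%:R =
  2%:R * Q ^+ 2 * (Q - 1) * (Q ^+ 2 - 1).
Proof.
have u0 := quadratic_u_neq0.
rewrite (@stab_card _ _ ({p : F * F | p != (0, 0)} * bool * U * (F * F))%type
  (fun '(p, s, k, (c, f)) => let: (a, d) := val p in
    if s then mat3 a (v * d) c d (a + u * v * d) f 0 0 (val k)
    else mat3 a (v * d + u * v * a) c d a f 0 0 (val k))).
- rewrite !card_prod card_bool !natrM card_nonzero -/qF card_sig card_rat.
  have -> : \sum_(p : F * F) (p != (0, 0))%:R = Q ^+ 2 - 1.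
    rewrite (eq_bigr (fun p => 1 - (p == (0, 0))%:R)) => [|p _].
      rewrite sumrB sumr_const card_prod natrM -/qF (bigD1 (0, 0)) //= eqxx big1 ?addr0 //.
      by move=> p /negPf->.
    by case: eqP; rewrite /= ?subrr ?subr0.
  by ring.
- move=> [[[p s] k] [c f]] [[[p' s'] k'] [c' f']].
  case E: (val p) (valP p) => [a d]; case E': (val p') (valP p') => [a' d'] /= n0 n0'.
  have pp : a = a' -> d = d' -> p = p' by move=> aa dd; apply: val_inj; rewrite E E' aa dd.
  case: s s' => [] [] /mat3P[[aa bb ->] [dd ee ->] [_ _ /val_inj->]]; rewrite (pp aa dd) //.
  + case/eqP: n0; subst a' d'; congr (_, _).
      apply: (mulfI u0); apply: (mulfI v0); apply: (lincomb1 (c := 1) bb); ring2 char2.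
    apply: (mulfI u0); apply: (mulfI v0); apply: (lincomb1 (c := 1) ee); ring2 char2.
  + case/eqP: n0; subst a' d'; congr (_, _).
      apply: (mulfI u0); apply: (mulfI v0); apply: (lincomb1 (c := 1) bb); ring2 char2.
    apply: (mulfI u0); apply: (mulfI v0); apply: (lincomb1 (c := 1) ee); ring2 char2.
- move=> [[[[[a d] /= /norm_neq0 n0] s] [k k0]] [c f]]; case: s; rewrite /= det_mat3.
    rewrite (_ : _ - _ + _ = (a ^+ 2 + u * v * a * d + v * d ^+ 2) * k) ?mulf_neq0 //.
    ring2 char2.
  rewrite (_ : _ - _ + _ = (a ^+ 2 + u * v * a * d + v * d ^+ 2) * k) ?mulf_neq0 //.
  ring2 char2.
- move=> [[[[[a d] /= n0] s] [k k0]] [c f]]; case: s => /=.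
    exists (a ^+ 2 + v * d ^+ 2), (v * a * d + v * d * (a + u * v * d)); stab_ring.
  exists (a ^+ 2 + v * d ^+ 2 + u ^+ 2 * v * a ^+ 2), (v * a * d + (v * d + u * v * a) * a).
  stab_ring.
- move=> [[[[[a d] /= n0] s] [k k0]] [c f]]; case: s => /=.
    exists (u * v * d ^+ 2), (a * (a + u * v * d) + v * d * d + u * (v * d) * (a + u * v * d)).
    stab_ring.
  exists (u * v * (d ^+ 2 + u ^+ 2 * a ^+ 2)), (a * a + (v * d + u * v * a) * d + u * (v * d + u
    * v * a) * a).
  stab_ring.
elim/mat3_ind => a b c d e f g h k x y x' y'.
rewrite det_mat3 !mat3E !simp0 => D.
move=> /mat3P[[E1 E2 _] [_ E3 _] [_ _ E4]] /mat3P[[E5 E6 _] [_ E7 _] [_ _ E8]].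
have h0 : h = 0 by apply: mulxx_eq0; apply: (mulfI u0); apply: (lincomb1 (c := 1) E8); ring2 char2.
have g0 : g = 0 by apply: mulxx_eq0; apply: (mulfI v0); apply: (lincomb1 (c := 1) E4);
  rewrite h0; ring2 char2.
subst g h; have k0 : k != 0 by nzfrom D.
have n0 : (a, d) != (0, 0).
  by apply: contraNneq D => -[-> ->]; apply/eqP; ring.
have C2 : b ^+ 2 = v * (e ^+ 2 + a * e + b * d + u * b * e).
  apply: (mulfI u0).
  by apply: (lincomb3 (c := 1) (c' := v) (c2 := u * v) E5 E7 E6); ring2 char2.
have C1 : v * a ^+ 2 + b ^+ 2 = v * (v * d ^+ 2 + e ^+ 2 + u * (v * a * d + b * e)).
  by apply: (lincomb3 (c := 1) (c' := v) (c2 := u * v) E1 E3 E2); ring2 char2.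
have C : a * e + b * d = a ^+ 2 + u * v * a * d + v * d ^+ 2.
  by apply: (mulfI v0); apply: (lincomb2 (c := 1) (c' := 1) C1 C2); ring2 char2.
(* [C] says that the block has the determinant of multiplication by a + d w, so its second column
   differs from w (a + d w) by a multiple t of the first. What follows leaves t = 0 or t = uv. *)
have [t [bE eE]] : exists t, b = v * d + t * a /\ e = a + u * v * d + t * d.
  have [a0|a0] := eqVneq a 0; last first.
    exists ((b + v * d) / a); split; first by field2 char2.
    by apply: (mulfI a0); apply: (lincomb1 (c := 1) C); field2 char2.
  have d0 : d != 0 by apply: contraNneq n0 => ->; rewrite a0.
  exists ((e + a + u * v * d) / d); split; last by field2 char2.
  by apply: (mulIf d0); apply: (lincomb1 (c := 1) C); rewrite a0; field2 char2.
have : t * (t + u * v) * (a ^+ 2 + u * v * a * d + v * d ^+ 2) = 0.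
  by apply: (lincomb1 (c := 1) C2); rewrite bE eE; ring2 char2.
move/eqP; rewrite !mulf_eq0 (negPf (norm_neq0 n0)) orbF char2_addr_eq0 // => /orP[]/eqP tE.
  exists (Sub (a, d) n0, true, Sub k k0, (c, f)) => /=.
  by rewrite bE eE tE !mul0r !addr0.
exists (Sub (a, d) n0, false, Sub k k0, (c, f)) => /=.
by rewrite bE eE tE; congr mat3; ring2 char2.
Qed.

Lemma stab_o15 : #|stab (mat3 0 1 0 1 u 0 0 0 1 : 'M[F]_3) (mat3 v 0 0 0 1 0 0 0 0)|%:R =
  2%:R * (Q - 1).
Proof.
have u0 := quadratic_u_neq0; have [r rE] := sqrtP char2 v.
have r0 : r != 0 by apply: contraNneq v0 => r0; rewrite -rE r0 expr0n.
rewrite (@stab_card _ _ (bool * U)%type (fun '(s, k) =>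
  if s then mat3 (val k) 0 0 0 (val k) 0 0 0 (val k)
  else mat3 0 (r * val k) 0 (val k / r) 0 0 0 0 (val k))).
- by rewrite !card_prod card_bool !natrM card_nonzero.
- move=> [s k] [s' k']; case: s s' => [] [] /mat3P[[E _ _] _ [_ _ /val_inj->]] //.
    by case/eqP: (valP k).
  by case/eqP: (valP k').
- move=> [s [k k0]]; case: s; rewrite /= det_mat3.
    by rewrite (_ : _ - _ + _ = k * k * k) ?mulf_neq0 //; ring.
  by rewrite (_ : _ - _ + _ = k * k * k) ?mulf_neq0 //; field2 char2.
- move=> [s [k k0]]; case: s => /=.
    by exists (k * k), 0; stab_ring.
  exists (k * k), (u * (k * k)); rewrite !mat3E -rE; congr mat3; field2 char2 => //.
- move=> [s [k k0]]; case: s => /=.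
    by exists 0, (k * k); stab_ring.
  exists 0, (k * k); rewrite !mat3E -rE; congr mat3; field2 char2 => //.
elim/mat3_ind => a b c d e f g h k x y x' y' D EM1 EM2.
(* The determinant on the line is x times a norm form in (x, y), so the second generator is its only
   singular point and A must fix it. *)
have x'0 : x' = 0.
  have := congr1 determinant EM2; rewrite !det_mulmx det_tr !det_mat3 => dE.
  have : x' * (x' ^+ 2 + u * v * x' * y' + v * y' ^+ 2) = 0.
    move: dE; rewrite !mat3E det_mat3 => dE.
    by apply: (lincomb1 (c := 1) dE); ring2 char2.
  move/eqP; rewrite mulf_eq0 => /orP[/eqP//|]; apply: contraTeq => n0.
  by apply: norm_neq0; rewrite xpair_eqE negb_and n0.
rewrite x'0 in EM2; move: D EM1 EM2; rewrite det_mat3 !mat3E !simp0 -rE => D.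
move=> /mat3P[[E1 E2 E3] [_ E4 E5] [_ _ E6]] /mat3P[[E7 E8 E9] [_ E10 E11] [_ _ E12]].
have hE : h = r * g by apply: mulxx_inj => //; apply: (lincomb1 (c := 1) E12); ring2 char2.
have g0 : g = 0.
  apply/eqP; apply: contraNT D => g0.
  have bE : b = r * a.
    by apply: (mulfI r0); apply: (mulfI g0); apply: (lincomb1 (c := 1) E9); rewrite hE; ring2 char2.
  have eE : e = r * d.
    by apply: (mulfI r0); apply: (mulfI g0); apply: (lincomb1 (c := 1) E11); rewrite hE;
      ring2 char2.
  by rewrite bE eE hE; apply/eqP; ring.
move: hE; rewrite g0 mulr0 => h0; subst g h.
have k0 : k != 0 by nzfrom D.
have c0 : c = 0 by apply: (mulf_eq0l _ k0); apply: (lincomb1 (c := 1) E3); ring.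
have f0 : f = 0 by apply: (mulf_eq0l _ k0); apply: (lincomb1 (c := 1) E5); ring.
subst c f; have bE : b = r * (e + k).
  apply: mulxx_inj => //; apply: (mulfI u0).
  by apply: (lincomb3 (c := 1) (c' := r ^+ 2) (c2 := u * r ^+ 2) E1 E4 E6); ring2 char2.
have aE : a = r * d + k.
  apply: mulxx_inj => //; apply: (mulfI r0); apply: (mulfI r0).
  by apply: (lincomb2 (c := 1) (c' := r ^+ 2) E7 E10); rewrite bE; ring2 char2.
subst a b.
have : (r * d + e) * (r * d + e + k) = 0.
  by apply: (mulfI r0); apply: (lincomb1 (c := 1) E8); ring2 char2.
move/eqP; rewrite mulf_eq0 => /orP[/eqP E|/eqP E].
  case/eqP: D; have -> : e = r * d by apply: (lincomb1 (c := 1) E); ring2 char2.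
  ring2 char2.
have eE : e = r * d + k by apply: (lincomb1 (c := 1) E); ring2 char2.
subst e; have : (r * d + k) * d = 0.
  apply: (mulfI u0); apply: (mulfI r0); apply: (mulfI r0).
  by apply: (lincomb2 (c := 1) (c' := 1) E2 E6); ring2 char2.
move/eqP; rewrite mulf_eq0 => /orP[/eqP e0|/eqP d0].
  exists (false, Sub k k0) => /=; have dE : d = k / r.
    by apply: (mulfI r0); apply: (lincomb1 (c := 1) e0); field2 char2.
  by rewrite dE; congr mat3; field2 char2.
by exists (true, Sub k k0) => /=; rewrite d0; congr mat3; ring2 char2.
Qed.
End QuadraticParameters.

Lemma stab_o14 : #|stab (mat3 1 0 0 0 1 0 0 0 0 : 'M[F]_3) (mat3 0 0 0 0 1 0 0 0 1)|%:R =
  6%:R * (Q - 1).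
Proof.
rewrite (@stab_card _ _ (U * 'I_6)%type (fun '(d, i) => nth 0 (scaled_perms (val d)) i)).
- by rewrite card_prod card_ord natrM card_nonzero -/qF; ring.
- move=> [d [i hi]] [d' [i' hi']]; have := valP d; have := valP d'; move=> /eqP n' /eqP n.
  move=> /= E; suff [dd ii] : val d = val d' /\ i = i'.
    by congr (_, _); apply: val_inj.
  move: E hi hi'.
  do 6 (case: i => [|i]; first by (
    do 6 (case: i' => [|i']; first by (
      move=> /= /mat3P[[? ? ?] [? ? ?] [? ? ?]] _ _;
      solve [done | by case: n | by case: n'])); done)).
  by [].
- move=> [[d d0] [i hi]] /=; move: hi.
  do 6 (case: i => [|i]; first by
    rewrite /= det_mat3 (_ : _ - _ + _ = d * d * d) ?mulf_neq0 //; ring2 char2).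
  by [].
- move=> [[d d0] [i hi]] /=; move: hi.
  do 6 (case: i => [|i]; first by move=> _ /=;
    solve [by exists (d * d), 0; stab_ring | by exists 0, (d * d); stab_ring
         | by exists (d * d), (d * d); stab_ring]).
  by [].
- move=> [[d d0] [i hi]] /=; move: hi.
  do 6 (case: i => [|i]; first by move=> _ /=;
    solve [by exists (d * d), 0; stab_ring | by exists 0, (d * d); stab_ring
         | by exists (d * d), (d * d); stab_ring]).
  by [].
move=> A x y x' y' D E1 E2; have [d [d0 iA]] := stab_diagonal char2 D E1 E2.
have hi : (index A (scaled_perms d) < 6)%N by rewrite index_mem.
by exists (Sub d d0, Ordinal hi); rewrite /= -[LHS](nth_index 0 iA).
Qed.

Section CubicParameters.
Variables (alpha beta gamma : F).
Hypothesis habc : forall x : F, x ^+ 3 + gamma * x ^+ 2 - beta * x + alpha != 0.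

Lemma cubic_splitting : exists (K : fieldType) (iota : {rmorphism F -> K})
    (f : {rmorphism K -> K}) (P : 'M[K]_3) (l0 l2 w0 w2 : K),
  [/\ f =1 @frob F K, P \in unitmx, map_mx f P = cycle3 K *m P,
    [/\ l0 != l2, w0 != 0 & w2 != 0] &
   P *m map_mx iota (mat3 alpha^-1 0 0 0 gamma 1 0 1 0) *m P^T =
     w0 *: mat3 1 0 0 0 1 0 0 0 0 + w2 *: mat3 0 0 0 0 1 0 0 0 1 /\
   P *m map_mx iota (mat3 0 1 0 1 beta 0 0 0 1) *m P^T =
      (l0 * w0) *: mat3 1 0 0 0 1 0 0 0 0 + (l2 * w2) *: mat3 0 0 0 0 1 0 0 0 1].
Proof.
have [K [iota _]] := countable_algebraic_closure F.
have h2 := char2_morph iota char2.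
have [f fE] := frob_morph iota char2.
have [x xE] := @solve_monicpoly K 3 (nth 0 [:: iota alpha; iota beta; iota gamma]) isT.
have rx : x ^+ 3 + iota gamma * x ^+ 2 + iota beta * x + iota alpha = 0.
  by rewrite xE !big_ord_recl big_ord0 /= /bump /= expr0 expr1; ring2 h2.
have [m mE] := @solve_monicpoly K 2 (nth 0 [:: x]) isT.
have mE' : m ^+ 2 = x by rewrite mE !big_ord_recl big_ord0 /= expr0; ring.
have [P [l0 [l2 [w0 [w2 [dP fP ne E1 E2]]]]]] :=
  cubic_diagonalization char2 habc fE rx (ex_intro _ m mE').
exists K, iota, f, P, l0, l2, w0, w2; split=> //; first by rewrite unitmxE unitfE.
by rewrite !map_mat3 !(rmorph0, rmorph1, fmorphV).
Qed.

Local Notation M1 := (mat3 alpha^-1 0 0 0 gamma 1 0 1 0 : 'M[F]_3).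
Local Notation M2 := (mat3 0 1 0 1 beta 0 0 0 1 : 'M[F]_3).

(* After conjugation by P, the stabilizer of the line becomes the set of matrices d C^i
   with d in F and C a 3-cycle, because P o Frobenius = C P. *)
Lemma stab_o17 : #|stab M1 M2|%:R = 3%:R * (Q - 1).
Proof.
have [K [iota [f [P [l0 [l2 [w0 [w2 [fE uP fP [l02 w00 w20] [D1 D2]]]]]]]]]] := cubic_splitting.
have h2 : 2%:R = 0 :> K := char2_morph iota char2.
pose E1 : 'M[K]_3 := mat3 1 0 0 0 1 0 0 0 0; pose E2 : 'M[K]_3 := mat3 0 0 0 0 1 0 0 0 1.
rewrite -/E1 -/E2 in D1 D2.
have iotaI : injective iota by apply: fmorph_inj.
have uPt : P^T \in unitmx by rewrite unitmx_tr.
have l02' : l0 + l2 != 0 by rewrite (char2_addr_eq0 h2).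
have spanD s t : exists X Y, s *: E1 + t *: E2 =
    X *: (w0 *: E1 + w2 *: E2) + Y *: ((l0 * w0) *: E1 + (l2 * w2) *: E2).
  exists (s / w0 + (s / w0 + t / w2) / (l0 + l2) * l0), ((s / w0 + t / w2) / (l0 + l2)).
  by rewrite /E1 /E2 !mat3E; congr mat3; field2 h2; rewrite w00 w20 l02'.
(* The coordinates lie in F because they are entries of N: at (1, 2) and (0, 1) one generator has 1
   and the other 0. *)
have descent (N : 'M[F]_3) X Y : map_mx iota N = X *: map_mx iota M1 + Y *: map_mx iota M2 ->
    exists x y, N = x *: M1 + y *: M2.
  move=> EN; exists (N 1 2%:R), (N 0 1); apply: (@map_mx_inj _ _ iota).
  rewrite EN map_mxD !map_mxZ; congr (_ *: _ + _ *: _).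
    have := congr1 (fun A : 'M[K]_3 => A 1 2%:R) EN; rewrite !mxE /= => ->.
    by rewrite rmorph1 rmorph0; ring.
  have := congr1 (fun A : 'M[K]_3 => A 0 1) EN; rewrite !mxE /= => ->.
  by rewrite rmorph1 rmorph0; ring.
(* The conjugate of the 3-cycle by P is fixed by Frobenius, since Frobenius multiplies P by that
   very cycle; so its entries lie in F. *)
have [C0 C0E] : exists C0 : 'M[F]_3, map_mx iota C0 = invmx P *m cycle3 K *m P.
  have fN : map_mx f (invmx P *m cycle3 K *m P) = invmx P *m cycle3 K *m P.
    have fC : map_mx f (cycle3 K) = cycle3 K.
      by rewrite /cycle3 map_mat3 !(rmorph0, rmorph1).
    have uC : cycle3 K \in unitmx.
      by rewrite unitmxE unitfE det_mat3 (_ : _ - _ + _ = 1) ?oner_eq0 //; ring.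
    rewrite !map_mxM map_invmx fP fC.
    rewrite -[RHS]mulmxA; apply: (can_inj (mulKmx (_ : cycle3 K *m P \in unitmx))).
      by rewrite unitmx_mul uC.
    by rewrite -mulmxA mulKVmx ?unitmx_mul ?uC // -(mulmxA (cycle3 K)) mulKVmx // mulmxA.
  have entry (ij : 'I_3 * 'I_3) : exists s, (invmx P *m cycle3 K *m P) ij.1 ij.2 = iota s.
    by apply: frob_fixed; rewrite -fE -[in RHS]fN [RHS]mxE.
  have [c cE] := fin_all_exists entry.
  by exists (\matrix_(i, j) c (i, j)); apply/matrixP => i j; rewrite [LHS]mxE [X in iota X]mxE -cE.
pose g (p : U * 'I_3) : 'M[F]_3 := let: (d, i) := p in
  val d *: nth 0 [:: 1%:M; C0; C0 *m C0] i.
have gE p : map_mx iota (g p) = invmx P *m nth 0 (scaled_perms (iota (val p.1))) p.2 *m P.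
  case: p => [[d d0] [[|[|[|i]]] hi]] //; rewrite /g map_mxZ /=.
  - rewrite map_mx1 (_ : mat3 _ _ _ _ _ _ _ _ _ = iota d *: 1%:M).
      by rewrite -scalemxAr mulmx1 -scalemxAl mulVmx.
    by rewrite one_mat3 scale_mat3 !simp0.
  - rewrite C0E (_ : mat3 _ _ _ _ _ _ _ _ _ = iota d *: cycle3 K).
      by rewrite -scalemxAr -scalemxAl.
    by rewrite /cycle3 scale_mat3 !simp0.
  - rewrite map_mxM C0E (_ : mat3 _ _ _ _ _ _ _ _ _ = iota d *: (cycle3 K *m cycle3 K)).
      by rewrite -scalemxAr -scalemxAl !mulmxA mulmxK.
    by rewrite /cycle3 mul_mat3 scale_mat3 !simp0.
have gcong p N : P *m map_mx iota (g p *m N *m (g p)^T) *m P^T =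
    let B := nth 0 (scaled_perms (iota (val p.1))) p.2 in
    B *m (P *m map_mx iota N *m P^T) *m B^T.
  rewrite !map_mxM -map_trmx gE /= !trmx_mul !mulmxA mulmxV // mul1mx.
  by rewrite -(mulmxA _ (invmx P)^T) -trmx_mul mulmxV // trmx1 mulmx1.
have permE d i s t : (i < 3)%N -> exists s' t', nth 0 (scaled_perms d) i *m (s *: E1 + t *: E2) *m
    (nth 0 (scaled_perms d) i)^T = s' *: E1 + t' *: E2.
  case: i => [|[|[|i]]] // _; rewrite /E1 /E2 /=.
  - by exists (d * d * s), (d * d * t); rewrite !mat3E; congr mat3; ring.
  - by exists (d * d * (s + t)), (d * d * s); rewrite !mat3E; congr mat3; ring2 h2.
  - by exists (d * d * t), (d * d * (s + t)); rewrite !mat3E; congr mat3; ring2 h2.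
have gstab p N s t : P *m map_mx iota N *m P^T = s *: E1 + t *: E2 ->
    exists x y, g p *m N *m (g p)^T = x *: M1 + y *: M2.
  move=> EN; have [s' [t' E]] := permE (iota (val p.1)) _ s t (ltn_ord p.2).
  have [X [Y EXY]] := spanD s' t'.
  apply: (descent _ X Y); apply: (can_inj (mulKmx uP)); apply: (can_inj (mulmxK uPt)).
  rewrite gcong EN [LHS]E EXY -D1 -D2 mulmxDr mulmxDl -!scalemxAr -!scalemxAl //.
rewrite (@stab_card _ _ (U * 'I_3)%type g).
- by rewrite card_prod card_ord natrM (card_nonzero) -/qF; ring.
- move=> [[d d0] [i hi]] [[d' d0'] [i' hi']] /(congr1 (map_mx iota)); rewrite !gE /= => E.
  have uP' : invmx P \in unitmx by rewrite unitmx_inv.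
  have {}E := can_inj (mulKmx uP') (can_inj (mulmxK uP) E).
  suff [/iotaI dd ii] : iota d = iota d' /\ i = i' by congr (_, _); apply: val_inj.
  have n : iota d <> 0 by move/eqP; rewrite fmorph_eq0 (negPf d0).
  have n' : iota d' <> 0 by move/eqP; rewrite fmorph_eq0 (negPf d0').
  case: i i' hi hi' E => [|[|[|i]]] // [|[|[|i']]] // _ _ /=
    /mat3P[[? ? ?] [? ? ?] [? ? ?]]; solve [done | by case: n | by case: n'].
- move=> p; rewrite -(fmorph_eq0 iota) -det_map_mx gE !det_mulmx det_inv.
  have dP : \det P != 0 by rewrite -unitfE -unitmxE.
  rewrite mulrAC mulVf // mul1r; case: p => [[d d0] [[|[|[|i]]] hi]] //=;
    rewrite det_mat3 (_ : _ - _ + _ = iota d * iota d * iota d) ?mulf_neq0 ?fmorph_eq0 //; ring.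
- move=> p; exact: (gstab p _ _ _ D1).
- move=> p; exact: (gstab p _ _ _ D2).
move=> A x y x' y' dA EA1 EA2.
pose B := P *m map_mx iota A *m invmx P.
have conjB N : B *m (P *m map_mx iota N *m P^T) *m B^T =
    P *m map_mx iota (A *m N *m A^T) *m P^T.
  rewrite /B !map_mxM -map_trmx !trmx_mul !mulmxA mulmxKV //.
  by rewrite -(mulmxA _ P^T) -trmx_mul mulVmx // trmx1 mulmx1.
have [a1 [b1 B1]] : exists s t, B *m (w0 *: E1 + w2 *: E2) *m B^T = s *: E1 + t *: E2.
  rewrite -D1 conjB EA1 map_mxD !map_mxZ mulmxDr mulmxDl -!scalemxAr -!scalemxAl D1 D2.
  rewrite !scalerDr !scalerA addrACA -!scalerDl.
  by do 2 eexists.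
have [a2 [b2 B2]] : exists s t,
    B *m ((l0 * w0) *: E1 + (l2 * w2) *: E2) *m B^T = s *: E1 + t *: E2.
  rewrite -D2 conjB EA2 map_mxD !map_mxZ mulmxDr mulmxDl -!scalemxAr -!scalemxAl D1 D2.
  rewrite !scalerDr !scalerA addrACA -!scalerDl.
  by do 2 eexists.
have Bspan s t : exists s' t', B *m (s *: E1 + t *: E2) *m B^T = s' *: E1 + t' *: E2.
  have [X [Y ->]] := spanD s t.
  rewrite mulmxDr mulmxDl -!scalemxAr -!scalemxAl B1 B2.
  rewrite !scalerDr !scalerA addrACA -!scalerDl.
  by do 2 eexists.
have [c1 [d1]] := Bspan 1 0; rewrite scale1r scale0r addr0 => BE1.
have [c2 [d2]] := Bspan 0 1; rewrite scale1r scale0r add0r => BE2.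
have dB : \det B != 0.
  rewrite !det_mulmx det_inv mulrAC mulfV ?mul1r; last by rewrite -unitfE -unitmxE.
  by rewrite det_map_mx fmorph_eq0.
have [d [d0 iB]] := stab_diagonal h2 dB BE1 BE2.
(* The condition that A is defined over F, read on its conjugate B. *)
have fB : map_mx f B *m cycle3 K = cycle3 K *m B.
  have fA : map_mx f (map_mx iota A) = map_mx iota A.
    by apply/matrixP => i j; rewrite !mxE fE frob_iota.
  have uCP : cycle3 K *m P \in unitmx by rewrite -fP map_unitmx.
  rewrite /B !map_mxM map_invmx fP fA -!mulmxA; congr (_ *m (_ *m (_ *m _))).
  by rewrite -[LHS](mulmxK uP) -(mulmxA (invmx (cycle3 K *m P))) mulVmx // mul1mx.
have AE : map_mx iota A = invmx P *m B *m P.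
  by rewrite /B !mulmxA mulVmx // mul1mx mulmxKV.
have invd : f d = d -> exists e : U, iota (val e) = d.
  rewrite fE => E; have [e eE] := frob_fixed iota E; subst d.
  by move: d0; rewrite fmorph_eq0 => e0; exists (Sub e e0).
clearbody B; suff [fd [i iB3]] : f d = d /\ exists i : 'I_3, B = nth 0 (scaled_perms d) i.
  have [e eE] := invd fd; exists (e, i); apply: (@map_mx_inj _ _ iota).
  by rewrite gE AE iB3 eE.
(* For the three powers of the cycle the relation reduces to f d = d; for the three transpositions
   it would force d = 0. *)
move: fB; rewrite /cycle3; move: iB; rewrite !inE => /or3P[|| /or4P[]] /eqP->;
  rewrite map_mat3 !rmorph0 !mul_mat3 !simp0 => /mat3P[[? ? ?] [? ? ?] [? ? ?]].
- by split=> //; exists 0.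
- by split=> //; exists 1.
- by split=> //; exists 2%:R.
- by case/eqP: d0.
- by case/eqP: d0.
- by case/eqP: d0.
Qed.
End CubicParameters.

End Stabilizers.

(** * The fifteen orbits *)

Section Counts.
Variable F : finFieldType.
Hypothesis char2 : 2%:R = 0 :> F.
Local Notation Q := (qF F).

Definition zero_pred : pred F := fun x => x == 0.
Definition any_pred : pred F := xpredT.
Definition count_pred (p : pred F) : rat := \sum_x (p x)%:R.
Lemma count_eq0 : count_pred zero_pred = 1. Proof. exact: sumF_eq1. Qed.
Lemma count_any : count_pred any_pred = Q. Proof. by rewrite /count_pred sumF_const mulr1. Qed.

Lemma sum_andb (T : finType) (b : bool) (P : pred T) :
  \sum_x (b && P x)%:R = b%:R * \sum_x (P x)%:R :> rat.
Proof.
by rewrite mulr_sumr; apply: eq_bigr => x _; case: b; rewrite ?mul1r ?mul0r.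
Qed.

Lemma sum3_box (B : F -> F -> F -> bool) (p1 p2 p3 : pred F) :
  (forall a b c, B a b c = [&& p1 a, p2 b & p3 c]) ->
  \sum_a \sum_b \sum_c (B a b c)%:R = count_pred p1 * count_pred p2 * count_pred p3.
Proof.
move=> BE; rewrite /count_pred -mulrA mulr_suml; apply: eq_bigr => a _.
rewrite mulr_suml mulr_sumr; apply: eq_bigr => b _.
rewrite mulrA -natrM mulnb -sum_andb; apply: eq_bigr => c _.
by rewrite BE andbA.
Qed.

Lemma sum4_box (B : F -> F -> F -> F -> bool) (p1 p2 p3 p4 : pred F) :
  (forall a b c d, B a b c d = [&& p1 a, p2 b, p3 c & p4 d]) ->
  \sum_a \sum_b \sum_c \sum_d (B a b c d)%:R =
  count_pred p1 * count_pred p2 * count_pred p3 * count_pred p4.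
Proof.
move=> BE; rewrite -(mulrA _ _ (count_pred p3)) -mulrA {1}/count_pred mulr_suml.
apply: eq_bigr => a _.
rewrite -(@sum3_box (fun b c d => [&& p2 b, p3 c & p4 d])) // mulr_sumr.
apply: eq_bigr => b _; rewrite mulr_sumr; apply: eq_bigr => c _.
by rewrite -sum_andb; apply: eq_bigr => d _; rewrite BE.
Qed.

(** Meant for t(n), where d is a diagonal coefficient and c is the parameter along which the square
    root of the coefficient of d is solved. For c different from [s a b] exactly one d works; for c
    = [s a b] all of them do or none. *)
Lemma sum4_affine_square (g : F -> F -> F -> F -> F) (w : F -> F -> F -> F)
    (s : F -> F -> F) (k : F) (r : rat) : k != 0 ->
  (forall a b c d, g a b c d = d * (k * (c + s a b)) ^+ 2 + w a b c) ->
  \sum_a \sum_b (w a b (s a b) == 0)%:R = r ->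
  \sum_a \sum_b \sum_c \sum_d (g a b c d == 0)%:R = Q ^+ 2 * (Q - 1) + Q * r.
Proof.
move=> k0 gE <-.
have -> : Q ^+ 2 * (Q - 1) = \sum_(a : F) \sum_(b : F) (Q - 1).
  by rewrite !sumF_const; ring.
rewrite mulr_sumr -big_split; apply: eq_bigr => a _ /=.
rewrite mulr_sumr -big_split; apply: eq_bigr => b _ /=.
have aff c : \sum_d (g a b c d == 0)%:R =
    if (k * (c + s a b)) ^+ 2 == 0 then Q * (w a b c == 0)%:R else 1.
  by rewrite -sumF_affine; apply: eq_bigr => d _; rewrite gE.
rewrite (@sumF_split _ (s a b) _ 1) => [|c cs].
  by rewrite aff char2_addrr // mulr0 expr0n eqxx mulr1 addrC.
by rewrite aff sqrf_eq0 mulf_eq0 (negPf k0) char2_addr_eq0 // (negPf cs).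
Qed.

Lemma sum2_any (B : F -> F -> bool) : (forall a b, B a b) -> \sum_a \sum_b (B a b)%:R = Q ^+ 2.
Proof.
move=> BT; transitivity (\sum_(a : F) \sum_(b : F) (1 : rat)).
  by apply: eq_bigr => a _; apply: eq_bigr => b _; rewrite BT.
by rewrite !sumF_const mulr1.
Qed.

Lemma sum2_right0 (B : F -> F -> bool) : (forall a b, B a b = (b == 0)) ->
  \sum_a \sum_b (B a b)%:R = Q.
Proof.
move=> BE; transitivity (\sum_(a : F) (1 : rat)); last by rewrite sumF_const mulr1.
by apply: eq_bigr => a _; rewrite -[RHS](sumF_eq1 (0 : F)); apply: eq_bigr => b _; rewrite BE.
Qed.

Lemma sum2_left0 (B : F -> F -> bool) : (forall a b, B a b = (a == 0)) ->
  \sum_a \sum_b (B a b)%:R = Q.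
Proof. by move=> BE; rewrite exchange_big; apply: sum2_right0 => a b; rewrite BE. Qed.

Lemma sum2_cross (B : F -> F -> bool) (s : F -> F) :
  (forall a b, B a b = (a == 0) || (b == s a)) -> \sum_a \sum_b (B a b)%:R = 2%:R * Q - 1.
Proof.
move=> BE; rewrite (@sumF_split _ 0 _ 1) => [|a a0].
  rewrite (eq_bigr (fun=> 1)) => [|b _]; first by rewrite sumF_const; ring.
  by rewrite BE eqxx.
by rewrite -[RHS](sumF_eq1 (s a)); apply: eq_bigr => b _; rewrite BE (negPf a0).
Qed.

Lemma sum2_both0 (B : F -> F -> bool) : (forall a b, B a b = (a == 0) && (b == 0)) ->
  \sum_a \sum_b (B a b)%:R = 1 :> rat.
Proof.
move=> BE; rewrite -[RHS](sumF_eq1 (0 : F)); apply: eq_bigr => a _.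
rewrite (eq_bigr (fun b => ((a == 0) && (b == 0))%:R)) => [|b _]; last by rewrite BE.
by rewrite sum_andb sumF_eq1 mulr1.
Qed.

Lemma mx3E (a b c d e f g h k : F) : mx3 a b c d e f g h k = mat3 a b c d e f g h k.
Proof. by []. Qed.

Lemma orbit_ofE (m : F -> F -> 'M[F]_3) M1 M2 : m 1 0 = M1 -> m 0 1 = M2 ->
  orbit_of m = K_orbit <<[:: M1; M2]>>.
Proof. by rewrite /orbit_of /line_of => -> ->. Qed.

End Counts.

Ltac char2_ring := match goal with h : 2%:R = 0 |- _ => ring2 h end.
Ltac orbit_rep := rewrite mx3E; congr mat3; char2_ring.
Ltac par_perp := move=> [[[? ?] ?] ?]; rewrite /perp !pairing_mat3;
  apply/andP; split; apply/eqP; char2_ring.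
Ltac qeval_par := move=> ? ? ? ? [[? ?] ?] /=; char2_ring.

Ltac prK := move=> [[[[[? ?] ?] ?] ?] ?]; rewrite /perp !pairing_mat3 =>
  /andP[/eqP ? /eqP ?]; congr (_, _, _, _, _, _);
  solve [ done
        | match goal with E : _ = 0 |- _ => apply: (lincomb1 (c := 1) E); char2_ring end
        | match goal with E : _ = 0, E' : _ = 0 |- _ =>
            apply: (lincomb2 (c := 1) (c' := 1) E E'); char2_ring end ].
Ltac nucleus_box p1 p2 p3 p4 := rewrite (@sum4_box _ _ p1 p2 p3 p4) => [|? ? ? ?];
  [by rewrite ?count_eq0 ?count_any; ring
  |by rewrite /= !xpair_eqE ?eqxx /zero_pred /any_pred; do ?case: (_ == 0)].
Ltac value_sum w s k h := apply: (@sum4_affine_square _ h _ w s k);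
  [by rewrite ?oner_neq0 | by move=> ? ? ? ?; rewrite /nucleus_value /=; char2_ring | ].
Ltac stab_neq0 := by rewrite !mulf_neq0 // ?expf_neq0 // ?qF_neq0 // ?qF_sub1_neq0 // ?qF_add1_neq0.
Ltac zeros_box p1 p2 p3 := rewrite (@sum3_box _ _ p1 p2 p3);
  [by rewrite ?count_eq0 ?count_any; ring | move=> x y z].

(** * Parameters and resulting numbers of each orbit *)

Section Orbits.
Variable F : finFieldType.
Hypothesis char2 : 2%:R = 0 :> F.
Local Notation Q := (qF F).

Lemma o5_numbers : hyperplane_numbers (o5 F)
  (1 / 2 * Q * (Q + 1)) (2 * Q ^+ 2 + Q)
  (0) (1 / 2 * Q * (Q + 1)).
Proof.
rewrite /o5 (@orbit_ofE _ _ (mat3 1 0 0 0 0 0 0 0 0) (mat3 0 0 0 0 1 0 0 0 0)); try by orbit_rep.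
(* The last of the four parameters of a form is a diagonal coefficient, as [sum4_affine_square]
   requires. The numbers K, T, R, S come at the end; R = 2Q - 1 because this line has two rank-one
   points. *)
apply: (@line_hyperplane_numbers F char2 _ _
  (fun '(l, m, n, c) => (0, 0, c, l, m, n)) (fun '(a, b, c, l, m, n) => (l, m, n, c))
  (fun '(x, y, z) => y * z) (fun '(x, y, z) => x * z) (fun '(x, y, z) => x * y) (fun '(x, y, z)
    => z ^+ 2)
  Q (Q ^+ 2 * (Q - 1) + Q * (Q ^+ 2)) (2 * Q - 1) (2 * Q ^+ 2 * (Q - 1) ^+ 3)).
- by rewrite tr_mat3.
- by rewrite tr_mat3.
- by case=> [[[]]].
- par_perp.
- prK.
- qeval_par.
- nucleus_box (@zero_pred F) (@zero_pred F) (@zero_pred F) (@any_pred F).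
- value_sum (fun l m n : F => l * m * n) (fun _ _ : F => (0 : F)) (1 : F) char2.
  by apply: sum2_any => ? ?; apply/eqP; ring.
- rewrite -(@sum2_cross _ (fun x y => x * y == 0) (fun=> 0)) => [|x y]; last by rewrite mulf_eq0.
  apply: eq_bigr => x _; apply: eq_bigr => y _.
  rewrite (eq_bigr (fun z => ((x * y == 0) && (z == 0))%:R)) => [|z _].
    by rewrite sum_andb sumF_eq1 mulr1.
  congr (nat_of_bool _)%:R; apply/and4P/andP => [[_ _ -> /eqP e]|[/eqP e /eqP->]].
    by split=> //; apply/eqP/mulxx_eq0; rewrite -e; ring.
  by split; apply/eqP; rewrite ?e; ring.
- by rewrite (stab_o5 char2); ring.
- stab_neq0.
- by field.
- by field.
- by field.
- by field.
Qed.

Lemma o6_numbers : hyperplane_numbers (o6 F)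
  ((Q + 1) ^+ 2) (3 * Q + 1)
  (Q + 1) (Q + 1).
Proof.
rewrite /o6 (@orbit_ofE _ _ (mat3 1 0 0 0 0 0 0 0 0) (mat3 0 1 0 1 0 0 0 0 0)); try by orbit_rep.
apply: (@line_hyperplane_numbers F char2 _ _
  (fun '(c, l, m, b) => (0, b, c, l, m, 0)) (fun '(a, b, c, l, m, n) => (c, l, m, b))
  (fun '(x, y, z) => z ^+ 2) (fun '(x, y, z) => y * z) (fun '(x, y, z) => x * z) (fun '(x, y, z)
    => y ^+ 2)
  (Q ^+ 2) (Q ^+ 2 * (Q - 1) + Q * (Q ^+ 2)) Q (Q ^+ 3 * (Q - 1) ^+ 3)).
- by rewrite tr_mat3.
- by rewrite tr_mat3.
- by case=> [[[]]].
- par_perp.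
- prK.
- qeval_par.
- nucleus_box (@any_pred F) (@zero_pred F) (@zero_pred F) (@any_pred F).
- value_sum (fun _ _ _ : F => (0 : F)) (fun _ _ : F => (0 : F)) (1 : F) char2.
  by apply: sum2_any => ? ?; apply/eqP; ring.
- zeros_box (@any_pred F) (@zero_pred F) (@zero_pred F);
  apply/and4P/and3P => [[/eqP e1 /eqP e2 /eqP e3 /eqP e4]|[_ /eqP-> /eqP->]];
    last by split; apply/eqP; ring.
  by split=> //; apply/eqP/mulxx_eq0; [rewrite -e4|rewrite -e1]; ring.
- by rewrite (stab_o6 char2); ring.
- stab_neq0.
- by field.
- by field.
- by field.
- by field.
Qed.

Lemma o8_1_numbers : hyperplane_numbers (o8_1 F)
  (Q ^+ 2 * (Q ^+ 2 - 1)) ((2 * Q + 3) * (Q - 1) * Q ^+ 2)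
  (Q ^+ 2 * (Q + 1)) (Q * (Q + 1) * (Q ^+ 2 - 1)).
Proof.
rewrite /o8_1 (@orbit_ofE _ _ (mat3 1 0 0 0 0 0 0 0 0) (mat3 0 0 0 0 1 0 0 0 1)); try by orbit_rep.
apply: (@line_hyperplane_numbers F char2 _ _
  (fun '(l, m, n, b) => (0, b, b, l, m, n)) (fun '(a, b, c, l, m, n) => (l, m, n, b))
  (fun '(x, y, z) => y * z) (fun '(x, y, z) => x * z) (fun '(x, y, z) => x * y) (fun '(x, y, z)
    => y ^+ 2 + z ^+ 2)
  Q (Q ^+ 2 * (Q - 1) + Q * (2 * Q - 1)) Q (Q * (Q - 1) ^+ 2)).
- by rewrite tr_mat3.
- by rewrite tr_mat3.
- by case=> [[[]]].
- par_perp.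
- prK.
- qeval_par.
- nucleus_box (@zero_pred F) (@zero_pred F) (@zero_pred F) (@any_pred F).
- value_sum (fun l m n : F => l * m * n) (fun _ m : F => m) (1 : F) char2.
  by apply: (@sum2_cross _ _ (fun=> 0)) => ? ?; by rewrite -mulrA mulf_eq0 mulf_eq0 orbb.
- zeros_box (@any_pred F) (@zero_pred F) (@zero_pred F);
  apply/and4P/and3P => [[/eqP e1 /eqP e2 /eqP e3 /eqP e4]|[_ /eqP-> /eqP->]];
    last by split; apply/eqP; ring.
  have yz : y = z by apply: (mulxx_inj char2); apply: (lincomb1 (c := 1) e4); char2_ring.
  by split=> //; apply/eqP/mulxx_eq0; rewrite -[RHS]e1 ?yz.
- by rewrite (stab_o8_1 char2); ring.
- stab_neq0.
- by field.
- by field.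
- by field.
- by field.
Qed.

Lemma o8_3_numbers : hyperplane_numbers (o8_3 F)
  (Q ^+ 2 * (Q + 1)) (2 * Q ^+ 2)
  (0) (Q * (Q + 1)).
Proof.
rewrite /o8_3 (@orbit_ofE _ _ (mat3 1 0 0 0 0 0 0 0 0) (mat3 0 0 0 0 0 1 0 1 0)); try by orbit_rep.
apply: (@line_hyperplane_numbers F char2 _ _
  (fun '(b, m, n, c) => (0, b, c, 0, m, n)) (fun '(a, b, c, l, m, n) => (b, m, n, c))
  (fun '(x, y, z) => y ^+ 2) (fun '(x, y, z) => x * z) (fun '(x, y, z) => x * y) (fun '(x, y, z)
    => z ^+ 2)
  (Q ^+ 2) (Q ^+ 2 * (Q - 1) + Q * (2 * Q - 1)) Q ((Q - 1) * (Q * (Q - 1) ^+ 2 * (Q + 1)))).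
- by rewrite tr_mat3.
- by rewrite tr_mat3.
- by case=> [[[]]].
- par_perp.
- prK.
- qeval_par.
- nucleus_box (@any_pred F) (@zero_pred F) (@zero_pred F) (@any_pred F).
- value_sum (fun b m _ : F => b * m ^+ 2) (fun _ _ : F => (0 : F)) (1 : F) char2.
  by apply: (@sum2_cross _ _ (fun=> 0)) => ? ?; by rewrite mulf_eq0 sqrf_eq0.
- zeros_box (@any_pred F) (@zero_pred F) (@zero_pred F);
  apply/and4P/and3P => [[/eqP e1 /eqP e2 /eqP e3 /eqP e4]|[_ /eqP-> /eqP->]];
    last by split; apply/eqP; ring.
  by split=> //; apply/eqP/mulxx_eq0; [rewrite -e1|rewrite -e4]; ring.
- by rewrite (stab_o8_3 char2); ring.
- stab_neq0.
- by field.
- by field.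
- by field.
- by field.
Qed.

Lemma o9_numbers : hyperplane_numbers (o9 F)
  (Q * (Q ^+ 2 - 1)) (2 * Q * (Q ^+ 2 - 1))
  (0) (Q ^+ 2 * (Q + 1)).
Proof.
rewrite /o9 (@orbit_ofE _ _ (mat3 1 0 0 0 0 0 0 0 0) (mat3 0 0 1 0 1 0 1 0 0)); try by orbit_rep.
apply: (@line_hyperplane_numbers F char2 _ _
  (fun '(l, m, n, c) => (0, m, c, l, m, n)) (fun '(a, b, c, l, m, n) => (l, m, n, c))
  (fun '(x, y, z) => y * z) (fun '(x, y, z) => x * z + y ^+ 2) (fun '(x, y, z) => x * y) (fun
    '(x, y, z) => z ^+ 2)
  Q (Q ^+ 2 * (Q - 1) + Q * Q) Q (Q ^+ 2 * (Q - 1) ^+ 2)).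
- by rewrite tr_mat3.
- by rewrite tr_mat3.
- by case=> [[[]]].
- par_perp.
- prK.
- qeval_par.
- nucleus_box (@zero_pred F) (@zero_pred F) (@zero_pred F) (@any_pred F).
- value_sum (fun l m n : F => m ^+ 3 + l * m * n) (fun _ _ : F => (0 : F)) (1 : F) char2.
  by apply: sum2_right0 => ? ?; rewrite mulr0 addr0 expf_eq0.
- zeros_box (@any_pred F) (@zero_pred F) (@zero_pred F);
  apply/and4P/and3P => [[/eqP e1 /eqP e2 /eqP e3 /eqP e4]|[_ /eqP-> /eqP->]];
    last by split; apply/eqP; ring.
  have z0 : z = 0 by apply: mulxx_eq0; rewrite -e4; ring.
  by split=> //; apply/eqP => //; apply: mulxx_eq0; rewrite -e2 z0; ring.
- by rewrite (stab_o9 char2); ring.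
- stab_neq0.
- by field.
- by field.
- by field.
- by field.
Qed.

Lemma o10_numbers (u v : F) (v0 : v != 0) (hv : forall x, v * x ^+ 2 + u * v * x - 1 != 0) :
  hyperplane_numbers (o10 u v)
  (1 / 2 * Q * (Q - 1)) (Q * (Q - 1))
  (Q ^+ 2) (1 / 2 * Q * (Q - 1)).
Proof.
have u0 := quadratic_u_neq0 char2 v0 hv.
rewrite /o10 (@orbit_ofE _ _ (mat3 v 0 0 0 1 0 0 0 0) (mat3 0 1 0 1 u 0 0 0 0)); try by orbit_rep.
apply: (@line_hyperplane_numbers F char2 _ _
  (fun '(l, m, a, c) => (a, v * a, c, l, m, u * v * a)) (fun '(a, b, c, l, m, n) => (l, m, a, c))
  (fun '(x, y, z) => y * z) (fun '(x, y, z) => x * z) (fun '(x, y, z) => x ^+ 2 + v * y ^+ 2 + u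
    * v * (x * y)) (fun '(x, y, z) => z ^+ 2)
  Q (Q ^+ 2 * (Q - 1) + Q * (Q ^+ 2)) 1 (2 * Q ^+ 2 * (Q - 1) * ((Q - 1) * (Q + 1)))).
- by rewrite tr_mat3.
- by rewrite tr_mat3.
- by case=> [[[]]].
- par_perp.
- move=> [[[[[? ?] ?] ?] ?] ?]; rewrite /perp !pairing_mat3 => /andP[/eqP E1 /eqP E2].
  congr (_, _, _, _, _, _); first by apply: (lincomb1 (c := 1) E1); char2_ring.
  by apply: (lincomb2 (c := u) (c' := 1) E1 E2); char2_ring.
- qeval_par.
- rewrite (@sum4_box _ _ (@zero_pred F) (@zero_pred F) (@zero_pred F) (@any_pred F)) => [|? ? ? ?].
    by rewrite !count_eq0 count_any; ring.
  rewrite /= !xpair_eqE !mulf_eq0 (negPf u0) (negPf v0) /zero_pred /any_pred /=.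
  by do ?case: (_ == 0).
- apply: (@sum4_affine_square _ char2 _ (fun l m a : F => a * l ^+ 2 + v * a * m ^+ 2 + l * m *
  (u * v * a)) (fun _ _ : F => (0 : F)) (u * v)).
    by rewrite mulf_neq0.
    by move=> ? ? ? ?; rewrite /nucleus_value /=; char2_ring.
  by apply: sum2_any => ? ?; apply/eqP; ring.
- zeros_box (@zero_pred F) (@zero_pred F) (@zero_pred F);
  apply/and4P/and3P => [[/eqP e1 /eqP e2 /eqP e3 /eqP e4]|[/eqP-> /eqP-> /eqP->]];
    last by split; apply/eqP; ring.
  have z0 : z = 0 by apply: mulxx_eq0; rewrite -e4; ring.
  have /eqP[-> ->] : (x, y) == (0, 0).
    by apply: contraTT (introT eqP e3) => /(norm_neq0 char2 v0 hv); rewrite addrAC mulrA.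
  by rewrite z0; split; apply/eqP.
- by rewrite (stab_o10 char2 v0 hv); ring.
- stab_neq0.
- by field.
- by field.
- by field.
- by field.
Qed.

Lemma o12_1_numbers : hyperplane_numbers (o12_1 F)
  (Q ^+ 2 + Q + 1) (1)
  1 (1).
Proof.
rewrite /o12_1 (@orbit_ofE _ _ (mat3 0 1 0 1 0 0 0 0 0) (mat3 0 0 0 0 0 1 0 1 0)); try by orbit_rep.
apply: (@line_hyperplane_numbers F char2 _ _
  (fun '(a, c, m, b) => (a, b, c, 0, m, 0)) (fun '(a, b, c, l, m, n) => (a, c, m, b))
  (fun '(x, y, z) => x ^+ 2) (fun '(x, y, z) => z ^+ 2) (fun '(x, y, z) => x * z) (fun '(x, y,
    z) => y ^+ 2)
  (Q ^+ 3) (Q ^+ 2 * (Q - 1) + Q * (Q ^+ 2)) 1 (Q ^+ 2 * (Q - 1) * (Q * (Q - 1) ^+ 2 * (Q + 1)))).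
- by rewrite tr_mat3.
- by rewrite tr_mat3.
- by case=> [[[]]].
- par_perp.
- prK.
- qeval_par.
- nucleus_box (@any_pred F) (@any_pred F) (@zero_pred F) (@any_pred F).
- value_sum (fun _ _ _ : F => (0 : F)) (fun _ _ : F => (0 : F)) (1 : F) char2.
  by apply: sum2_any => ? ?; apply/eqP; ring.
- zeros_box (@zero_pred F) (@zero_pred F) (@zero_pred F);
  apply/and4P/and3P => [[/eqP e1 /eqP e2 /eqP e3 /eqP e4]|[/eqP-> /eqP-> /eqP->]];
    last by split; apply/eqP; ring.
  by split; apply/eqP/mulxx_eq0; [rewrite -e1|rewrite -e4|rewrite -e2]; ring.
- by rewrite (stab_o12_1 char2); ring.
- stab_neq0.
- by field.
- by field.
- by field.
- by field.
Qed.

Lemma o12_3_numbers : hyperplane_numbers (o12_3 F)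
  ((Q + 1) * (Q ^+ 2 - 1)) ((Q - 1) * (2 * Q + 1))
  ((Q + 1) * (2 * Q - 1)) (Q ^+ 2 - 1).
Proof.
rewrite /o12_3 (@orbit_ofE _ _ (mat3 0 1 0 1 1 0 0 0 0) (mat3 0 0 0 0 1 1 0 1 0)); try by orbit_rep.
apply: (@line_hyperplane_numbers F char2 _ _
  (fun '(m, c, b, a) => (a, b, c, b, m, b)) (fun '(a, b, c, l, m, n) => (m, c, b, a))
  (fun '(x, y, z) => x * z) (fun '(x, y, z) => z ^+ 2) (fun '(x, y, z) => y ^+ 2 + y * z + x *
    y) (fun '(x, y, z) => x ^+ 2)
  (Q ^+ 2) (Q ^+ 2 * (Q - 1) + Q * (Q ^+ 2)) 1 (Q ^+ 3 * (Q - 1) ^+ 2)).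
- by rewrite tr_mat3.
- by rewrite tr_mat3.
- by case=> [[[]]].
- par_perp.
- prK.
- qeval_par.
- nucleus_box (@zero_pred F) (@any_pred F) (@zero_pred F) (@any_pred F).
- value_sum (fun m c b : F => b * m ^+ 2 + c * b ^+ 2 + b ^+ 2 * m) (fun _ _ : F => (0 : F)) (1
  : F) char2.
  by apply: sum2_any => ? ?; apply/eqP; ring.
- zeros_box (@zero_pred F) (@zero_pred F) (@zero_pred F);
  apply/and4P/and3P => [[/eqP e1 /eqP e2 /eqP e3 /eqP e4]|[/eqP-> /eqP-> /eqP->]];
    last by split; apply/eqP; ring.
  have x0 : x = 0 by apply: mulxx_eq0; rewrite -e4; ring.
  have z0 : z = 0 by apply: mulxx_eq0; rewrite -e2; ring.
  by split; apply/eqP => //; apply: mulxx_eq0; rewrite -e3 x0 z0; ring.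
- by rewrite (stab_o12_3 char2); ring.
- stab_neq0.
- by field.
- by field.
- by field.
- by field.
Qed.

Lemma o13_1_numbers : hyperplane_numbers (o13_1 F)
  (Q ^+ 2 * (Q + 1) * (Q ^+ 2 - 1)) (Q ^+ 2 * (Q - 1) * (Q + 2))
  (Q ^+ 3 * (Q + 1)) (Q * (Q + 1) * (Q ^+ 2 - 1)).
Proof.
rewrite /o13_1 (@orbit_ofE _ _ (mat3 0 1 0 1 0 0 0 0 0) (mat3 0 0 0 0 1 0 0 0 1)); try by orbit_rep.
apply: (@line_hyperplane_numbers F char2 _ _
  (fun '(b, m, l, a) => (a, b, b, l, m, 0)) (fun '(a, b, c, l, m, n) => (b, m, l, a))
  (fun '(x, y, z) => y ^+ 2 + z ^+ 2) (fun '(x, y, z) => x * z) (fun '(x, y, z) => y * z) (fun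
    '(x, y, z) => x ^+ 2)
  (Q ^+ 2) (Q ^+ 2 * (Q - 1) + Q * (2 * Q - 1)) 1 (Q * (Q - 1) ^+ 2)).
- by rewrite tr_mat3.
- by rewrite tr_mat3.
- by case=> [[[]]].
- par_perp.
- prK.
- qeval_par.
- nucleus_box (@any_pred F) (@zero_pred F) (@zero_pred F) (@any_pred F).
- value_sum (fun b m _ : F => b * m ^+ 2) (fun _ _ : F => (0 : F)) (1 : F) char2.
  by apply: (@sum2_cross _ _ (fun=> 0)) => ? ?; by rewrite mulf_eq0 sqrf_eq0.
- zeros_box (@zero_pred F) (@zero_pred F) (@zero_pred F);
  apply/and4P/and3P => [[/eqP e1 /eqP e2 /eqP e3 /eqP e4]|[/eqP-> /eqP-> /eqP->]];
    last by split; apply/eqP; ring.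
  have yz : y = z by apply: (mulxx_inj char2); apply: (lincomb1 (c := 1) e1); char2_ring.
  by split; apply/eqP/mulxx_eq0; [rewrite -e4; ring|rewrite -[RHS]e3 yz|rewrite -[RHS]e3 yz].
- by rewrite (stab_o13_1 char2); ring.
- stab_neq0.
- by field.
- by field.
- by field.
- by field.
Qed.

Lemma o13_3_numbers : hyperplane_numbers (o13_3 F)
  (Q ^+ 2 * (Q - 1) * (Q ^+ 2 - 1)) (Q ^+ 2 * (Q + 3) * (Q - 1) ^+ 2)
  (Q ^+ 2 * (Q + 1) * (Q ^+ 2 - 1)) (Q * (Q ^+ 2 - 1) ^+ 2).
Proof.
rewrite /o13_3 (@orbit_ofE _ _ (mat3 0 1 0 1 1 0 0 0 0) (mat3 0 0 0 0 1 0 0 0 1)); try by orbit_rep.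
apply: (@line_hyperplane_numbers F char2 _ _
  (fun '(b, m, l, a) => (a, b, b, l, m, b)) (fun '(a, b, c, l, m, n) => (b, m, l, a))
  (fun '(x, y, z) => y ^+ 2 + z ^+ 2 + x * y) (fun '(x, y, z) => x * z) (fun '(x, y, z) => y *
    z) (fun '(x, y, z) => x ^+ 2)
  Q (Q ^+ 2 * (Q - 1) + Q * (2 * Q - 1)) 1 (Q * (Q - 1))).
- by rewrite tr_mat3.
- by rewrite tr_mat3.
- by case=> [[[]]].
- par_perp.
- prK.
- qeval_par.
- nucleus_box (@zero_pred F) (@zero_pred F) (@zero_pred F) (@any_pred F).
- value_sum (fun b m l : F => b * m ^+ 2 + b ^+ 3 + l * m * b) (fun _ _ : F => (0 : F)) (1 : F)
  char2.
  (* On the kernel the cubic is b (m + b)^2, whose zeros form two lines through the origin. *)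
  apply: (@sum2_cross _ _ (fun b => b)) => b m.
  rewrite (_ : _ + _ = b * (m + b) ^+ 2); last by char2_ring.
  by rewrite mulf_eq0 sqrf_eq0 char2_addr_eq0.
- zeros_box (@zero_pred F) (@zero_pred F) (@zero_pred F);
  apply/and4P/and3P => [[/eqP e1 /eqP e2 /eqP e3 /eqP e4]|[/eqP-> /eqP-> /eqP->]];
    last by split; apply/eqP; ring.
  have x0 : x = 0 by apply: mulxx_eq0; rewrite -e4; ring.
  have yz : y = z by apply: (mulxx_inj char2); apply: (lincomb1 (c := 1) e1); rewrite x0;
    char2_ring.
  by split; apply/eqP => //; apply: mulxx_eq0; rewrite -[RHS]e3 yz.
- by rewrite (stab_o13_3 char2); ring.
- stab_neq0.
- by field.
- by field.
- by field.
- by field.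
Qed.

Lemma o14_1_numbers : hyperplane_numbers (o14_1 F)
  (1 / 6 * Q ^+ 3 * (Q - 1) * (Q ^+ 2 - 1)) (1 / 6 * Q ^+ 3 * (Q - 1) ^+ 2 * (Q + 4))
  (1 / 6 * Q ^+ 3 * (Q ^+ 2 - 1) * (Q + 2)) (1 / 6 * Q ^+ 2 * (Q ^+ 2 - 1) * (Q ^+ 2 - 2)).
Proof.
rewrite /o14_1 (@orbit_ofE _ _ (mat3 1 0 0 0 1 0 0 0 0) (mat3 0 0 0 0 1 0 0 0 1)); try by orbit_rep.
apply: (@line_hyperplane_numbers F char2 _ _
  (fun '(l, m, n, a) => (a, a, a, l, m, n)) (fun '(a, b, c, l, m, n) => (l, m, n, a))
  (fun '(x, y, z) => y * z) (fun '(x, y, z) => x * z) (fun '(x, y, z) => x * y) (fun '(x, y, z)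
    => x ^+ 2 + y ^+ 2 + z ^+ 2)
  Q (Q ^+ 2 * (Q - 1) + Q * (3 * Q - 2)) 1 (6 * (Q - 1))).
- by rewrite tr_mat3.
- by rewrite tr_mat3.
- by case=> [[[]]].
- par_perp.
- prK.
- qeval_par.
- nucleus_box (@zero_pred F) (@zero_pred F) (@zero_pred F) (@any_pred F).
- value_sum (fun l m n : F => l * m * n) (fun l m : F => l + m) (1 : F) char2.
  (* The zeros of l m (l + m) form three lines through the origin, whence 3Q - 2. *)
  transitivity (\sum_(l : F) (if l == 0 then Q else 2)).
    apply: eq_bigr => l _; have [->|l0] := eqVneq l 0.
      rewrite (eq_bigr (fun=> 1)) => [|m _]; first by rewrite sumF_const mulr1.
      by rewrite !mul0r eqxx.
    rewrite (eq_bigr (fun m => (m == 0)%:R + (m == l)%:R)) => [|m _].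
      by rewrite big_split /= !sumF_eq1.
    rewrite !mulf_eq0 (negPf l0) /= [l + m]addrC char2_addr_eq0 //.
    by have [->|_] := eqVneq m 0; rewrite /= ?[0 == l]eq_sym ?(negPf l0) ?addr0 ?add0r.
  rewrite (@sumF_split _ 0 _ 2) => [|l /negPf-> //]; rewrite eqxx; ring.
- zeros_box (@zero_pred F) (@zero_pred F) (@zero_pred F);
  apply/and4P/and3P => [[/eqP e1 /eqP e2 /eqP e3 /eqP e4]|[/eqP-> /eqP-> /eqP->]];
    last by split; apply/eqP; ring.
  have x0 : x = 0 by apply: mulxxx_eq0; apply: (lincomb3 (c := x) (c' := y) (c2 := z) e4 e3 e2);
    char2_ring.
  have y0 : y = 0 by apply: mulxxx_eq0; apply: (lincomb3 (c := y) (c' := x) (c2 := z) e4 e3 e1);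
    char2_ring.
  have z0 : z = 0 by apply: mulxxx_eq0; apply: (lincomb3 (c := z) (c' := x) (c2 := y) e4 e2 e1);
    char2_ring.
  by rewrite x0 y0 z0; split; apply/eqP.
- by rewrite (stab_o14 char2); ring.
- stab_neq0.
- by field.
- by field.
- by field.
- by field.
Qed.

Lemma o15_1_numbers (u v : F) (v0 : v != 0) (hv : forall x, v * x ^+ 2 + u * v * x - 1 != 0) :
  hyperplane_numbers (o15_1 u v)
  (1 / 2 * Q ^+ 3 * (Q - 1) * (Q ^+ 2 - 1)) (1 / 2 * Q ^+ 3 * (Q - 1) ^+ 2 * (Q + 2))
  (1 / 2 * Q ^+ 4 * (Q ^+ 2 - 1)) (1 / 2 * Q ^+ 4 * (Q ^+ 2 - 1)).
Proof.
have [r rE] := sqrtP char2 v; have [t tE] := sqrtP char2 (u * v).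
rewrite /o15_1 (@orbit_ofE _ _ (mat3 0 1 0 1 u 0 0 0 1) (mat3 v 0 0 0 1 0 0 0 0)); try by orbit_rep.
apply: (@line_hyperplane_numbers F char2 _ _
  (fun '(m, n, l, a) => (a, v * a, n + u * v * a, l, m, n)) (fun '(a, b, c, l, m, n) => (m, n,
    l, a))
  (fun '(x, y, z) => x * z) (fun '(x, y, z) => z ^+ 2 + x * y) (fun '(x, y, z) => y * z) (fun
    '(x, y, z) => x ^+ 2 + v * y ^+ 2 + u * v * z ^+ 2)
  Q (Q ^+ 2 * (Q - 1) + Q * Q) 1 (2 * (Q - 1))).
- by rewrite tr_mat3.
- by rewrite tr_mat3.
- by case=> [[[]]].
- par_perp.
- move=> [[[[[? ?] ?] ?] ?] ?]; rewrite /perp !pairing_mat3 => /andP[/eqP E1 /eqP E2].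
  congr (_, _, _, _, _, _); first by apply: (lincomb1 (c := 1) E2); char2_ring.
  by apply: (lincomb2 (c := 1) (c' := u) E1 E2); char2_ring.
- qeval_par.
- nucleus_box (@zero_pred F) (@zero_pred F) (@zero_pred F) (@any_pred F).
(* The coefficient of a is l^2 + v m^2 + uv n^2 = (l + r m + t n)^2. *)
- apply: (@sum4_affine_square _ char2 _ (fun m n l => n ^+ 3 + l * m * n)
    (fun m n => r * m + t * n) 1).
  + by rewrite oner_neq0.
  + by move=> m n l a; rewrite /nucleus_value /= -tE -rE; char2_ring.
  + apply: sum2_right0 => m n; have [->|n0] := eqVneq n 0.
      by apply/eqP; ring.
    (* After division by n, squaring removes the square roots r and t and leaves the norm form at
       (n^2, m^2). *)
    apply/eqP => E; have nz : (n ^+ 2, m ^+ 2) != (0, 0) by rewrite xpair_eqE !sqrf_eq0 (negPf n0).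
    have E' : n ^+ 2 + (r * m + t * n) * m = 0 by apply: (mulfI n0); rewrite mulr0 -E; ring.
    have /eqP[] := norm_neq0 char2 v0 hv nz.
    by apply: (lincomb1 (c := n ^+ 2 + (r * m + t * n) * m) E'); rewrite -tE -rE; char2_ring.
- zeros_box (@zero_pred F) (@zero_pred F) (@zero_pred F);
  apply/and4P/and3P => [[/eqP e1 /eqP e2 /eqP e3 /eqP e4]|[/eqP-> /eqP-> /eqP->]];
    last by split; apply/eqP; ring.
  have z0 : z = 0.
    by apply: mulxxx_eq0; apply: (lincomb2 (c := z) (c' := x) e2 e3); char2_ring.
  have x0 : x = 0.
    by apply: mulxxx_eq0; apply: (lincomb2 (c := x) (c' := v * y) e4 e2); rewrite z0; char2_ring.
  have y0 : y = 0.
    by apply: mulxx_eq0; apply: (mulfI v0); apply: (lincomb1 (c := 1) e4); rewrite x0 z0;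
      char2_ring.
  by rewrite x0 y0 z0; split; apply/eqP.
- by rewrite (stab_o15 char2 v0 hv); ring.
- stab_neq0.
- by field.
- by field.
- by field.
- by field.
Qed.

Lemma o16_1_numbers : hyperplane_numbers (o16_1 F)
  (Q * (Q + 1) * (Q ^+ 2 - 1)) (Q * (Q ^+ 2 - 1))
  (Q * (Q ^+ 2 - 1)) (Q ^+ 2 * (Q + 1)).
Proof.
rewrite /o16_1 (@orbit_ofE _ _ (mat3 0 0 1 0 1 0 1 0 0) (mat3 0 0 0 0 0 1 0 1 0)); try by orbit_rep.
apply: (@line_hyperplane_numbers F char2 _ _
  (fun '(a, m, n, c) => (a, m, c, 0, m, n)) (fun '(a, b, c, l, m, n) => (a, m, n, c))
  (fun '(x, y, z) => x ^+ 2) (fun '(x, y, z) => y ^+ 2 + x * z) (fun '(x, y, z) => x * y) (fun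
    '(x, y, z) => z ^+ 2)
  (Q ^+ 2) (Q ^+ 2 * (Q - 1) + Q * Q) 1 (Q ^+ 2 * (Q - 1) ^+ 2)).
- by rewrite tr_mat3.
- by rewrite tr_mat3.
- by case=> [[[]]].
- par_perp.
- prK.
- qeval_par.
- nucleus_box (@any_pred F) (@zero_pred F) (@zero_pred F) (@any_pred F).
- value_sum (fun _ m _ : F => m ^+ 3) (fun _ _ : F => (0 : F)) (1 : F) char2.
  by apply: sum2_right0 => ? ?; rewrite expf_eq0.
- zeros_box (@zero_pred F) (@zero_pred F) (@zero_pred F);
  apply/and4P/and3P => [[/eqP e1 /eqP e2 /eqP e3 /eqP e4]|[/eqP-> /eqP-> /eqP->]];
    last by split; apply/eqP; ring.
  have x0 : x = 0 by apply: mulxx_eq0; rewrite -e1; ring.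
  have z0 : z = 0 by apply: mulxx_eq0; rewrite -e4; ring.
  by split; apply/eqP => //; apply: mulxx_eq0; rewrite -e2 x0; ring.
- by rewrite (stab_o16_1 char2); ring.
- stab_neq0.
- by field.
- by field.
- by field.
- by field.
Qed.

Lemma o16_3_numbers : hyperplane_numbers (o16_3 F)
  (Q * (Q - 1) * (Q ^+ 2 - 1)) (Q * (Q - 1) ^+ 2 * (Q + 2))
  (Q ^+ 2 * (Q ^+ 2 - 1)) (Q ^+ 2 * (Q ^+ 2 - 1)).
Proof.
rewrite /o16_3 (@orbit_ofE _ _ (mat3 0 0 1 0 1 0 1 0 0) (mat3 0 0 0 0 0 1 0 1 1)); try by orbit_rep.
apply: (@line_hyperplane_numbers F char2 _ _
  (fun '(m, n, l, a) => (a, m, l, l, m, n)) (fun '(a, b, c, l, m, n) => (m, n, l, a))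
  (fun '(x, y, z) => y ^+ 2 + x * z) (fun '(x, y, z) => x * y) (fun '(x, y, z) => z ^+ 2 + y *
    z) (fun '(x, y, z) => x ^+ 2)
  Q (Q ^+ 2 * (Q - 1) + Q * Q) 1 (Q ^+ 2 * (Q - 1))).
- by rewrite tr_mat3.
- by rewrite tr_mat3.
- by case=> [[[]]].
- par_perp.
- prK.
- qeval_par.
- nucleus_box (@zero_pred F) (@zero_pred F) (@zero_pred F) (@any_pred F).
- value_sum (fun m n l : F => m ^+ 3 + l * n ^+ 2 + l * m * n) (fun _ _ : F => (0 : F)) (1 : F)
  char2.
  by apply: sum2_left0 => ? ?; rewrite !mul0r !addr0 expf_eq0.
- zeros_box (@zero_pred F) (@zero_pred F) (@zero_pred F);
  apply/and4P/and3P => [[/eqP e1 /eqP e2 /eqP e3 /eqP e4]|[/eqP-> /eqP-> /eqP->]];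
    last by split; apply/eqP; ring.
  have x0 : x = 0 by apply: mulxx_eq0; rewrite -e4; ring.
  have y0 : y = 0 by apply: mulxx_eq0; rewrite -e1 x0; ring.
  by split; apply/eqP => //; apply: mulxx_eq0; rewrite -e3 y0; ring.
- by rewrite (stab_o16_3 char2); ring.
- stab_neq0.
- by field.
- by field.
- by field.
- by field.
Qed.

Lemma o17_numbers (alpha beta gamma : F) (habc : forall x, x ^+ 3 + gamma * x ^+ 2 - beta * x +
  alpha != 0) : hyperplane_numbers (o17 alpha beta gamma)
  (1 / 3 * Q ^+ 3 * (Q - 1) * (Q ^+ 2 - 1)) (1 / 3 * Q ^+ 3 * (Q - 1) * (Q ^+ 2 - 1))
  (1 / 3 * Q ^+ 3 * (Q - 1) * (Q ^+ 2 - 1)) (1 / 3 * Q ^+ 2 * (Q ^+ 4 - 1)).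
Proof.
have a0 := cubic_alpha_neq0 habc.
have [r rE] := sqrtP char2 (alpha * gamma); have [t tE] := sqrtP char2 beta.
rewrite /o17 (@orbit_ofE _ _ (mat3 alpha^-1 0 0 0 gamma 1 0 1 0) (mat3 0 1 0 1 beta 0 0 0 1));
  try by orbit_rep.
apply: (@line_hyperplane_numbers F char2 _ _
  (fun '(l, n, m, b) => (alpha * (gamma * b + l), b, beta * b + n, l, m, n)) (fun '(a, b, c, l,
    m, n) => (l, n, m, b))
  (fun '(x, y, z) => alpha * x ^+ 2 + y * z) (fun '(x, y, z) => z ^+ 2 + x * y) (fun '(x, y, z)
    => x * z) (fun '(x, y, z) => alpha * gamma * x ^+ 2 + y ^+ 2 + beta * z ^+ 2)
  Q (Q ^+ 2 * (Q - 1) + Q * 1) 1 (3 * (Q - 1))).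
- by rewrite tr_mat3.
- by rewrite tr_mat3.
- by case=> [[[]]].
- move=> [[[? ?] ?] ?]; rewrite /perp !pairing_mat3; apply/andP; split; apply/eqP;
  [by field2 char2; rewrite a0|char2_ring].
- move=> [[[[[? ?] ?] ?] ?] ?]; rewrite /perp !pairing_mat3 => /andP[/eqP E1 /eqP E2].
  congr (_, _, _, _, _, _).
    by apply: (lincomb1 (c := alpha) E1); field2 char2.
  by apply: (lincomb1 (c := 1) E2); char2_ring.
- qeval_par.
- nucleus_box (@zero_pred F) (@zero_pred F) (@zero_pred F) (@any_pred F).
(* The coefficient of b is m^2 + alpha gamma l^2 + beta n^2 = (m + r l + t n)^2. *)
- apply: (@sum4_affine_square _ char2 _ (fun l n m => alpha * l ^+ 3 + n ^+ 3 + l * m * n)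
    (fun l n => r * l + t * n) 1).
  + by rewrite oner_neq0.
  + by move=> l n m b; rewrite /nucleus_value /=;
    apply: (lincomb2 (c := b * l ^+ 2) (c' := b * n ^+ 2) rE tE); char2_ring.
  + apply: sum2_both0 => l n; apply/eqP/andP => [E|[/eqP-> /eqP->]]; last by ring.
    have E' : alpha ^+ 2 * l ^+ 6 + n ^+ 6 + l ^+ 2 * n ^+ 2 * (alpha * gamma * l ^+ 2 + beta *
      n ^+ 2) = 0.
      apply: (lincomb1 (c := alpha * l ^+ 3 + n ^+ 3 + l * (r * l + t * n) * n) E).
      by rewrite -rE -tE; char2_ring.
    have [n0|n0] := eqVneq n 0.
      move: E'; rewrite n0 => E'; split=> //.
      have /eqP : alpha ^+ 2 * l ^+ 6 = 0 by rewrite -E'; ring.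
      by rewrite mulf_eq0 !expf_eq0 (negPf a0).
    (* The squared equation [E'] is, up to the factor n^6 / alpha, the given cubic at alpha l^2 /
       n^2. *)
    have /eqP[] := habc (alpha * l ^+ 2 / n ^+ 2); have n6 : n ^+ 6 != 0 by rewrite expf_neq0.
    apply: (mulfI n6); apply: (lincomb1 (c := alpha) E'); field2 char2; exact: n0.
- zeros_box (@zero_pred F) (@zero_pred F) (@zero_pred F);
  apply/and4P/and3P => [[/eqP e1 /eqP e2 /eqP e3 /eqP e4]|[/eqP-> /eqP-> /eqP->]];
    last by split; apply/eqP; ring.
  have x0 : x = 0.
    apply: mulxxx_eq0; apply: (mulfI a0); apply: (lincomb2 (c := x) (c' := y) e1 e3); char2_ring.
  have z0 : z = 0 by apply: mulxx_eq0; rewrite -e2 x0; ring.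
  have y0 : y = 0 by apply: mulxx_eq0; rewrite -e4 x0 z0; ring.
  by rewrite x0 y0 z0; split; apply/eqP.
- by rewrite (stab_o17 char2 habc); ring.
- stab_neq0.
- by field.
- by field.
- by field.
- by field.
Qed.

End Orbits.

(** The additive group of F is a p-group for p the characteristic, and 2 divides its order. *)
Lemma char2_even_card (F : finFieldType) : ~~ odd #|F| -> 2%:R = 0 :> F.
Proof.
move=> even; have [p p_pr charp] := finPcharP F.
have /and3P[+ _ _] := fin_ring_pchar_abelem charp; rewrite /pgroup cardsT => np.
have pi2 : 2%N \in \pi(#|F|).
  by rewrite mem_primes /= dvdn2 even (ltnW (cardF_gt1 F)).
have /eqP p2 : 2%N == p by apply: (pnatPpi np).
by apply/eqP; move: charp; rewrite inE -p2 => /andP[].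
Qed.

Theorem theorem4p29 (q : nat) (F : finFieldType)
  (cardF : #|F| = q) (q_even : ~~ odd q)
  (u v0 v1 alpha beta gamma : F)
  (v0_neq0 : v0 != 0) (v1_neq0 : v1 != 0)
  (hv0 : forall lam : F, v0 * lam ^+ 2 + u * v0 * lam - 1 != 0)
  (hv1 : forall lam : F, v1 * lam ^+ 2 + u * v1 * lam - 1 != 0)
  (habc : forall lam : F,
     lam ^+ 3 + gamma * lam ^+ 2 - beta * lam + alpha != 0) :
  let Q : rat := q%:R in
  hyperplane_numbers (o5 F)
    (1 / 2 * Q * (Q + 1))
    (2 * Q ^+ 2 + Q)
    0
    (1 / 2 * Q * (Q + 1)) /\
  hyperplane_numbers (o6 F)
    ((Q + 1) ^+ 2)
    (3 * Q + 1)
    (Q + 1)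
    (Q + 1) /\
  hyperplane_numbers (o8_1 F)
    (Q ^+ 2 * (Q ^+ 2 - 1))
    ((2 * Q + 3) * (Q - 1) * Q ^+ 2)
    (Q ^+ 2 * (Q + 1))
    (Q * (Q + 1) * (Q ^+ 2 - 1)) /\
  hyperplane_numbers (o8_3 F)
    (Q ^+ 2 * (Q + 1))
    (2 * Q ^+ 2)
    0
    (Q * (Q + 1)) /\
  hyperplane_numbers (o9 F)
    (Q * (Q ^+ 2 - 1))
    (2 * Q * (Q ^+ 2 - 1))
    0
    (Q ^+ 2 * (Q + 1)) /\
  hyperplane_numbers (o10 u v0)
    (1 / 2 * Q * (Q - 1))
    (Q * (Q - 1))
    (Q ^+ 2)
    (1 / 2 * Q * (Q - 1)) /\
  hyperplane_numbers (o12_1 F)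
    (Q ^+ 2 + Q + 1)
    1
    1
    1 /\
  hyperplane_numbers (o12_3 F)
    ((Q + 1) * (Q ^+ 2 - 1))
    ((Q - 1) * (2 * Q + 1))
    ((Q + 1) * (2 * Q - 1))
    (Q ^+ 2 - 1) /\
  hyperplane_numbers (o13_1 F)
    (Q ^+ 2 * (Q + 1) * (Q ^+ 2 - 1))
    (Q ^+ 2 * (Q - 1) * (Q + 2))
    (Q ^+ 3 * (Q + 1))
    (Q * (Q + 1) * (Q ^+ 2 - 1)) /\
  hyperplane_numbers (o13_3 F)
    (Q ^+ 2 * (Q - 1) * (Q ^+ 2 - 1))
    (Q ^+ 2 * (Q + 3) * (Q - 1) ^+ 2)
    (Q ^+ 2 * (Q + 1) * (Q ^+ 2 - 1))
    (Q * (Q ^+ 2 - 1) ^+ 2) /\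
  hyperplane_numbers (o14_1 F)
    (1 / 6 * Q ^+ 3 * (Q - 1) * (Q ^+ 2 - 1))
    (1 / 6 * Q ^+ 3 * (Q - 1) ^+ 2 * (Q + 4))
    (1 / 6 * Q ^+ 3 * (Q ^+ 2 - 1) * (Q + 2))
    (1 / 6 * Q ^+ 2 * (Q ^+ 2 - 1) * (Q ^+ 2 - 2)) /\
  hyperplane_numbers (o15_1 u v1)
    (1 / 2 * Q ^+ 3 * (Q - 1) * (Q ^+ 2 - 1))
    (1 / 2 * Q ^+ 3 * (Q - 1) ^+ 2 * (Q + 2))
    (1 / 2 * Q ^+ 4 * (Q ^+ 2 - 1))
    (1 / 2 * Q ^+ 4 * (Q ^+ 2 - 1)) /\
  hyperplane_numbers (o16_1 F)
    (Q * (Q + 1) * (Q ^+ 2 - 1))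
    (Q * (Q ^+ 2 - 1))
    (Q * (Q ^+ 2 - 1))
    (Q ^+ 2 * (Q + 1)) /\
  hyperplane_numbers (o16_3 F)
    (Q * (Q - 1) * (Q ^+ 2 - 1))
    (Q * (Q - 1) ^+ 2 * (Q + 2))
    (Q ^+ 2 * (Q ^+ 2 - 1))
    (Q ^+ 2 * (Q ^+ 2 - 1)) /\
  hyperplane_numbers (o17 alpha beta gamma)
    (1 / 3 * Q ^+ 3 * (Q - 1) * (Q ^+ 2 - 1))
    (1 / 3 * Q ^+ 3 * (Q - 1) * (Q ^+ 2 - 1))
    (1 / 3 * Q ^+ 3 * (Q - 1) * (Q ^+ 2 - 1))
    (1 / 3 * Q ^+ 2 * (Q ^+ 4 - 1)).
Proof.
have char2 : 2%:R = 0 :> F by apply: char2_even_card; rewrite cardF.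
move=> Q0; have -> : Q0 = qF F by rewrite /Q0 -cardF.
split; first exact: o5_numbers.
split; first exact: o6_numbers.
split; first exact: o8_1_numbers.
split; first exact: o8_3_numbers.
split; first exact: o9_numbers.
split; first exact: o10_numbers.
split; first exact: o12_1_numbers.
split; first exact: o12_3_numbers.
split; first exact: o13_1_numbers.
split; first exact: o13_3_numbers.
split; first exact: o14_1_numbers.
split; first exact: o15_1_numbers.
split; first exact: o16_1_numbers.
split; first exact: o16_3_numbers.
exact: o17_numbers.
Qed.
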